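(* If $q\in\mathcal{GC}^\infty([t_1,t_2],\widetilde{\mathbb R}^d)$ is a weak extremal of the functional $J$ (i.e. $\delta J(q;h)=0$ for all $h\in\mathcal{GC}^\infty_0(m)$), then on $[t_1,t_2]$ $$\frac{d}{dt}\left(L[q]^m-\sum_{j=1}^m\varphi^j(q)\cdot q^{(j)}\right)=\partial_1L[q]^m,$$ where, for $j=0,\ldots,m$ and $t\in[t_1,t_2]$, $$\varphi^j(q)(t):=\sum_{i=0}^{m-j}(-1)^i\frac{d^i}{dt^i}\,\partial_{i+j+2}L[q]^m(t).$$
   Context: Ring of scalars. Fix a net $\rho=(\rho_\varepsilon)_{\varepsilon\in(0,1]}$ in $(0,1]$ with $\rho_\varepsilon\to0$ as $\varepsilon\to0^+$. ''For $\varepsilon$ small'' means: for all $\varepsilon\in(0,\varepsilon_0]$, for some $\varepsilon_0\in(0,1]$. A net $(x_\varepsilon)\in\mathbb R^{(0,1]}$ is moderate if there is $N\in\mathbb N$ with $|x_\varepsilon|\le\rho_\varepsilon^{-N}$ for $\varepsilon$ small; $(x_\varepsilon)\sim(y_\varepsilon)$ if for all $n\in\mathbb N$, $|x_\varepsilon-y_\varepsilon|\le\rho_\varepsilon^n$ for $\varepsilon$ small. $\widetilde{\mathbb R}$ is the ring of moderate nets modulo $\sim$ with pointwise operations; classes are written $[x_\varepsilon]$, similarly for $\widetilde{\mathbb R}^n$. Order: $x\le y$ iff there are representatives $x=[x_\varepsilon]$, $y=[y_\varepsilon]$ with $x_\varepsilon\le y_\varepsilon$ for all $\varepsilon$; $x<y$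 means $x\le y$ and $y-x$ is invertible; $\widetilde{\mathbb R}_{>0}=\{x: x>0\}$. $[a,b]=\{x\in\widetilde{\mathbb R}: a\le x\le b\}$, $(a,b)=\{x: a<x<b\}$, $|[x_\varepsilon]|=[|x_\varepsilon|]$, $B_r(c)=\{x\in\widetilde{\mathbb R}^n:|x-c|<r\}$ for $r\in\widetilde{\mathbb R}_{>0}$. The sharp topology on $\widetilde{\mathbb R}^n$ has these balls as a base; all topological notions refer to it. Generalized smooth functions (GSF). For $\Omega_\varepsilon\subseteq\mathbb R^n$, $\langle\Omega_\varepsilon\rangle$ is the set of $[x_\varepsilon]\in\widetilde{\mathbb R}^n$ such that for every representative $(x'_\varepsilon)$ one has $x'_\varepsilon\in\Omega_\varepsilon$ for $\varepsilon$ small. For $X\subseteq\widetilde{\mathbb R}^n$, $Y\subseteq\widetilde{\mathbb R}^k$, a map $f:X\to Y$ is a GSF, $f\in\mathcal{GC}^\infty(X,Y)$, if there is a net $f_\varepsilon\in C^\infty(\Omega_\varepsilon,\mathbb R^k)$, $\Omega_\varepsilon\subseteq\mathbb R^n$ open, with $X\subseteq\langle\Omega_\varepsilon\rangle$, $f([x_\varepsilon])=[f_\varepsilon(x_\varepsilon)]\in Y$ and $(\partial^\alpha f_\varepsilon(x_\varepsilon))$ moderate for all $[x_\varepsilon]\in X$ and all multi-indices $\alpha$ (one may always choose $\Omega_\varepsilon=\mathbb R^n$). Derivatives at sharply interior points are $\partial^\alpha f([x_\varepsilon])=[\partial^\alpha f_\varepsilon(x_\varepsilon)]$ (independent of choices),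 and at endpoints of intervals they are the sharp limits from interior points. For $f\in\mathcal{GC}^\infty([a,b],\widetilde{\mathbb R})$ and $c=[c_\varepsilon],e=[e_\varepsilon]\in[a,b]$, $\int_c^e f(t)\,dt=[\int_{c_\varepsilon}^{e_\varepsilon}f_\varepsilon(t)\,dt]$ for any $f_\varepsilon\in C^\infty(\mathbb R,\mathbb R)$ defining $f$. Variational setting. Let $t_1<t_2$ in $\widetilde{\mathbb R}$, $d,m\in\mathbb N_{>0}$, $L\in\mathcal{GC}^\infty([t_1,t_2]\times\widetilde{\mathbb R}^{d(m+1)},\widetilde{\mathbb R})$. For $q\in\mathcal{GC}^\infty([t_1,t_2],\widetilde{\mathbb R}^d)$ set $[q]^m(t)=(t,q(t),\dot q(t),\ldots,q^{(m)}(t))$, $L[q]^m(t)=L(t,q(t),\ldots,q^{(m)}(t))$, $J[q]=J(q)=\int_{t_1}^{t_2}L[q]^m(t)\,dt$. $\partial_1L$ is the partial derivative in $t$, and $\partial_{i+2}L$ ($0\le i\le m$) is the gradient with respect to the $\widetilde{\mathbb R}^d$-argument into which $q^{(i)}$ is inserted; $\partial_jL[q]^m(t)$ is $\partial_jL$ evaluated at $[q]^m(t)$. $\mathcal{GC}^\infty_0(m)$ is the set of $h\in\mathcal{GC}^\infty([t_1,t_2],\widetilde{\mathbb R}^d)$ with $h^{(i)}(t_1)=h^{(i)}(t_2)=0$ for $i=0,\ldots,m-1$. First variation: $\delta J(q;h)=\frac{d}{ds}J(q+sh)|_{s=0}$. *)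

(* Defs.v *)
From HB Require Import structures.
From mathcomp Require Import all_boot all_order all_algebra.
From mathcomp Require Import ring_quotient.
From mathcomp Require Import all_classical all_reals all_analysis.
Set Implicit Arguments.
Unset Strict Implicit.
Unset Printing Implicit Defensive.
Import Order.TTheory GRing.Theory Num.Theory.
Import numFieldNormedType.Exports.
Local Open Scope classical_set_scope.
Local Open Scope ring_scope.

(* A net indexed by (0, 1] is encoded as a total function of a real variable e,
   its values off (0, 1] being irrelevant; "for e small" is the library's
   filter 0^'+ of right neighbourhoods of 0. *)

Record gauge (R : realType) := Gauge {
  gauge_fun :> R -> R;
  gauge_range : forall e, 0 < e <= 1 -> 0 < gauge_fun e <= 1;
  gauge_cvg : gauge_fun e @[e --> 0^'+] --> (0 : R)
}.

Section GeneralizedNumbers.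
Context {R : realType} (rho : gauge R).

Definition moderate : {pred (R -> R)} := fun x : R -> R =>
  `[< exists N : nat, \forall e \near 0^'+, `|x e| <= rho e ^- N >].

Lemma gauge_near (d : R) : 0 < d ->
  \forall e \near 0^'+, 0 < rho e /\ rho e <= d.
Proof.
move=> d0; near=> e.
have e01 : 0 < e <= 1 by apply/andP; split; near: e;
  [exact: nbhs_right_gt | exact: nbhs_right_le].
have /andP[r0 _] := gauge_range rho e01; split=> //.
rewrite ltW//; have : `|0 - rho e| < d.
  by near: e; have /cvgrPdist_lt/(_ _ d0) := @gauge_cvg _ rho.
by rewrite sub0r normrN gtr0_norm.
Unshelve. all: by end_near. Qed.

Lemma moderate_subring : subring_closed moderate.
Proof.
have half : (0 < 2^-1 :> R) by rewrite invr_gt0.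
have powle N M (r : R) : 0 < r -> r <= 2^-1 -> (N <= M)%N -> r ^- N <= r ^- M.
  move=> r0 r2 NM; rewrite lef_pV2 ?posrE ?exprn_gt0//.
  apply: ler_wiXn2l => //; first exact: ltW.
  by rewrite (le_trans r2)// invf_le1// ler1n.
split.
- apply/asboolP; exists 0%N; near=> e.
  by rewrite expr0 invr1 normr1.
- move=> x y /asboolP[N xN] /asboolP[M yM]; apply/asboolP.
  exists (maxn N M).+1; near=> e.
  have [r0 r2] : 0 < rho e /\ rho e <= 2^-1 by near: e; exact: gauge_near.
  have hx : `|x e| <= rho e ^- maxn N M.
    apply: le_trans (powle _ _ _ r0 r2 (leq_maxl N M)); near: e; exact: xN.
  have hy : `|y e| <= rho e ^- maxn N M.
    apply: le_trans (powle _ _ _ r0 r2 (leq_maxr N M)); near: e; exact: yM.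
  apply: (le_trans (ler_normB _ _)); apply: (le_trans (lerD hx hy)).
  rewrite -mulr2n -mulr_natl exprS invfM ler_wpM2r//.
    by rewrite invr_ge0 exprn_ge0// ltW.
  by rewrite -[leLHS]invrK lef_pV2 ?posrE ?invr_gt0.
- move=> x y /asboolP[N xN] /asboolP[M yM]; apply/asboolP.
  exists (N + M)%N; near=> e.
  rewrite /GRing.mul/= normrM exprD invfM ler_pM//.
    near: e; exact: xN.
  near: e; exact: yM.
Unshelve. all: by end_near. Qed.

HB.instance Definition _ :=
  GRing.isSubringClosed.Build (R -> R) moderate moderate_subring.

Record mnet := MNet {
  mnet_fun :> R -> R;
  mnet_moderate : mnet_fun \in moderate
}.

HB.instance Definition _ := [isSub for mnet_fun].
HB.instance Definition _ := [Choice of mnet by <:].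
HB.instance Definition _ := [SubChoice_isSubComNzRing of mnet by <:].

Definition negligible : {pred mnet} := fun x : mnet =>
  `[< forall n : nat, \forall e \near 0^'+, `|x e| <= rho e ^+ n >].

Lemma negligible_ideal : idealr_closed negligible.
Proof.
have half : (0 < 2^-1 :> R) by rewrite invr_gt0.
split.
- apply/asboolP => n; near=> e.
  have [r0 _] : 0 < rho e /\ rho e <= 2^-1 by near: e; exact: gauge_near.
  by rewrite normr0 exprn_ge0// ltW.
- apply/negP => /asboolP /(_ 1%N) h.
  have : \forall e \near (0:R)^'+, False.
    near=> e.
    have [_ r2] : 0 < rho e /\ rho e <= 2^-1 by near: e; exact: gauge_near.
    have : `|(1 : mnet) e| <= rho e ^+ 1 by near: e; exact: h.
    rewrite expr1 normr1 => /le_trans/(_ r2).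
    by rewrite leNgt invf_lt1 ?ltr1n.
  by move=> /filter_ex[].
- move=> a x y /asboolP hx /asboolP hy; apply/asboolP => n.
  have /asboolP[N aN] := mnet_moderate a.
  near=> e.
  have [r0 r2] : 0 < rho e /\ rho e <= 2^-1 by near: e; exact: gauge_near.
  have -> : (a * x + y) e = a e * x e + y e by [].
  apply: (le_trans (ler_normD _ _)); rewrite normrM.
  have h1 : `|a e| * `|x e| <= rho e ^+ n.+1.
    have : `|a e| * `|x e| <= rho e ^- N * rho e ^+ (N + n.+1).
      apply: ler_pM => //; first by near: e; exact: aN.
      near: e; exact: hx.
    by rewrite exprD mulKf// expf_neq0// gt_eqF.
  have h2 : `|y e| <= rho e ^+ n.+1 by near: e; exact: hy.
  apply: (le_trans (lerD h1 h2)).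
  rewrite -mulr2n -mulr_natl exprS mulrA; apply: ler_piMl.
    by rewrite exprn_ge0// ltW.
  by rewrite mulrC -ler_pdivlMr// mul1r.
Unshelve. all: by end_near. Qed.

HB.instance Definition _ := isIdealr.Build mnet negligible negligible_ideal.

Definition gnum := {ideal_quot negligible}.

End GeneralizedNumbers.

Section GeneralizedSmoothFunctions.
Context {R : realType} {rho : gauge R}.
Local Notation Rt := (gnum rho).

(* (x_e) is a representative of x; in particular it is moderate. *)
Definition rep (x : Rt) (xe : R -> R) :=
  exists2 u : mnet rho, xe = u & x = (\pi_Rt u)%qT.

(* The class [x_e]; it is 0 when (x_e) is not moderate. *)
Definition cls (xe : R -> R) : Rt :=
  if insub xe is Some u then (\pi_Rt (u : mnet rho))%qT else 0.

Definition vrep n (x : 'rV[Rt]_n) (xe : R -> 'rV[R]_n) :=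
  forall j, rep (x 0 j) (fun e => xe e 0 j).

Definition vmoderate n (xe : R -> 'rV[R]_n) :=
  forall j, (fun e => xe e 0 j) \in moderate rho.

Definition gle (x y : Rt) := exists xe ye,
  [/\ rep x xe, rep y ye & forall e, 0 < e <= 1 -> xe e <= ye e].

Definition glt (x y : Rt) := gle x y /\ exists z : Rt, (y - x) * z = 1.

Definition gcc (a b : Rt) : set Rt := [set x | gle a x /\ gle x b].

(* The norm of R^n is the library's sup norm, which is equivalent to the
   Euclidean one and so gives the same sharp topology. *)
Definition gnorm n (x : 'rV[Rt]_n) : Rt :=
  cls (fun e => `|\row_j ((repr (x 0 j) : mnet rho) e)|).

Definition gball n (c : 'rV[Rt]_n) (r : Rt) : set 'rV[Rt]_n :=
  [set x | glt (gnorm (x - c)) r].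

Definition sharp_interior n (X : set 'rV[Rt]_n) : set 'rV[Rt]_n :=
  [set x | exists2 r, glt 0 r & gball x r `<=` X].

Definition strong_internal n (Om : R -> set 'rV[R]_n) : set 'rV[Rt]_n :=
  [set x | forall xe, vrep x xe -> \forall e \near 0^'+, Om e (xe e)].

Definition partial n k (i : 'I_n) (f : 'rV[R]_n -> 'rV[R]_k) :=
  fun x => 'D_(delta_mx 0 i) f x.

(* Multi-indices are words of coordinates (the order of differentiation being
   immaterial for smooth functions): d_(i1) ... d_(ir) f. *)
Definition partials n k (s : seq 'I_n) (f : 'rV[R]_n -> 'rV[R]_k) :=
  foldr (@partial n k) f s.

Definition smooth_on n k (Om : set 'rV[R]_n) (f : 'rV[R]_n -> 'rV[R]_k) :=
  forall s x, Om x -> {for x, continuous (partials s f)} /\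
    forall i, derivable (partials s f) x (delta_mx 0 i).

(* f : X -> Rt^k is defined by the net of smooth functions u_e on Om_e; only
   the values of f on X matter. *)
Definition gsf_net n k (X : set 'rV[Rt]_n) (f : 'rV[Rt]_n -> 'rV[Rt]_k)
    (Om : R -> set 'rV[R]_n) (u : R -> 'rV[R]_n -> 'rV[R]_k) :=
  [/\ forall e, 0 < e <= 1 -> open (Om e) /\ smooth_on (Om e) (u e),
      X `<=` strong_internal Om &
      forall x xe, X x -> vrep x xe ->
        vrep (f x) (fun e => u e (xe e)) /\
        forall s, vmoderate (fun e => partials s (u e) (xe e))].

Definition gsf n k (X : set 'rV[Rt]_n) (f : 'rV[Rt]_n -> 'rV[Rt]_k) :=
  exists Om u, gsf_net X f Om u.

Definition interior_partial n k (X : set 'rV[Rt]_n) (i : 'I_n)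
    (f : 'rV[Rt]_n -> 'rV[Rt]_k) (x : 'rV[Rt]_n) (y : 'rV[Rt]_k) :=
  exists Om u xe, [/\ gsf_net X f Om u, vrep x xe &
    vrep y (fun e => partial i (u e) (xe e))].

(* At the points of X that are not sharply interior, the derivative is the
   sharp limit of its values at sharply interior points. *)
Definition is_gpartial n k (X : set 'rV[Rt]_n) (i : 'I_n)
    (f : 'rV[Rt]_n -> 'rV[Rt]_k) (x : 'rV[Rt]_n) (y : 'rV[Rt]_k) :=
  (sharp_interior X x /\ interior_partial X i f x y) \/
  (~ sharp_interior X x /\
   forall r, glt 0 r -> exists2 s, glt 0 s &
     forall x', sharp_interior X x' -> gball x s x' ->
       exists2 y', interior_partial X i f x' y' & gball y r y').

Definition gpartial n k (X : set 'rV[Rt]_n) (i : 'I_n)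
    (f : 'rV[Rt]_n -> 'rV[Rt]_k) (x : 'rV[Rt]_n) : 'rV[Rt]_k :=
  xget 0 [set y | is_gpartial X i f x y].

(* Rt is identified with Rt^1, i.e. with 'rV[Rt]_1. *)
Definition sc (x : Rt) : 'rV[Rt]_1 := const_mx x.

Definition line (X : set Rt) : set 'rV[Rt]_1 := [set x | X (x 0 0)].

Definition gsf1 k (X : set Rt) (f : Rt -> 'rV[Rt]_k) :=
  gsf (line X) (fun x => f (x 0 0)).

Definition gder k (X : set Rt) (f : Rt -> 'rV[Rt]_k) : Rt -> 'rV[Rt]_k :=
  fun t => gpartial (line X) 0 (fun x => f (x 0 0)) (sc t).

Definition gdern k (X : set Rt) (i : nat) (f : Rt -> 'rV[Rt]_k) :=
  iter i (gder X) f.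

Definition gder_sc (X : set Rt) (f : Rt -> Rt) : Rt -> Rt :=
  fun t => gder X (fun s => sc (f s)) t 0 0.

Definition oriented_integral (a b : R) (f : R -> R) : R :=
  \int[lebesgue_measure]_(x in `[a, b]) f x
  - \int[lebesgue_measure]_(x in `[b, a]) f x.

(* Only the values of f_e between c_e and d_e, which belong to Om_e for e
   small, matter, so that Om_e need not be R. *)
Definition is_gintegral (a b : Rt) (f : Rt -> Rt) (c d y : Rt) :=
  exists Om u ce de,
    [/\ gsf_net (line (gcc a b)) (fun x => sc (f (x 0 0))) Om u,
        rep c ce, rep d de &
        rep y (fun e =>
          oriented_integral (ce e) (de e) (fun t => u e (const_mx t) 0 0))].

Definition gintegral (a b : Rt) (f : Rt -> Rt) (c d : Rt) : Rt :=
  xget 0 [set y | is_gintegral a b f c d y].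

End GeneralizedSmoothFunctions.

Section Variational.
Context {R : realType} {rho : gauge R}.
Local Notation Rt := (gnum rho).
Variables (t1 t2 : Rt) (d m : nat).

(* Rt * Rt^(d (m + 1)): the i-th block of d coordinates, obtained through
   mxvec from the i-th row of a matrix, receives the i-th derivative. *)
Local Notation jetsp := ('rV[Rt]_(1 + m.+1 * d)).

Variable L : jetsp -> Rt.

Definition jet_domain : set jetsp := [set x | gcc t1 t2 (lsubmx x 0 0)].

Definition jet (q : Rt -> 'rV[Rt]_d) (t : Rt) : jetsp :=
  row_mx (sc t) (mxvec (\matrix_(i < m.+1) gdern (gcc t1 t2) i q t)).

Definition Lagr_time (x : jetsp) : Rt :=
  gpartial jet_domain (lshift (m.+1 * d) 0) (sc \o L) x 0 0.

Definition Lagr_grad (i : 'I_m.+1) (x : jetsp) : 'rV[Rt]_d :=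
  \row_k gpartial jet_domain (rshift 1 (mxvec_index i k)) (sc \o L) x 0 0.

Definition action (q : Rt -> 'rV[Rt]_d) : Rt :=
  gintegral t1 t2 (fun t => L (jet q t)) t1 t2.

Definition first_variation (q h : Rt -> 'rV[Rt]_d) : Rt :=
  gder_sc setT (fun s => action (fun t => q t + s *: h t)) 0.

Definition admissible_variation (h : Rt -> 'rV[Rt]_d) :=
  gsf1 (gcc t1 t2) h /\
  forall i, (i < m)%N ->
    gdern (gcc t1 t2) i h t1 = 0 /\ gdern (gcc t1 t2) i h t2 = 0.

Definition weak_extremal (q : Rt -> 'rV[Rt]_d) :=
  forall h, admissible_variation h -> first_variation q h = 0.

(* For j <= m, the index i + j stays below m.+1, where inord is the identity. *)
Definition momentum (j : nat) (q : Rt -> 'rV[Rt]_d) (t : Rt) : 'rV[Rt]_d :=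
  \sum_(0 <= i < (m - j).+1)
    (-1) ^+ i *:
      gdern (gcc t1 t2) i (fun s => Lagr_grad (inord (i + j)) (jet q s)) t.

Definition dot (u v : 'rV[Rt]_d) : Rt := \sum_k u 0 k * v 0 k.

End Variational.

(* Main.v *)
From HB Require Import structures.
From mathcomp Require Import all_boot all_order all_algebra.
From mathcomp Require Import ring_quotient.
From mathcomp Require Import all_classical all_reals all_analysis.
From mathcomp Require Import ring lra zify.
Require Import Defs.
Set Implicit Arguments.
Unset Strict Implicit.
Unset Printing Implicit Defensive.
Import Order.TTheory GRing.Theory Num.Theory.
Import numFieldNormedType.Exports.
Local Open Scope classical_set_scope.
Local Open Scope ring_scope.

(** Noether's theorem for translations in time, for generalized smooth functions.
    Classically: with the momenta [phi j] one has [phi m = dL_m] and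
    [phi j = dL_j - D (phi j.+1)] for [j < m], [dL_j] being the gradient of [L] with
    respect to the [j]-th derivative. These relations alone give, for every
    function [w],

      [D (sum_(j < m) phi j.+1 * D^j w) = sum_(j <= m) dL_j * D^j w - phi 0 * w],

    because the left-hand side telescopes ([momenta_identity]). The identity is
    used twice.

    - With [w] a variation that vanishes to order [m] at the end points it is an
      integration by parts, and turns the vanishing of the first variation
      ([first_variationE]) into [int phi 0 * w = 0]. The choice
      [w = ((t - t1) (t2 - t)) ^ m * phi 0] is admissible and makes the integrand a
      weighted square, whence [phi 0 = 0] by [gintegral_weight_eq0]: these are
      the Euler-Lagrange equations ([euler_lagrange]).
    - With [w] the velocity it computes the derivative of the sum of the
      [phi j * D^j q]. As [phi 0 = 0], the result cancels the chain rule expansion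
      of the derivative of [L] along [q] ([D_Lagrangian]) up to the partial
      derivative of [L] in time.

    What remains is to justify this calculus on [t1, t2]. Derivatives are defined
    by arbitrary nets at sharply interior points and by sharp limits elsewhere,
    and integrals by arbitrary nets too. The main tool is that a statement about
    all nets of points is automatically uniform on internal sets ([uniform_near],
    [uniform_mod]). It yields moderate Lipschitz constants, hence independence of
    the representatives and of the nets, and shows that on the domains at hand a
    generalized derivative is represented by the derivative of any defining net
    ([gpartial_vrep]); the same is proved for integrals ([gintegral_rep]). The
    Leibniz and chain rules then follow from those for nets. Stability of smooth
    nets under products, compositions and integrals depending on a parameter is
    obtained from a coinductive description of smoothness ([snet]). For the first
    variation, the function [s |-> J (q + s h)] is recognized as generalized
    smooth by differentiating under the integral sign ([gder_param],
    [gder_family]). *)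

(** * Nets of real numbers and generalized numbers *)

Section Nets.
Context {R : realType} (rho : gauge R).
Local Notation Rt := (gnum rho).
Implicit Types x y z : R -> R.

(** Negligibility is stated for bare functions of [e], so that it applies to any
    expression without carrying a proof of moderateness along. *)
Definition negl x := forall n, \forall e \near 0^'+, `|x e| <= rho e ^+ n.

Lemma gauge_half : \forall e \near 0^'+, 0 < rho e <= 2^-1.
Proof.
have h : (0 < 2^-1 :> R) by rewrite invr_gt0.
by near=> e; apply/andP; near: e; exact: (gauge_near rho h).
Unshelve. all: by end_near. Qed.

Lemma near_unit : \forall e \near (0:R)^'+, 0 < e <= 1.
Proof.
by near=> e; apply/andP; split; near: e;
  [exact: nbhs_right_gt | exact: nbhs_right_le].
Unshelve. all: by end_near. Qed.

Lemma gauge_le1 (r : R) : 0 < r <= 2^-1 -> [/\ 0 < r, 0 <= r, r <= 1 & r * 2 <= 1].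
Proof. by move=> /andP[r0 r1]; split => //; lra. Qed.

(** One power of the gauge pays for a factor 2; constants are absorbed this way
    throughout. *)
Lemma powS_half (r : R) n : 0 < r <= 2^-1 -> r ^+ n.+1 * 2 <= r ^+ n.
Proof.
move=> /gauge_le1[r0 r1 r2 r3]; rewrite exprSr -mulrA ler_piMr//.
exact: exprn_ge0.
Qed.

Lemma mod_of_bound x N : (\forall e \near 0^'+, `|x e| <= rho e ^- N) ->
  x \in moderate rho.
Proof. by move=> h; apply/asboolP; exists N. Qed.

Lemma mod_bound x : x \in moderate rho ->
  exists N : nat, \forall e \near 0^'+, `|x e| <= rho e ^- N.
Proof. by move=> /asboolP. Qed.

Lemma modD x y : x \in moderate rho -> y \in moderate rho ->
  (fun e => x e + y e) \in moderate rho.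
Proof. exact: rpredD. Qed.

Lemma modN x : x \in moderate rho -> (fun e => - x e) \in moderate rho.
Proof. by move=> h; have := rpredN (moderate rho) x; rewrite h => ->. Qed.

Lemma modB x y : x \in moderate rho -> y \in moderate rho ->
  (fun e => x e - y e) \in moderate rho.
Proof. exact: rpredB. Qed.

Lemma modM x y : x \in moderate rho -> y \in moderate rho ->
  (fun e => x e * y e) \in moderate rho.
Proof. exact: rpredM. Qed.

Lemma mod0 : (fun=> 0 : R) \in moderate rho.
Proof. exact: rpred0. Qed.

Lemma mod1 : (fun=> 1 : R) \in moderate rho.
Proof. exact: rpred1. Qed.

Lemma mod_le x y : y \in moderate rho ->
  (\forall e \near 0^'+, `|x e| <= `|y e|) -> x \in moderate rho.
Proof.
move=> /mod_bound[N yN] xy; apply: (@mod_of_bound _ N); near=> e.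
by apply: (@le_trans _ _ `|y e|); near: e.
Unshelve. all: by end_near. Qed.

Lemma mod_norm x : x \in moderate rho -> (fun e => `|x e|) \in moderate rho.
Proof. by move=> h; apply: mod_le h _; near=> e; rewrite normr_id.
Unshelve. all: by end_near. Qed.

Lemma mod_sum (I : Type) (s : seq I) (F : I -> R -> R) :
  (forall i, F i \in moderate rho) ->
  (fun e => \sum_(i <- s) F i e) \in moderate rho.
Proof.
move=> h; elim: s => [|i s IH].
  by under eq_fun do rewrite big_nil; exact: mod0.
by under eq_fun do rewrite big_cons; exact: modD.
Qed.

Lemma mod_rhoV n : (fun e => rho e ^- n) \in moderate rho.
Proof.
apply: (@mod_of_bound _ n); near=> e.
have /gauge_le1[r0 _ _ _] : 0 < rho e <= 2^-1 by near: e; exact: gauge_half.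
by rewrite gtr0_norm// invr_gt0 exprn_gt0.
Unshelve. all: by end_near. Qed.

Lemma mod_small x : (\forall e \near 0^'+, `|x e| <= 1) -> x \in moderate rho.
Proof. by move=> h; apply: mod_le mod1 _; under eq_near do rewrite normr1. Qed.

Lemma mod_rhoX n : (fun e => rho e ^+ n) \in moderate rho.
Proof.
apply: mod_small; near=> e.
have /gauge_le1[r0 ? ? _] : 0 < rho e <= 2^-1 by near: e; exact: gauge_half.
by rewrite ger0_norm ?exprn_ge0// exprn_ile1.
Unshelve. all: by end_near. Qed.

Lemma negl_mod x : negl x -> x \in moderate rho.
Proof. by move=> /(_ 0%N) h; apply: mod_small. Qed.

Lemma negl_le x y : negl y -> (\forall e \near 0^'+, `|x e| <= `|y e|) -> negl x.
Proof.
move=> hy xy n; near=> e.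
by apply: (@le_trans _ _ `|y e|); near: e => //; exact: hy.
Unshelve. all: by end_near. Qed.

Lemma neglD x y : negl x -> negl y -> negl (fun e => x e + y e).
Proof.
move=> hx hy n; near=> e.
have r : 0 < rho e <= 2^-1 by near: e; exact: gauge_half.
apply: le_trans (powS_half n r); apply: (le_trans (ler_normD _ _)).
by rewrite mulr2n mulrDr mulr1 lerD//; near: e; [exact: hx|exact: hy].
Unshelve. all: by end_near. Qed.

Lemma neglM x y : x \in moderate rho -> negl y -> negl (fun e => x e * y e).
Proof.
move=> /mod_bound[N xN] hy n; near=> e.
have /gauge_le1[r0 _ _ _] : 0 < rho e <= 2^-1 by near: e; exact: gauge_half.
rewrite normrM; apply: (@le_trans _ _ (rho e ^- N * rho e ^+ (N + n))).
  by apply: ler_pM => //; near: e => //; exact: hy.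
by rewrite exprD mulKf// expf_neq0// gt_eqF.
Unshelve. all: by end_near. Qed.

Lemma negl_near0 x : (\forall e \near 0^'+, x e = 0) -> negl x.
Proof.
move=> h n; near=> e.
have /gauge_le1[r0 ? _ _] : 0 < rho e <= 2^-1 by near: e; exact: gauge_half.
have -> : x e = 0 by near: e.
by rewrite normr0 exprn_ge0.
Unshelve. all: by end_near. Qed.

Lemma negl_sum (I : Type) (s : seq I) (F : I -> R -> R) :
  (forall i, negl (F i)) -> negl (fun e => \sum_(i <- s) F i e).
Proof.
move=> h; elim: s => [|i s IH].
  by under eq_fun do rewrite big_nil; apply: negl_near0; near=> e.
by under eq_fun do rewrite big_cons; exact: neglD.
Unshelve. all: by end_near. Qed.

(** ** Representatives *)

Lemma negligibleP (u : mnet rho) : (u \in Defs.negligible (rho := rho)) <-> negl u.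
Proof. by split=> [/asboolP|h]; [|apply/asboolP]. Qed.

Lemma rep_mod (a : Rt) x : rep a x -> x \in moderate rho.
Proof. by move=> [u -> _]; exact: mnet_moderate. Qed.

Lemma rep_ex (a : Rt) : exists x, rep a x.
Proof. by exists (repr a : mnet rho); exists (repr a) => //; rewrite reprK. Qed.

Lemma rep_eq (a b : Rt) x y : rep a x -> rep b y ->
  a = b <-> negl (fun e => x e - y e).
Proof.
move=> [u -> ->] [v -> ->].
have -> : ((\pi_Rt u)%qT = (\pi_Rt v)%qT :> Rt) <-> (u - v \in Defs.negligible (rho := rho)).
  by rewrite Quotient.idealrBE; split=> [->//|/eqP].
exact: negligibleP.
Qed.

Lemma rep_uniq (a b : Rt) x : rep a x -> rep b x -> a = b.
Proof.
move=> h k; apply/(rep_eq h k); apply: negl_near0.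
by near=> e; rewrite subrr.
Unshelve. all: by end_near. Qed.

Lemma rep_cls x : x \in moderate rho -> rep (cls x : Rt) x.
Proof.
move=> h; rewrite /cls; case: insubP => [u _ ux|]; last by rewrite h.
by exists u.
Qed.

Lemma rep_negl (a : Rt) x y : rep a x -> negl (fun e => x e - y e) -> rep a y.
Proof.
move=> h n; have yE : y = fun e => x e - (x e - y e).
  by apply/funext => e; rewrite subKr.
have ym : y \in moderate rho.
  by rewrite yE; apply: modB (rep_mod h) (negl_mod n).
have -> : a = cls y by apply/(rep_eq h (rep_cls ym)); exact: n.
exact: rep_cls.
Qed.

Lemma rep_near (a : Rt) x y : rep a x -> (\forall e \near 0^'+, x e = y e) ->
  rep a y.
Proof.
move=> h xy; apply: (rep_negl h); apply: negl_near0; near=> e.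
by apply/eqP; rewrite subr_eq0; apply/eqP; near: e.
Unshelve. all: by end_near. Qed.

Lemma repD (a b : Rt) x y : rep a x -> rep b y ->
  rep (a + b) (fun e => x e + y e).
Proof. by move=> [u -> ->] [v -> ->]; exists (u + v) => //; rewrite rmorphD. Qed.

Lemma repN (a : Rt) x : rep a x -> rep (- a) (fun e => - x e).
Proof. by move=> [u -> ->]; exists (- u) => //; rewrite rmorphN. Qed.

Lemma repB (a b : Rt) x y : rep a x -> rep b y ->
  rep (a - b) (fun e => x e - y e).
Proof. by move=> ra rb; apply: repD => //; exact: repN. Qed.

Lemma repM (a b : Rt) x y : rep a x -> rep b y ->
  rep (a * b) (fun e => x e * y e).
Proof. by move=> [u -> ->] [v -> ->]; exists (u * v) => //; rewrite rmorphM. Qed.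

Lemma rep0 : rep (0 : Rt) (fun=> 0).
Proof. by exists 0 => //; rewrite rmorph0. Qed.

Lemma rep1 : rep (1 : Rt) (fun=> 1).
Proof. by exists 1 => //; rewrite rmorph1. Qed.

Lemma rep_sum (I : Type) (s : seq I) (a : I -> Rt) (F : I -> R -> R) :
  (forall i, rep (a i) (F i)) ->
  rep (\sum_(i <- s) a i) (fun e => \sum_(i <- s) F i e).
Proof.
move=> h; elim: s => [|i s IH].
  by rewrite big_nil; apply: rep_near rep0 _; near=> e; rewrite big_nil.
by rewrite big_cons; apply: rep_near (repD (h i) IH) _; near=> e; rewrite big_cons.
Unshelve. all: by end_near. Qed.

Lemma rep_eq0 (a : Rt) x : rep a x -> a = 0 <-> negl x.
Proof.
move=> h; have := rep_eq h rep0.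
by have -> : (fun e => x e - (fun=> 0) e) = x by apply/funext => e; rewrite subr0.
Qed.

(** ** Order *)

Lemma gle_rep (a b : Rt) x y : rep a x -> rep b y -> gle a b ->
  forall k, \forall e \near 0^'+, x e <= y e + rho e ^+ k.
Proof.
move=> ra rb [x' [y' [ra' rb' xy']]] k.
have nx := (rep_eq ra ra').1 erefl k.+1.
have ny := (rep_eq rb rb').1 erefl k.+1.
near=> e.
have r : 0 < rho e <= 2^-1 by near: e; exact: gauge_half.
have /xy' : 0 < e <= 1 by near: e; exact: near_unit.
have := powS_half k r.
have : `|x e - x' e| <= rho e ^+ k.+1 by near: e.
have : `|y e - y' e| <= rho e ^+ k.+1 by near: e.
by rewrite !ler_norml => /andP[? ?] /andP[? ?] ? ?; lra.
Unshelve. all: by end_near. Qed.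

(** Cutting [x] down to [y] changes it by a negligible net, so that a slack of
    every power of the gauge is harmless. *)
Lemma rep_gle (a b : Rt) x y : rep a x -> rep b y ->
  (forall k, \forall e \near 0^'+, x e <= y e + rho e ^+ k) -> gle a b.
Proof.
move=> ra rb h; exists (fun e => Num.min (x e) (y e)), y; split=> //.
  apply: (rep_negl ra) => k; near=> e.
  have /gauge_le1[r0 ? _ _] : 0 < rho e <= 2^-1 by near: e; exact: gauge_half.
  have := exprn_ge0 k (ltW r0).
  have : x e <= y e + rho e ^+ k by near: e; exact: h.
  rewrite ler_norml minEle; case: ifP => [_|/negbT]; first by lra.
  by rewrite -ltNge; lra.
by move=> e _; rewrite ge_min lexx orbT.
Unshelve. all: by end_near. Qed.

Lemma near_gle (a b : Rt) x y : rep a x -> rep b y ->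
  (\forall e \near 0^'+, x e <= y e) -> gle a b.
Proof.
move=> ra rb h; apply: (rep_gle ra rb) => k; near=> e.
have /gauge_le1[r0 ? _ _] : 0 < rho e <= 2^-1 by near: e; exact: gauge_half.
by rewrite -[x e]addr0 lerD//; [near: e|exact: exprn_ge0].
Unshelve. all: by end_near. Qed.

(** An invertible generalized number is bounded away from 0 by a power of the
    gauge: its inverse is moderate. *)
Lemma glt_rep (a b : Rt) x y : rep a x -> rep b y -> glt a b ->
  exists K : nat, \forall e \near 0^'+, x e + rho e ^+ K <= y e.
Proof.
move=> ra rb [ab [z abz]]; have [w rz] := rep_ex z.
have := (rep_eq (repM (repB rb ra) rz) rep1).1 abz => /(_ 1%N) n1.
have [N wN] := mod_bound (rep_mod rz).
have le2 := gle_rep ra rb ab N.+2.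
exists N.+1; near=> e.
have r : 0 < rho e <= 2^-1 by near: e; exact: gauge_half.
have [r0 r0' r1 r2] := gauge_le1 r.
have w1 : `|w e| <= rho e ^- N by near: e.
have n2 : `|(y e - x e) * w e - 1| <= rho e by rewrite -[leRHS]expr1; near: e.
have l2 : x e <= y e + rho e ^+ N.+2 by near: e.
have : 2^-1 <= `|y e - x e| * `|w e|.
  rewrite -normrM; have := ler_norm ((y e - x e) * w e).
  by move: n2; rewrite ler_norml => /andP[? ?]; lra.
have pN : 0 < rho e ^+ N by exact: exprn_gt0.
move=> /le_trans/(_ (ler_wpM2l (normr_ge0 _) w1)).
rewrite ler_pdivlMr// => h3.
have h4 : rho e ^+ N.+1 <= `|y e - x e|.
  by apply: le_trans h3; have := powS_half N r; lra.
have h5 : rho e ^+ N.+2 * 2 <= rho e ^+ N.+1 by exact: powS_half.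
have h6 : 0 < rho e ^+ N.+2 by exact: exprn_gt0.
by move: h4; case: (lerP 0 (y e - x e)) => [/ger0_norm->|/ltr0_norm->]; lra.
Unshelve. all: by end_near. Qed.

Lemma mod_inv x K : (\forall e \near 0^'+, rho e ^+ K <= x e) ->
  (fun e => (x e)^-1) \in moderate rho.
Proof.
move=> h; apply: (@mod_of_bound _ K); near=> e.
have /gauge_le1[r0 ? _ _] : 0 < rho e <= 2^-1 by near: e; exact: gauge_half.
have h1 : rho e ^+ K <= x e by near: e.
have p : 0 < rho e ^+ K by exact: exprn_gt0.
have xp : 0 < x e by exact: lt_le_trans h1.
by rewrite normfV gtr0_norm// lef_pV2.
Unshelve. all: by end_near. Qed.

Lemma near_glt (a b : Rt) x y K : rep a x -> rep b y ->
  (\forall e \near 0^'+, x e + rho e ^+ K <= y e) -> glt a b.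
Proof.
move=> ra rb h.
have h' : \forall e \near 0^'+, rho e ^+ K <= y e - x e.
  by near=> e; rewrite lerBrDl; near: e.
split.
  apply: (near_gle ra rb); near=> e.
  have /gauge_le1[r0 ? _ _] : 0 < rho e <= 2^-1 by near: e; exact: gauge_half.
  apply: le_trans (_ : x e + rho e ^+ K <= _); last by near: e.
  by rewrite lerDl exprn_ge0.
exists (cls (fun e => (y e - x e)^-1)).
have rI := rep_cls (mod_inv h').
apply/(rep_eq (repM (repB rb ra) rI) rep1); apply: negl_near0; near=> e.
have /gauge_le1[r0 ? _ _] : 0 < rho e <= 2^-1 by near: e; exact: gauge_half.
have : rho e ^+ K <= y e - x e by near: e.
by move=> /(lt_le_trans (exprn_gt0 K r0)) p; rewrite divff ?subrr// gt_eqF.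
Unshelve. all: by end_near. Qed.

(** ** Vectors *)

Lemma coord_norm n (v : 'rV[R]_n) j : `|v 0 j| <= `|v|.
Proof.
rewrite [leRHS]/Num.Def.normr/= mx_normrE.
exact: (le_bigmax _ (fun ij : 'I_1 * 'I_n => `|v ij.1 ij.2|) (0, j)).
Qed.

Lemma norm_coord n (v : 'rV[R]_n) (c : R) : 0 <= c ->
  (forall j, `|v 0 j| <= c) -> `|v| <= c.
Proof.
move=> c0 h; rewrite [leLHS]/Num.Def.normr/= mx_normrE.
by apply: bigmax_le => // -[i j] _ /=; rewrite (ord1 i).
Qed.

Lemma norm_le_sum n (v : 'rV[R]_n) : `|v| <= \sum_j `|v 0 j|.
Proof.
apply: norm_coord => [|j]; first exact: sumr_ge0.
by rewrite (bigD1 j)//= lerDl sumr_ge0.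
Qed.

Lemma vrep_ex n (x : 'rV[Rt]_n) : exists xe, vrep x xe.
Proof.
exists (fun e => \row_j (repr (x 0 j) : mnet rho) e) => j.
under eq_fun do rewrite mxE.
by exists (repr (x 0 j)) => //; rewrite reprK.
Qed.

Lemma vrep_eq n (x y : 'rV[Rt]_n) xe ye : vrep x xe -> vrep y ye ->
  x = y <-> forall j, negl (fun e => xe e 0 j - ye e 0 j).
Proof.
move=> rx ry; split=> [xy j|h]; first by apply/(rep_eq (rx j) (ry j)); rewrite xy.
by apply/rowP => j; apply/(rep_eq (rx j) (ry j)); exact: h.
Qed.

Lemma vrep_uniq n (x y : 'rV[Rt]_n) xe : vrep x xe -> vrep y xe -> x = y.
Proof. by move=> rx ry; apply/rowP => j; exact: rep_uniq (rx j) (ry j). Qed.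

Lemma vrep_negl n (x : 'rV[Rt]_n) (xe ye : R -> 'rV[R]_n) : vrep x xe ->
  (forall j, negl (fun e => xe e 0 j - ye e 0 j)) -> vrep x ye.
Proof. by move=> rx h j; exact: rep_negl (rx j) (h j). Qed.

Lemma vrep_cls n (xe : R -> 'rV[R]_n) : vmoderate (rho := rho) xe ->
  vrep (\row_j cls (fun e => xe e 0 j) : 'rV[Rt]_n) xe.
Proof. by move=> h j; rewrite mxE; exact: rep_cls. Qed.

Lemma vrepB n (x y : 'rV[Rt]_n) xe ye : vrep x xe -> vrep y ye ->
  vrep (x - y) (fun e => xe e - ye e).
Proof.
move=> rx ry j; rewrite !mxE; under eq_fun do rewrite !mxE.
exact: repB.
Qed.

Lemma vrep_mod n (x : 'rV[Rt]_n) xe : vrep x xe -> vmoderate (rho := rho) xe.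
Proof. by move=> h j; exact: rep_mod (h j). Qed.

Lemma mod_vnorm n (xe : R -> 'rV[R]_n) : vmoderate (rho := rho) xe ->
  (fun e => `|xe e|) \in moderate rho.
Proof.
move=> h; have := @mod_sum _ (index_enum 'I_n) (fun j e => `|xe e 0 j|)
  (fun j => mod_norm (h j)).
move=> /mod_le; apply; near=> e; rewrite normr_id.
by apply: le_trans (norm_le_sum _) _; exact: ler_norm.
Unshelve. all: by end_near. Qed.

(** [gnorm] is defined by chosen representatives; others give the same class as
    the norm is 1-Lipschitz. *)
Lemma rep_gnorm n (x : 'rV[Rt]_n) xe : vrep x xe -> rep (gnorm x) (fun e => `|xe e|).
Proof.
move=> rx; pose ye : R -> 'rV[R]_n := fun e => \row_j (repr (x 0 j) : mnet rho) e.
have ry : vrep x ye.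
  move=> j; rewrite /ye; under eq_fun do rewrite mxE.
  by exists (repr (x 0 j)) => //; rewrite reprK.
have := rep_cls (mod_vnorm (vrep_mod ry)) => /rep_negl; apply.
have := @negl_sum _ (index_enum 'I_n) (fun j e => `|ye e 0 j - xe e 0 j|) => H.
apply: (negl_le (H _)) => [j|].
  apply: (negl_le ((rep_eq (ry j) (rx j)).1 erefl)).
  by near=> e; rewrite normr_id.
near=> e; apply: (le_trans (ler_dist_dist _ _)).
apply: (le_trans (norm_le_sum _)); apply: le_trans (ler_norm _).
by apply: ler_sum => j _; rewrite !mxE.
Unshelve. all: by end_near. Qed.

Lemma gball_rep n (c x : 'rV[Rt]_n) (r : Rt) ce xe re :
  vrep c ce -> vrep x xe -> rep r re -> gball c r x ->
  \forall e \near 0^'+, `|xe e - ce e| <= re e.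
Proof.
move=> rc rx rr /(glt_rep (rep_gnorm (vrepB rx rc)) rr)[K h]; near=> e.
have /gauge_le1[r0 ? _ _] : 0 < rho e <= 2^-1 by near: e; exact: gauge_half.
apply: (@le_trans _ _ (`|xe e - ce e| + rho e ^+ K)); last by near: e.
by rewrite lerDl exprn_ge0.
Unshelve. all: by end_near. Qed.

Lemma near_gball n (c x : 'rV[Rt]_n) (r : Rt) ce xe re K :
  vrep c ce -> vrep x xe -> rep r re ->
  (\forall e \near 0^'+, `|xe e - ce e| + rho e ^+ K <= re e) -> gball c r x.
Proof. by move=> rc rx rr; apply: near_glt (rep_gnorm (vrepB rx rc)) rr. Qed.

Lemma glt0_rep (r : Rt) re : rep r re -> glt 0 r ->
  exists K : nat, \forall e \near 0^'+, rho e ^+ K <= re e.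
Proof.
move=> rr /(glt_rep rep0 rr)[K h]; exists K; near=> e.
by rewrite -[leLHS]add0r; near: e.
Unshelve. all: by end_near. Qed.

Lemma rep_rhoX k : rep (cls (fun e => rho e ^+ k) : Rt) (fun e => rho e ^+ k).
Proof. exact/rep_cls/mod_rhoX. Qed.

Lemma glt0_rhoX k : glt (0 : Rt) (cls (fun e => rho e ^+ k)).
Proof.
apply: (@near_glt _ _ _ _ k rep0 (rep_rhoX k)).
by near=> e; rewrite add0r.
Unshelve. all: by end_near. Qed.

End Nets.

Section Uniformity.
Context {R : realType} (rho : gauge R).

(** ** From nets of points to uniform statements *)

(** A net which selects a point of failure whenever there is one would contradict
    the hypothesis on nets if the conclusion failed for arbitrarily small [e]. *)
Lemma uniform_near (T : pointedType) (A : R -> set T) (P : R -> T -> Prop) :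
  (\forall e \near (0:R)^'+, exists y, A e y) ->
  (forall x : R -> T, (\forall e \near (0:R)^'+, A e (x e)) ->
     \forall e \near (0:R)^'+, P e (x e)) ->
  \forall e \near (0:R)^'+, forall y : T, A e y -> P e y.
Proof.
move=> A0 h.
have /choice[x hx] : forall e, exists y : T, (exists y : T, A e y) ->
    A e y /\ ((exists y : T, A e y /\ ~ P e y) -> ~ P e y).
  move=> e; have [[y [Ay nP]]|no] := pselect (exists y : T, A e y /\ ~ P e y).
    by exists y.
  have [[y Ay]|no'] := pselect (exists y : T, A e y).
    by exists y => _; split=> // /no.
  by exists point => /no'.
have /h hP : \forall e \near (0:R)^'+, A e (x e).
  by near=> e; apply: (hx e _).1; near: e.
near=> e => /= y Ay; apply: contrapT => nP.
have /hx[_ /(_ (ex_intro _ y (conj Ay nP)))] : exists y : T, A e y by exists y.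
by apply; near: e.
Unshelve. all: by end_near. Qed.

(** The net to test is chosen at [e] as bad as possible among the exponents
    below [e^-1]; a moderateness bound for it is then uniform. *)
Lemma uniform_mod (T : pointedType) (A : R -> set T) (g : R -> T -> R) :
  (\forall e \near (0:R)^'+, exists y, A e y) ->
  (forall x : R -> T, (\forall e \near (0:R)^'+, A e (x e)) ->
     (fun e => g e (x e)) \in moderate rho) ->
  exists N : nat, \forall e \near (0:R)^'+, forall y : T, A e y -> `|g e y| <= rho e ^- N.
Proof.
move=> A0 h.
have ex (e : R) : 0 < rho e <= 1 -> (exists y : T, A e y) -> forall M : nat,
    exists y : T, A e y /\ forall N, (N <= M)%N ->
      (exists z : T, A e z /\ rho e ^- N < `|g e z|) -> rho e ^- N < `|g e y|.
  move=> /andP[r0 r1] Ae M; elim: M => [|M [y [Ay IH]]].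
    have [[z [Az gz]]|no] := pselect (exists z : T, A e z /\ rho e ^- 0 < `|g e z|).
      by exists z; split=> // N; rewrite leqn0 => /eqP->.
    by case: Ae => /= y Ay; exists y; split=> // N; rewrite leqn0 => /eqP-> /no.
  have [[z [Az gz]]|no] := pselect (exists z : T, A e z /\ rho e ^- M.+1 < `|g e z|).
    exists z; split=> // N NM _; apply: le_lt_trans gz.
    by rewrite lef_pV2 ?posrE ?exprn_gt0// ler_wiXn2l// ltW.
  exists y; split=> // N; rewrite leq_eqVlt => /orP[/eqP-> /no//|].
  by rewrite ltnS; exact: IH.
have /choice[x hx] : forall e, exists y : T, 0 < rho e <= 1 -> (exists y : T, A e y) ->
    A e y /\ forall N : nat, (N <= Num.truncn e^-1)%N ->
      (exists z : T, A e z /\ rho e ^- N < `|g e z|) -> rho e ^- N < `|g e y|.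
  move=> e; have [r|nr] := pselect (is_true (0 < rho e <= 1)); last first.
    by exists point => /nr.
  have [Ae|no] := pselect (exists y : T, A e y); last by exists point => _ /no.
  by have [y hy] := ex e r Ae (Num.truncn e^-1); exists y.
have r01 : \forall e \near (0:R)^'+, 0 < rho e <= 1.
  by near=> e; apply: gauge_range; near: e; exact: near_unit.
have /h/mod_bound[N gN] : \forall e \near (0:R)^'+, A e (x e).
  by near=> e; apply: (hx e _ _).1; near: e.
exists N; near=> e => /= y Ay; rewrite leNgt; apply/negP => gy.
have [|_ /(_ N)] := hx e _ (ex_intro _ y Ay); first by near: e.
have e0 : 0 < e by near: e; exact: nbhs_right_gt.
have -> : (N <= Num.truncn e^-1)%N.
  rewrite truncn_ge_nat ?invr_ge0 ?(ltW e0)//.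
  apply: (@le_trans _ _ N.+1%:R); first by rewrite ler_nat.
  rewrite -[leLHS]invrK lef_pV2 ?posrE ?invr_gt0 ?ltr0n//.
  by near: e; apply: nbhs_right_le; rewrite invr_gt0 ltr0n.
move=> /(_ isT (ex_intro _ y (conj Ay gy))); rewrite ltNge => /negP; apply.
by near: e.
Unshelve. all: by end_near. Qed.

End Uniformity.

(** * Differential calculus on row vectors *)

Section Calculus.
Context {R : realType}.

Lemma is_derive_line n (f : 'rV[R]_n -> R) x v (s : R) :
  derivable f (x + s *: v) v ->
  is_derive s 1 (fun t : R => f (x + t *: v)) ('D_v f (x + s *: v)).
Proof.
move=> df.
have E : (fun h : R => h^-1 *: (((fun t : R => f (x + t *: v)) \o shift s) (h *: 1) -
      f (x + s *: v))) =
    (fun h => h^-1 *: ((f \o shift (x + s *: v)) (h *: v) - f (x + s *: v))).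
  apply/funext => h /=; congr (_ *: (f _ - _)).
  by rewrite [_ *: 1]mulr1 scalerDl addrCA.
by split; rewrite /derivable /derive E.
Qed.

(** The factor [a] may be negative, which allows moves along a coordinate axis in
    both directions. *)
Lemma mvt_line n (f : 'rV[R]_n -> R) x v (a : R) :
  (forall s : R, 0 <= s <= 1 -> derivable f (x + (s * a) *: v) v) ->
  exists2 s : R, 0 <= s <= 1 &
    f (x + a *: v) - f x = a * 'D_v f (x + (s * a) *: v).
Proof.
move=> df; pose g := fun t : R => f (x + t *: v).
pose dg := fun t : R => 'D_v f (x + t *: v).
have [->|a0] := eqVneq a 0.
  by exists 0; rewrite ?lexx ?ler01// scale0r addr0 subrr mul0r.
have sa (t : R) : t = (t / a) * a by rewrite divfK.
have dgE (t : R) : 0 <= t / a <= 1 -> is_derive t 1 g (dg t).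
  by move=> /df; rewrite -sa => /is_derive_line.
have cont (b c : R) : (forall t, t \in `[b, c]%R -> 0 <= t / a <= 1) ->
    {within `[b, c], continuous g}.
  move=> bc; apply: derivable_within_continuous => t /bc/dgE.
  by case.
have [ap|an|/eqP] := ltgtP 0 a; last by rewrite eq_sym (negbTE a0).
- have I (t : R) : t \in `[0, a]%R -> 0 <= t / a <= 1.
    by rewrite in_itv/= => /andP[t0 ta]; rewrite divr_ge0 ?ler_pdivrMr ?mul1r// ltW.
  have [|t||t tI E] := @MVT_segment R g dg 0 a; rewrite ?(ltW ap)//.
  + by move=> /subset_itv_oo_cc/I/dgE.
  + exact: cont.
  exists (t / a); rewrite ?I// -sa; move: E.
  by rewrite /g/dg scale0r addr0 subr0 mulrC.
- have I (t : R) : t \in `[a, 0]%R -> 0 <= t / a <= 1.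
    rewrite in_itv/= => /andP[t0 ta]; rewrite ler_ndivrMr// mul1r t0 andbT.
    by rewrite mulr_le0// invr_le0 ltW.
  have [|t||t tI E] := @MVT_segment R g dg a 0; rewrite ?(ltW an)//.
  + by move=> /subset_itv_oo_cc/I/dgE.
  + exact: cont.
  exists (t / a); rewrite ?I// -sa; move: E.
  by rewrite /g/dg scale0r addr0 sub0r mulrN => /(congr1 -%R); rewrite opprB opprK mulrC.
Qed.

Lemma row_delta n (v : 'rV[R]_n) : v = \sum_j v 0 j *: delta_mx 0 j.
Proof. exact: row_sum_delta. Qed.

Lemma derive_delta n (f : 'rV[R]_n -> R) x v : differentiable f x ->
  'D_v f x = \sum_j v 0 j * 'D_(delta_mx 0 j) f x.
Proof.
move=> df; rewrite deriveE// {1}[v]row_delta linear_sum; apply: eq_bigr => j _.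
by rewrite linearZ/= deriveE.
Qed.

(** Changing the coordinates of [x] into those of [x + h] one at a time, the
    mean value theorem in each coordinate bounds the error. *)
Lemma C1_differentiable n (f : 'rV[R]_n -> R) x :
  (\forall y \near x, forall i, derivable f y (delta_mx 0 i)) ->
  (forall i, {for x, continuous (fun y => 'D_(delta_mx 0 i) f y)}) ->
  differentiable f x.
Proof.
move=> nd cd.
pose c j := 'D_(delta_mx 0 j) f x.
pose df (h : 'rV[R]_n) : R := \sum_j h 0 j * c j.
have df_lin : linear df.
  move=> a u v; rewrite /df scaler_sumr -big_split/=; apply: eq_bigr => j _.
  by rewrite !mxE mulrDl -mulrA.
pose dfM := GRing.isLinear.Build _ _ _ _ _ df_lin.
pose dfL : {linear 'rV[R]_n -> R} := HB.pack df dfM.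
have dfc : continuous dfL.
  have := @continuous_big R^o 'I_n +%R 0 xpredT (@add_continuous R^o) 'rV[R]_n
    (index_enum 'I_n) (fun j h => h 0 j * c j).
  apply => j _ y.
  by apply: cvgMr_tmp (@coord_continuous R 1 n 0 j y).
suff E : f \o shift x = cst (f x) + dfL +o_ 0 id.
  by apply/diff_locallyP; rewrite (diff_unique dfc E).
apply/eqaddoP => _/posnumP[e].
have e0 : 0 < e%:num / n.+1%:R by rewrite divr_gt0.
have cd' : \forall y \near x, forall i, `|'D_(delta_mx 0 i) f y - c i| <= e%:num / n.+1%:R.
  apply: (@filter_forall _ 'I_n (fun i y =>
    `|'D_(delta_mx 0 i) f y - c i| <= e%:num / n.+1%:R) (nbhs x)) => i.
  have /cvgrPdist_le/(_ _ e0) := cd i.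
  by apply: filterS => y; rewrite distrC.
have [d0 d0p nb] := (nbhs_ballP _ _).1 (filterI nd cd').
have d0p' : 0 < d0 by [].
near=> h; have hd : `|h| < d0.
  near: h; apply/nbhs_ballP; exists d0 => //= h.
  by rewrite -ball_normE/= sub0r normrN.
pose hk (k : nat) : 'rV[R]_n := \row_j (if (j < k)%N then h 0 j else 0).
have hkn : hk n = h by apply/rowP => j; rewrite mxE ltn_ord.
have hk0 : hk 0%N = 0 by apply/rowP => j; rewrite !mxE ltn0.
have step (k : 'I_n) : `|f (x + hk k.+1) - f (x + hk k) - h 0 k * c k| <=
    `|h| * (e%:num / n.+1%:R).
  have hkS : hk k.+1 = hk k + h 0 k *: delta_mx 0 k.
    apply/rowP => j; rewrite !mxE eqxx/= ltnS leq_eqVlt.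
    have [->|jk] := eqVneq j k; first by rewrite eqxx ltnn/= mulr1 add0r.
    by rewrite val_eqE (negbTE jk)/= mulr0 addr0.
  have small (s : R) : 0 <= s <= 1 -> ball x d0 (x + hk k + (s * h 0 k) *: delta_mx 0 k).
    move=> /andP[s0 s1]; rewrite -ball_normE/= -addrA opprD addNKr normrN.
    apply: le_lt_trans hd; apply: norm_coord => // j; rewrite !mxE eqxx/=.
    have [->|jk] := eqVneq j k.
      rewrite ltnn add0r mulr1 normrM ger0_norm// -[leRHS]mul1r ler_pM//.
      exact: coord_norm.
    rewrite mulr0 addr0; case: ifP => _; first exact: coord_norm.
    by rewrite normr0.
  have [s|s s01] := @mvt_line n f (x + hk k) (delta_mx 0 k) (h 0 k).
    by move=> /small/nb[/(_ k)].
  rewrite -addrA -hkS => ->.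
  rewrite -mulrBr normrM ler_pM ?coord_norm//.
  by have [_ /(_ k)] := nb _ (small _ s01).
rewrite /= -[leLHS]/(`|f (h + x) - (f x + df h)|).
have -> : f (h + x) - (f x + df h) =
    \sum_(k < n) (f (x + hk k.+1) - f (x + hk k) - h 0 k * c k).
  rewrite big_split/= sumrN opprD addrA; congr (_ - _).
  rewrite -(big_mkord xpredT (fun k => f (x + hk k.+1) - f (x + hk k))).
  rewrite (telescope_sumr (fun k => f (x + hk k)))//.
  by rewrite hkn hk0 addr0 [h + x]addrC.
apply: (le_trans (ler_norm_sum _ _ _)).
apply: (@le_trans _ _ (\sum_(k < n) `|h| * (e%:num / n.+1%:R))).
  by apply: ler_sum => k _; exact: step.
rewrite sumr_const card_ord -mulrnAr mulrC ler_wpM2r//.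
rewrite -mulr_natr mulrAC ler_pdivrMr ?ltr0n// ler_wpM2l// ler_nat.
exact: leqnSn.
Unshelve. all: by end_near. Qed.

(** Only the curve [h |-> g (x + h v)] is involved, hence the inner map need not be
    differentiable. *)
Lemma derive_comp_dir n p (g : 'rV[R]_n -> 'rV[R]_p) (f : 'rV[R]_p -> R) x v :
  derivable g x v -> differentiable f (g x) ->
  derivable (f \o g) x v /\ 'D_v (f \o g) x = 'D_('D_v g x) f (g x).
Proof.
move=> dg df.
have gE (W : normedModType R) (k : 'rV[R]_n -> W) :
    'D_v k x = 'D_1 (fun h : R => k (h *: v + x)) 0.
  rewrite /derive; set k1 := (X in X @ _); set k2 := (X in _ = lim (X @ _)).
  suff -> : k1 = k2 by [].
  by apply/funext => h; rewrite /k1 /k2/= addr0 scale0r add0r [_ *: 1]mulr1.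
have dg1 : differentiable (fun h : R => g (h *: v + x)) 0.
  by apply/derivable1_diffP; move: dg; rewrite derivable1P.
have df1 : differentiable f ((fun h : R => g (h *: v + x)) 0).
  by rewrite scale0r add0r.
have dfg : differentiable (f \o (fun h : R => g (h *: v + x))) 0.
  exact: differentiable_comp.
split; first exact/derivable1P/derivable1_diffP.
rewrite (gE _ (f \o g)) (gE _ g); pose c := fun h : R => g (h *: v + x).
have c0 : c 0 = g x by rewrite /c scale0r add0r.
rewrite -[LHS]/('D_1 (f \o c) 0) deriveE// diff_comp// -/c -c0.
by rewrite [RHS]deriveE ?c0// [X in 'd f _ X]deriveE.
Qed.

End Calculus.

(** * Smooth nets with moderate derivatives *)

Section SmoothNets.
Context {R : realType} {rho : gauge R}.
Local Notation Rt := (gnum rho).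

Definition net_domain n (X : set 'rV[Rt]_n) (Om : R -> set 'rV[R]_n) :=
  (forall e, 0 < e <= 1 -> open (Om e)) /\ X `<=` strong_internal Om.

(** Smoothness with moderate derivatives is defined coinductively: a net has it
    when it belongs to some class of continuous, derivable, moderate nets that
    contains the partial derivatives of its members. To prove that an operation
    preserves smoothness one exhibits such a class, and multi-indices never
    appear. *)
Definition derivation_closed n (X : set 'rV[Rt]_n) (Om : R -> set 'rV[R]_n)
    (G : set (R -> 'rV[R]_n -> R)) := forall F, G F ->
  [/\ forall e x, 0 < e <= 1 -> Om e x ->
        {for x, continuous (F e)} /\ forall i, derivable (F e) x (delta_mx 0 i),
      forall i, exists2 F', G F' & forall e x, 0 < e <= 1 -> Om e x ->
        'D_(delta_mx 0 i) (F e) x = F' e x &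
      forall x xe, X x -> vrep x xe -> (fun e => F e (xe e)) \in moderate rho].

Definition snet n (X : set 'rV[Rt]_n) Om F :=
  exists2 G, derivation_closed X Om G & G F.

Lemma snet_continuous n (X : set 'rV[Rt]_n) Om F e x : snet X Om F ->
  0 < e <= 1 -> Om e x -> {for x, continuous (F e)}.
Proof. by move=> [G cG /cG[h _ _]] e01 /(h _ _ e01)[]. Qed.

Lemma snet_derivable n (X : set 'rV[Rt]_n) Om F e x i : snet X Om F ->
  0 < e <= 1 -> Om e x -> derivable (F e) x (delta_mx 0 i).
Proof. by move=> [G cG /cG[h _ _]] e01 /(h _ _ e01)[]. Qed.

Lemma snet_moderate n (X : set 'rV[Rt]_n) Om F x xe : snet X Om F ->
  X x -> vrep x xe -> (fun e => F e (xe e)) \in moderate rho.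
Proof. by move=> [G cG /cG[_ _ h]]; exact: h. Qed.

Lemma snet_closed n (X : set 'rV[Rt]_n) Om : derivation_closed X Om (snet X Om).
Proof.
move=> F sF; split=> [e x e01 Ox|i|x xe Xx rx].
- by split=> [|i]; [exact: snet_continuous sF _ _|exact: snet_derivable sF _ _].
- have [G cG /cG[_ /(_ i)[F' GF' FF'] _]] := sF.
  by exists F' => //; exists G.
- exact: snet_moderate sF Xx rx.
Qed.

Lemma near_open n (O : set 'rV[R]_n) x : open O -> O x -> \forall y \near x, O y.
Proof. by move=> oO Ox; apply: open_nbhs_nbhs. Qed.

(** As [Om e] is open, functions that agree on it have the same derivatives
    there. *)
Lemma snet_ext n (X : set 'rV[Rt]_n) Om F F1 : net_domain X Om -> snet X Om F ->
  (forall e x, 0 < e <= 1 -> Om e x -> F e x = F1 e x) -> snet X Om F1.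
Proof.
move=> [oO XO] [G cG GF] FF1.
exists [set H1 | exists2 H, G H &
  forall e x, 0 < e <= 1 -> Om e x -> H e x = H1 e x]; last by exists F.
move=> H1 [H GH HH]; have [h1 h2 h3] := cG _ GH.
have nH e x : 0 < e <= 1 -> Om e x -> {near x, H e =1 H1 e}.
  by move=> e01 Ox; apply: filterS (near_open (oO e e01) Ox) => y; exact: HH.
split.
- move=> e x e01 Ox; have [hc hd] := h1 e x e01 Ox; split=> [|i].
    rewrite /prop_for /continuous_at -HH//.
    by apply: cvg_trans hc; apply: (@near_eq_cvg _ _ (nbhs x)); exact: nH e01 Ox.
  exact: near_eq_derivable (nH _ _ e01 Ox) (hd i).
- move=> i; have [F' GF' FF'] := h2 i; exists F'; first by exists F'.
  move=> e x e01 Ox; rewrite -FF'//; apply/esym/near_eq_derive.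
  exact: nH e01 Ox.
- move=> x xe Xx rx; have := h3 x xe Xx rx => /mod_le; apply.
  near=> e; have Oe : Om e (xe e) by near: e; exact: XO x Xx xe rx.
  by rewrite HH//; near: e; exact: near_unit.
Unshelve. all: by end_near. Qed.

Lemma snet_partial n (X : set 'rV[Rt]_n) Om F i : net_domain X Om -> snet X Om F ->
  snet X Om (fun e x => 'D_(delta_mx 0 i) (F e) x).
Proof.
move=> dO /snet_closed[_ /(_ i)[F' sF' FF'] _]; apply: (snet_ext dO sF').
by move=> e x e01 Ox; rewrite FF'.
Qed.

Lemma snet_differentiable n (X : set 'rV[Rt]_n) Om F e x : net_domain X Om ->
  snet X Om F -> 0 < e <= 1 -> Om e x -> differentiable (F e) x.
Proof.
move=> dO sF e01 Ox; apply: C1_differentiable.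
  apply: filterS (near_open (dO.1 e e01) Ox) => y Oy i.
  exact: snet_derivable sF _ _.
by move=> i; exact: snet_continuous (snet_partial i dO sF) _ _.
Qed.

Lemma snet_sub n (X X' : set 'rV[Rt]_n) Om Om' F : snet X Om F -> X' `<=` X ->
  (forall e, Om' e `<=` Om e) -> snet X' Om' F.
Proof.
move=> [G cG GF] XX OO; exists G => // H /cG[h1 h2 h3]; split.
- by move=> e x e01 /OO; exact: h1.
- move=> i; have [F' GF' FF'] := h2 i; exists F' => // e x e01 /OO.
  exact: FF'.
- by move=> x xe /XX; exact: h3.
Qed.

Inductive generated n (G : set (R -> 'rV[R]_n -> R)) : (R -> 'rV[R]_n -> R) -> Prop :=
| Gen F of G F : generated G F
| GenD F H of generated G F & generated G H : generated G (fun e x => F e x + H e x)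
| GenM F H of generated G F & generated G H : generated G (fun e x => F e x * H e x).

(** By the Leibniz rule, stability under derivation has to be checked on
    generators only. *)
Lemma generated_snet n (X : set 'rV[Rt]_n) Om (G : set (R -> 'rV[R]_n -> R)) :
  (forall F, G F ->
  [/\ forall e x, 0 < e <= 1 -> Om e x ->
        {for x, continuous (F e)} /\ forall i, derivable (F e) x (delta_mx 0 i),
      forall i, exists2 F', generated G F' & forall e x, 0 < e <= 1 -> Om e x ->
        'D_(delta_mx 0 i) (F e) x = F' e x &
      forall x xe, X x -> vrep x xe -> (fun e => F e (xe e)) \in moderate rho]) ->
  forall F, generated G F -> snet X Om F.
Proof.
move=> hG F gF; exists (generated G) => // {gF}F.
elim=> {F} [F /hG[] //|F H gF [F1 F2 F3] gH [H1 H2 H3]|F H gF [F1 F2 F3] gH [H1 H2 H3]].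
- split=> [e x e01 Ox|i|x xe Xx rx].
  + have [Fc Fd] := F1 e x e01 Ox; have [Hc Hd] := H1 e x e01 Ox.
    by split=> [|i]; [exact: continuousD|exact: derivableD].
  + have [F' gF' FF'] := F2 i; have [H' gH' HH'] := H2 i.
    exists (fun e x => F' e x + H' e x); first exact: GenD.
    move=> e x e01 Ox; have [_ Fd] := F1 e x e01 Ox; have [_ Hd] := H1 e x e01 Ox.
    by rewrite deriveD// FF'// HH'.
  + by apply: modD; [exact: F3 Xx rx|exact: H3 Xx rx].
- split=> [e x e01 Ox|i|x xe Xx rx].
  + have [Fc Fd] := F1 e x e01 Ox; have [Hc Hd] := H1 e x e01 Ox.
    by split=> [|i]; [exact: continuousM|exact: derivableM].
  + have [F' gF' FF'] := F2 i; have [H' gH' HH'] := H2 i.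
    exists (fun e x => F e x * H' e x + H e x * F' e x).
      by apply: GenD; exact: GenM.
    move=> e x e01 Ox; have [_ Fd] := F1 e x e01 Ox; have [_ Hd] := H1 e x e01 Ox.
    by rewrite deriveM// FF'// HH'.
  + by apply: modM; [exact: F3 Xx rx|exact: H3 Xx rx].
Qed.

Lemma snet_generated n (X : set 'rV[Rt]_n) Om F : generated (snet X Om) F -> snet X Om F.
Proof.
apply: generated_snet => {}F /snet_closed[h1 h2 h3]; split=> // i.
by have [F' sF' FF'] := h2 i; exists F' => //; exact: Gen.
Qed.

Lemma snetD n (X : set 'rV[Rt]_n) Om F H : snet X Om F -> snet X Om H ->
  snet X Om (fun e x => F e x + H e x).
Proof. by move=> sF sH; apply: snet_generated; apply: GenD; exact: Gen. Qed.

Lemma snetM n (X : set 'rV[Rt]_n) Om F H : snet X Om F -> snet X Om H ->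
  snet X Om (fun e x => F e x * H e x).
Proof. by move=> sF sH; apply: snet_generated; apply: GenM; exact: Gen. Qed.

Lemma snet_cst n (X : set 'rV[Rt]_n) Om (c : R -> R) : c \in moderate rho ->
  snet X Om (fun e _ => c e).
Proof.
move=> mc; exists [set H | exists2 c, c \in moderate rho & H = fun e _ => c e];
  last by exists c.
move=> _ [{mc}c mc ->]; split=> [e x _ _|i|//].
  by split=> [|i]; [exact: cst_continuous|exact: derivable_cst].
exists (fun _ _ => 0); first by exists (fun=> 0) => //; exact: mod0.
by move=> e x _ _; exact: derive_cst.
Qed.

Lemma derivable_coord n (x v : 'rV[R]_n) j :
  derivable (fun y : 'rV[R]_n => y 0 j) x v /\
  'D_v (fun y : 'rV[R]_n => y 0 j) x = v 0 j.
Proof.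
have d : derivable (@idfun 'rV[R]_n) x v by exact: derivable_id.
split; first by move/derivable_mxP : d => /(_ 0 j).
have /(congr1 (fun m : 'rV[R]_n => m 0 j)) := derive_mx d.
by rewrite derive_id mxE.
Qed.

Lemma snet_coord n (X : set 'rV[Rt]_n) Om j : snet X Om (fun e x => x 0 j).
Proof.
exists [set H | H = (fun=> fun x : 'rV[R]_n => x 0 j) \/ snet X Om H]; last by left.
move=> H [->|/snet_closed[h1 h2 h3]]; last first.
  by split=> // i; have [F' sF' FF'] := h2 i; exists F' => //; right.
split=> [e x _ _|i|x xe Xx rx]; last exact: rep_mod (rx j).
  by split=> [|i]; [exact: coord_continuous|exact: (derivable_coord _ _ _).1].
exists (fun _ _ => (delta_mx 0 i : 'rV[R]_n) 0 j).
  by right; apply: snet_cst; apply: mod_small; near=> e; rewrite mxE; case: (_ && _);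
    rewrite ?normr1 ?normr0.
by move=> e x _ _; exact: (derivable_coord _ _ _).2.
Unshelve. all: by end_near. Qed.

Lemma snetN n (X : set 'rV[Rt]_n) Om F : net_domain X Om -> snet X Om F ->
  snet X Om (fun e x => - F e x).
Proof.
move=> dO sF; have m1 := modN (mod1 rho) : (fun=> -1 : R) \in moderate rho.
by apply: (snet_ext dO (snetM (snet_cst X Om m1) sF)) => e x _ _; rewrite mulN1r.
Qed.

Lemma snetX n (X : set 'rV[Rt]_n) Om F k : net_domain X Om -> snet X Om F ->
  snet X Om (fun e x => F e x ^+ k).
Proof.
move=> dO sF; elim: k => [|k IH].
  by apply: (snet_ext dO (snet_cst X Om (mod1 rho))) => e x _ _; rewrite expr0.
by apply: (snet_ext dO (snetM sF IH)) => e x _ _; rewrite exprS.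
Qed.

(** ** Vector valued nets *)

Lemma continuous_coords n k (g : 'rV[R]_n -> 'rV[R]_k) x :
  (forall j, {for x, continuous (fun y => g y 0 j)}) -> {for x, continuous g}.
Proof.
move=> h; apply/(@cvgrPdist_le _ _ _ (nbhs x)) => e e0.
have : \forall y \near x, forall j, `|g x 0 j - g y 0 j| <= e.
  apply: (@filter_forall _ 'I_k (fun j y => `|g x 0 j - g y 0 j| <= e) (nbhs x)) => j.
  by have /(@cvgrPdist_le _ _ _ (nbhs x))/(_ _ e0) := h j.
by apply: filterS => y hy; apply: norm_coord (ltW e0) _ => j; rewrite !mxE.
Qed.

Lemma derive_coord n k (g : 'rV[R]_n -> 'rV[R]_k) x v j :
  derivable g x v -> derivable (fun y => g y 0 j) x v /\
  'D_v (fun y => g y 0 j) x = 'D_v g x 0 j.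
Proof.
move=> dg; split; first by move/derivable_mxP : dg => /(_ 0 j).
by rewrite (derive_mx dg) mxE.
Qed.

Lemma derivable_coords n k (g : 'rV[R]_n -> 'rV[R]_k) x v :
  (forall j, derivable (fun y => g y 0 j) x v) -> derivable g x v.
Proof. by move=> h; apply/derivable_mxP => i j; rewrite (ord1 i). Qed.

Definition vnet n k (X : set 'rV[Rt]_n) Om (u : R -> 'rV[R]_n -> 'rV[R]_k) :=
  forall j, snet X Om (fun e x => u e x 0 j).

(** The iterated partial derivatives of the components of [u] form a class closed
    under derivation; conversely, membership in such classes is inherited by
    every iterated derivative. *)
Lemma gsf_netP n k (X : set 'rV[Rt]_n) (f : 'rV[Rt]_n -> 'rV[Rt]_k) Om u :
  gsf_net X f Om u <->
  [/\ net_domain X Om, vnet X Om u &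
      forall x xe, X x -> vrep x xe -> vrep (f x) (fun e => u e (xe e))].
Proof.
split=> [[oO XO h]|[[oO XO] vu h]].
  split=> [|j|x xe Xx rx]; last by have [] := h x xe Xx rx.
    by split=> // e /oO[].
  exists [set H | exists s, H = fun e x => partials s (u e) x 0 j]; last by exists [::].
  move=> _ [s ->]; split=> [e x e01 Ox|i|x xe Xx rx].
  - have [_ /(_ s x Ox)[c d]] := oO _ e01; split=> [|i].
      apply: (@continuous_comp _ _ _ _ (fun y : 'rV[R]_k => y 0 j)) => //.
      exact: coord_continuous.
    exact: (derive_coord j (d i)).1.
  - exists (fun e x => partials (i :: s) (u e) x 0 j); first by exists (i :: s).
    move=> e x e01 Ox; have [_ /(_ s x Ox)[c d]] := oO _ e01.
    exact: (derive_coord j (d i)).2.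
  - by have [_ /(_ s j)] := h x xe Xx rx.
have vs s : exists F : 'I_k -> R -> 'rV[R]_n -> R, (forall j, snet X Om (F j)) /\
    forall e x, 0 < e <= 1 -> Om e x -> forall j, partials s (u e) x 0 j = F j e x.
  elim: s => [|i s [F [sF IH]]]; first by exists (fun j e x => u e x 0 j).
  exists (fun j e x => 'D_(delta_mx 0 i) (F j e) x).
  split=> [j|e x e01 Ox j]; first exact: snet_partial.
  have nE j0 : {near x, (fun y => partials s (u e) y 0 j0) =1 F j0 e}.
    by apply: filterS (near_open (oO e e01) Ox) => y Oy; exact: IH.
  have d : derivable (partials s (u e)) x (delta_mx 0 i).
    apply: derivable_coords => j0.
    have nE' : {near x, F j0 e =1 (fun y => partials s (u e) y 0 j0)}.
      by apply: filterS (nE j0) => y ->.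
    exact: near_eq_derivable nE' (snet_derivable (sF j0) e01 Ox).
  rewrite /= /partial -(derive_coord j d).2.
  by apply: near_eq_derive; exact: nE.
split=> [e e01|//|x xe Xx rx].
  split; first exact: oO.
  move=> s x Ox; have [F [sF FE]] := vs s.
  have nE j0 : {near x, F j0 e =1 (fun y => partials s (u e) y 0 j0)}.
    by apply: filterS (near_open (oO e e01) Ox) => y Oy; rewrite FE.
  split=> [|i].
    apply: continuous_coords => j; rewrite /prop_for /continuous_at FE//.
    have := snet_continuous (sF j) e01 Ox; apply: cvg_trans.
    by apply: (@near_eq_cvg _ _ (nbhs x)); exact: nE.
  apply: derivable_coords => j.
  exact: near_eq_derivable (nE j) (snet_derivable (sF j) e01 Ox).
split; first exact: h.
move=> s j; have [F [sF FE]] := vs s.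
have := snet_moderate (sF j) Xx rx => /mod_le; apply; near=> e.
have Oe : Om e (xe e) by near: e; exact: XO x Xx xe rx.
by rewrite FE//; near: e; exact: near_unit.
Unshelve. all: by end_near. Qed.

Definition comp_domain n p (Om : R -> set 'rV[R]_n) (g : R -> 'rV[R]_n -> 'rV[R]_p)
    (La : R -> set 'rV[R]_p) := fun e => [set y | Om e y /\ La e (g e y)].

Lemma vnet_continuous n k (X : set 'rV[Rt]_n) Om (u : R -> 'rV[R]_n -> 'rV[R]_k) e x :
  vnet X Om u -> 0 < e <= 1 -> Om e x -> {for x, continuous (u e)}.
Proof.
by move=> vu e01 Ox; apply: continuous_coords => j; exact: snet_continuous (vu j) _ _.
Qed.

Lemma comp_net_domain n p (Y : set 'rV[Rt]_n) (X : set 'rV[Rt]_p) Om La c g :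
  gsf_net Y c Om g -> (forall y, Y y -> X (c y)) -> net_domain X La ->
  net_domain Y (comp_domain Om g La).
Proof.
move=> /gsf_netP[dO vg cg] YX dL; split=> [e e01|y Yy ye ry].
  rewrite openE => y [Oy Ly]; rewrite /interior.
  have := vnet_continuous vg e01 Oy => /(_ (La e) (near_open (dL.1 _ e01) Ly)).
  by move=> nL; apply: filterS2 (near_open (dO.1 e e01) Oy) nL.
near=> e; split; near: e; first exact: (dO.2 y Yy ye ry).
exact: (dL.2 _ (YX _ Yy)) (cg y ye Yy ry).
Unshelve. all: by end_near. Qed.

(** By the chain rule the compositions with [g] generate, together with the nets
    on [Y], a class closed under derivation. *)
Lemma snet_comp n p (Y : set 'rV[Rt]_n) (X : set 'rV[Rt]_p) Om La c g v :
  gsf_net Y c Om g -> (forall y, Y y -> X (c y)) ->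
  net_domain X La -> snet X La v ->
  net_domain Y (comp_domain Om g La) /\
  snet Y (comp_domain Om g La) (fun e y => v e (g e y)).
Proof.
move=> hc YX dL sv.
have dC := comp_net_domain hc YX dL.
have [dO vg cg] := (gsf_netP _ _ _ _).1 hc.
split=> //; set C := comp_domain Om g La.
apply: (@generated_snet n Y C [set H | snet Y C H \/
  exists2 w, snet X La w & H = fun e y => w e (g e y)]); last first.
  by apply: Gen; right; exists v.
move=> H [/snet_closed[h1 h2 h3]|[w sw ->{H}]].
  by split=> // i; have [F' sF' FF'] := h2 i; exists F' => //; apply: Gen; left.
have dg e x i : 0 < e <= 1 -> C e x -> derivable (g e) x (delta_mx 0 i).
  move=> e01 [Ox _]; apply: derivable_coords => j.
  exact: snet_derivable (vg j) _ _.
have key e x i (e01 : 0 < e <= 1) (Cx : C e x) :=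
  derive_comp_dir (dg e x i e01 Cx) (snet_differentiable dL sw e01 Cx.2).
split=> [e x e01 Cx|i|x xe Yx rx].
- split=> [|i]; last exact: (key e x i e01 Cx).1.
  apply: (@continuous_comp _ _ _ (g e)); first exact: vnet_continuous vg e01 Cx.1.
  exact: snet_continuous sw e01 Cx.2.
- exists (fun e y => \sum_j 'D_(delta_mx 0 i) (fun z => g e z 0 j) y *
                           'D_(delta_mx 0 j) (w e) (g e y)).
    elim: (index_enum _) => [|j s IH].
      have -> : (fun e y => \sum_(j <- [::]) 'D_(delta_mx 0 i) (fun z => g e z 0 j) y *
          'D_(delta_mx 0 j) (w e) (g e y)) = (fun _ _ => 0).
        by apply/funext => e; apply/funext => y; rewrite big_nil.
      by apply: Gen; left; exact: (snet_cst _ _ (mod0 rho)).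
    have -> : (fun e y => \sum_(j <- j :: s) 'D_(delta_mx 0 i) (fun z => g e z 0 j) y *
        'D_(delta_mx 0 j) (w e) (g e y)) = (fun e y =>
        'D_(delta_mx 0 i) (fun z => g e z 0 j) y * 'D_(delta_mx 0 j) (w e) (g e y) +
        \sum_(j <- s) 'D_(delta_mx 0 i) (fun z => g e z 0 j) y *
        'D_(delta_mx 0 j) (w e) (g e y)).
      by apply/funext => e; apply/funext => y; rewrite big_cons.
    apply: GenD => //; apply: GenM; apply: Gen; [left|right].
      have := snet_partial i dO (vg j) => /snet_sub; apply=> // e y.
      by case.
    by exists (fun e z => 'D_(delta_mx 0 j) (w e) z) => //; exact: snet_partial.
  move=> e x e01 Cx; rewrite -/(w e \o g e) (key e x i e01 Cx).2.
  rewrite derive_delta; last exact: snet_differentiable dL sw e01 Cx.2.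
  by apply: eq_bigr => j _; rewrite (derive_coord j (dg e x i e01 Cx)).2.
- exact: snet_moderate sw (YX _ Yx) (cg x xe Yx rx).
Qed.

Lemma gsf_net_comp n p k (Y : set 'rV[Rt]_n) (X : set 'rV[Rt]_p)
    (c : 'rV[Rt]_n -> 'rV[Rt]_p) (f : 'rV[Rt]_p -> 'rV[Rt]_k) Om La g v :
  gsf_net Y c Om g -> (forall y, Y y -> X (c y)) -> gsf_net X f La v ->
  gsf_net Y (f \o c) (comp_domain Om g La) (fun e => v e \o g e).
Proof.
move=> hc YX /gsf_netP[dL vv fv]; have [dO vg cg] := (gsf_netP _ _ _ _).1 hc.
apply/gsf_netP; split.
- exact: comp_net_domain hc YX dL.
- by move=> j; have [] := snet_comp hc YX dL (vv j).
- by move=> y ye Yy ry; apply: fv; [exact: YX|exact: cg].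
Qed.

End SmoothNets.

(** * Uniform estimates on internal sets *)

Section Derivatives.
Context {R : realType} {rho : gauge R}.
Local Notation Rt := (gnum rho).

(** Moderateness on [X] is a statement about nets of points; on a family [K] all of
    whose nets represent points of [X] it becomes uniform. *)
Definition internal_in n (X : set 'rV[Rt]_n) (K : R -> set 'rV[R]_n) :=
  (\forall e \near (0:R)^'+, exists y, K e y) /\
  forall xe, (\forall e \near (0:R)^'+, K e (xe e)) -> exists2 x, X x & vrep x xe.

Lemma internal_in_domain n (X : set 'rV[Rt]_n) Om K : net_domain X Om ->
  internal_in X K -> \forall e \near (0:R)^'+, forall y, K e y -> Om e y.
Proof.
move=> [_ XO] [K0 KX]; apply: uniform_near => // xe /KX[x Xx rx].
exact: (XO x Xx xe rx).
Qed.

Lemma snet_uniform n (X : set 'rV[Rt]_n) Om K F : snet X Om F ->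
  internal_in X K ->
  exists N : nat, \forall e \near (0:R)^'+, forall y, K e y -> `|F e y| <= rho e ^- N.
Proof.
move=> sF [K0 KX]; apply: uniform_mod => // xe /KX[x Xx rx].
exact: snet_moderate sF Xx rx.
Qed.

Definition convex_set n (K : set 'rV[R]_n) := forall y z (s : R), K y -> K z ->
  0 <= s <= 1 -> K (y + s *: (z - y)).

Lemma snet_lipschitz n (X : set 'rV[Rt]_n) Om K F : net_domain X Om ->
  snet X Om F -> internal_in X K -> (forall e, convex_set (K e)) ->
  exists N : nat, \forall e \near (0:R)^'+, forall y z, K e y -> K e z ->
    `|F e z - F e y| <= rho e ^- N * `|z - y|.
Proof.
move=> dO sF iK cK.
pose g e y := \sum_j `|'D_(delta_mx 0 j) (F e) y|.
have [N hN] : exists N : nat, \forall e \near (0:R)^'+, forall y, K e y ->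
    `|g e y| <= rho e ^- N.
  apply: uniform_mod iK.1 _ => xe /iK.2[x Xx rx]; apply: mod_sum => j.
  exact/mod_norm/(snet_moderate (snet_partial j dO sF) Xx rx).
have KO := internal_in_domain dO iK.
exists N; near=> e => y z Ky Kz.
have e01 : 0 < e <= 1 by near: e; exact: near_unit.
have KOe y' : K e y' -> Om e y' by move: y'; near: e.
have seg (s : R) : 0 <= s <= 1 -> K e (y + (s * 1) *: (z - y)).
  by move=> s01; rewrite mulr1; exact: cK.
have [s s01|s s01] := @mvt_line R n (F e) y (z - y) 1.
  exact/diff_derivable/(snet_differentiable dO sF e01)/KOe/seg.
rewrite scale1r [y + (z - y)]addrC subrK mul1r => ->.
rewrite derive_delta; last exact/(snet_differentiable dO sF e01)/KOe/seg.
apply: (le_trans (ler_norm_sum _ _ _)).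
apply: (@le_trans _ _ (g e (y + (s * 1) *: (z - y)) * `|z - y|)).
  rewrite /g mulr_suml; apply: ler_sum => j _.
  by rewrite normrM mulrC ler_wpM2l// coord_norm.
apply: ler_wpM2r => //; apply: le_trans (ler_norm _) _.
have : K e (y + (s * 1) *: (z - y)) by exact: seg.
by move: (y + _); near: e.
Unshelve. all: by end_near. Qed.

Lemma vrep_segment n (x : 'rV[Rt]_n) xe xe' ye : vrep x xe -> vrep x xe' ->
  (\forall e \near (0:R)^'+, exists2 s : R, 0 <= s <= 1 &
     ye e = xe e + s *: (xe' e - xe e)) -> vrep x ye.
Proof.
move=> rx rx' h; apply: (vrep_negl rx) => j.
apply: (negl_le ((vrep_eq rx rx').1 erefl j)); near=> e.
have [s /andP[s0 s1] ->] : exists2 s : R, 0 <= s <= 1 &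
     ye e = xe e + s *: (xe' e - xe e) by near: e.
rewrite !mxE opprD addNKr normrN normrM ger0_norm// distrC.
by rewrite ler_piMl.
Unshelve. all: by end_near. Qed.

(** The segment between two representatives consists of representatives, so that
    the net is Lipschitz on it with a moderate constant. *)
Lemma snet_indep n (X : set 'rV[Rt]_n) Om F x xe xe' : net_domain X Om ->
  snet X Om F -> X x -> vrep x xe -> vrep x xe' ->
  negl rho (fun e => F e (xe e) - F e (xe' e)).
Proof.
move=> dO sF Xx rx rx'.
pose K e := [set y | exists2 s : R, 0 <= s <= 1 & y = xe e + s *: (xe' e - xe e)].
have K0 e : K e (xe e) by exists 0; rewrite ?lexx ?ler01// scale0r addr0.
have K1 e : K e (xe' e) by exists 1; rewrite ?lexx ?ler01// scale1r addrC subrK.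
have iK : internal_in X K.
  split; first by near=> e; exists (xe e).
  by move=> ye hy; exists x => //; exact: vrep_segment rx rx' hy.
have cK e : convex_set (K e).
  move=> _ _ s [a a01 ->] [b b01 ->] s01; exists (a + s * (b - a)).
    by move: a01 b01 s01 => /andP[? ?] /andP[? ?] /andP[? ?]; apply/andP; nra.
  rewrite opprD addrACA subrr add0r -scalerBl scalerA -addrA -scalerDl.
  by [].
have [N hN] := snet_lipschitz dO sF iK cK.
have nv : negl rho (fun e => `|xe e - xe' e|).
  have H := @negl_sum _ rho _ (index_enum 'I_n) (fun j e => `|xe e 0 j - xe' e 0 j|).
  apply: (negl_le (H _)) => [j|].
    apply: (negl_le ((vrep_eq rx rx').1 erefl j)).
    by near=> e; rewrite normr_id.
  near=> e; rewrite normr_id; apply: le_trans (norm_le_sum _) _.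
  by apply: le_trans (ler_norm _); apply: ler_sum => j _; rewrite !mxE.
apply: (negl_le (neglM (mod_rhoV rho N) nv)); near=> e.
apply: le_trans (ler_norm _).
have H : forall y z, K e y -> K e z -> `|F e z - F e y| <= rho e ^- N * `|z - y|.
  by near: e.
exact: H (K1 e) (K0 e).
Unshelve. all: by end_near. Qed.

Lemma net_domainI n (X : set 'rV[Rt]_n) Om Om' : net_domain X Om ->
  net_domain X Om' -> net_domain X (fun e => Om e `&` Om' e).
Proof.
move=> [oO sO] [oO' sO']; split=> [e e01|x Xx xe rx].
  by apply: openI; [exact: oO|exact: oO'].
by apply: filterI; [exact: (sO x Xx xe rx)|exact: (sO' x Xx xe rx)].
Qed.

Lemma sharp_interior_sub n (X : set 'rV[Rt]_n) : sharp_interior X `<=` X.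
Proof.
move=> x [r r0]; apply; have [xe rx] := vrep_ex x; have [re rr] := rep_ex r.
have [K hK] := glt0_rep rr r0.
apply: (@near_gball _ _ _ _ _ _ _ _ _ K rx rx rr); near=> e.
by rewrite subrr normr0 add0r; near: e.
Unshelve. all: by end_near. Qed.

(** A function negligible near [x] whose second derivative is moderate has a
    negligible derivative: the difference quotient of step [rho ^ M] is off by
    at most [rho ^ (M - N)]. *)
Lemma snet_partial_negl n (X : set 'rV[Rt]_n) Om F i x xe : net_domain X Om ->
  snet X Om F -> (forall y ye, X y -> vrep y ye -> negl rho (fun e => F e (ye e))) ->
  sharp_interior X x -> vrep x xe ->
  negl rho (fun e => 'D_(delta_mx 0 i) (F e) (xe e)).
Proof.
move=> dO sF nF [r r0 rX] rx p; have [re rr] := rep_ex r.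
have [k hk] := glt0_rep rr r0.
pose K e := [set y | exists2 a : R, `|a| <= rho e ^+ k.+1 &
  y = xe e + a *: delta_mx 0 i].
have KX ye : (\forall e \near (0:R)^'+, K e (ye e)) -> exists2 y, X y & vrep y ye.
  move=> hy; have dy : \forall e \near (0:R)^'+, `|ye e - xe e| <= rho e ^+ k.+1.
    near=> e; have [a ha ->] : K e (ye e) by near: e.
    rewrite addrC addKr; apply: norm_coord => [|j]; first exact: le_trans ha.
    rewrite !mxE eqxx/=; case: eqP => _; rewrite ?mulr1// mulr0 normr0.
    exact: le_trans ha.
  have my : vmoderate (rho := rho) ye.
    move=> j; have -> : (fun e => ye e 0 j) = (fun e => xe e 0 j + (ye e - xe e) 0 j).
      by apply/funext => e; rewrite !mxE [RHS]addrC subrK.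
    apply: modD (rep_mod (rx j)) (mod_le (mod_rhoX rho k.+1) _); near=> e.
    apply: (le_trans (coord_norm _ _)); apply: le_trans (ler_norm _).
    by near: e.
  exists (\row_j cls (fun e => ye e 0 j)); last exact: vrep_cls.
  apply: rX; apply: (@near_gball _ _ _ _ _ _ _ _ _ k.+1 rx (vrep_cls my) rr).
  near=> e; have h1 : rho e ^+ k <= re e by near: e.
  have h2 : `|ye e - xe e| <= rho e ^+ k.+1 by near: e.
  apply: le_trans h1; have r1 : 0 < rho e <= 2^-1 by near: e; exact: gauge_half.
  by have := powS_half k r1; lra.
have iK : internal_in X K.
  split=> //; near=> e; exists (xe e), 0; last by rewrite scale0r addr0.
  have /gauge_le1[r1 ? _ _] : 0 < rho e <= 2^-1 by near: e; exact: gauge_half.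
  by rewrite normr0 exprn_ge0.
have sF1 := snet_partial i dO sF; have sF2 := snet_partial i dO sF1.
have [N hN] := snet_uniform sF2 iK.
have KO := internal_in_domain dO iK.
pose M := (N + (p + k).+2)%N.
have nFK : \forall e \near (0:R)^'+, forall y, K e y -> `|F e y| <= rho e ^+ (M + M).
  by apply: (uniform_near iK.1) => ye /KX[y Xy ry]; exact: (nF y ye Xy ry).
near=> e.
have e01 : 0 < e <= 1 by near: e; exact: near_unit.
have rh : 0 < rho e <= 2^-1 by near: e; exact: gauge_half.
have [q0 q0' q1 _] := gauge_le1 rh.
pose h := rho e ^+ M; have h0 : 0 < h by exact: exprn_gt0.
have KOe y : K e y -> Om e y by move: y; near: e.
have hNe y : K e y -> `|'D_(delta_mx 0 i) (fun z => 'D_(delta_mx 0 i) (F e) z) y| <= rho e ^- N.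
  by move: y; near: e.
have nFe y : K e y -> `|F e y| <= rho e ^+ (M + M) by move: y; near: e.
have hk1 : h <= rho e ^+ k.+1.
  by apply: ler_wiXn2l => //; rewrite /M; lia.
have c3 : h <= rho e ^+ (p + k).+2.
  by apply: ler_wiXn2l => //; rewrite /M; lia.
have c4 : rho e ^+ (p + k).+2 <= rho e ^+ p.+2 by apply: ler_wiXn2l => //; lia.
have inK (s : R) : 0 <= s <= 1 -> forall t, 0 <= t <= 1 ->
    K e (xe e + (s * (t * h)) *: delta_mx 0 i).
  move=> /andP[s0 s1] t /andP[t0 t1]; exists (s * (t * h)) => //.
  rewrite ger0_norm ?mulr_ge0// ?(ltW h0)//; apply: le_trans hk1.
  by rewrite mulrA ler_piMl ?mulr_ile1// ltW.
have one : 0 <= (1:R) <= 1 by rewrite ler01 lexx.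
have zero : 0 <= (0:R) <= 1 by rewrite ler01 lexx.
have [s s01|s s01 E1] := @mvt_line R n (F e) (xe e) (delta_mx 0 i) h.
  apply: (snet_derivable sF e01); apply: KOe.
  by have := inK s s01 1 one; rewrite mul1r.
have [t t01|t t01 E2] := @mvt_line R n (fun z => 'D_(delta_mx 0 i) (F e) z) (xe e)
    (delta_mx 0 i) (s * h).
  by apply: (snet_derivable sF1 e01); apply: KOe; exact: inK.
have b1 : `|F e (xe e + h *: delta_mx 0 i)| <= rho e ^+ (M + M).
  by apply: nFe; have := inK 1 one 1 one; rewrite !mul1r.
have b2 : `|F e (xe e)| <= rho e ^+ (M + M).
  by apply: nFe; have := inK 0 zero 1 one; rewrite mul0r scale0r addr0.
have b3 := hNe _ (inK t t01 s s01).
set D := 'D_(delta_mx 0 i) (F e) (xe e) in E2 *.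
set D1 := 'D_(delta_mx 0 i) (F e) (xe e + (s * h) *: delta_mx 0 i) in E1 E2.
set D2 := 'D_(delta_mx 0 i) _ (xe e + (t * (s * h)) *: delta_mx 0 i) in E2 b3.
have c1 : `|D1| <= h * 2.
  rewrite -(ler_pM2l h0) -[X in X * `|D1|](gtr0_norm h0) -normrM -E1.
  apply: (le_trans (ler_normB _ _)); apply: (le_trans (lerD b1 b2)).
  by rewrite exprD -/h mulrA mulr2n mulrDr mulr1.
have c2 : `|D1 - D| <= rho e ^+ (p + k).+2.
  rewrite E2 normrM normrM (ger0_norm (ltW h0)) ger0_norm; last by case/andP: s01.
  apply: (@le_trans _ _ (1 * h * rho e ^- N)).
    by apply: ler_pM => //; [rewrite mulr_ge0 ?(ltW h0)//; case/andP: s01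
      |rewrite ler_wpM2r ?(ltW h0)//; case/andP: s01].
  by rewrite mul1r /h /M exprD mulrAC divff ?mul1r// expf_neq0// gt_eqF.
have -> : D = D1 - (D1 - D) by rewrite subKr.
apply: (le_trans (ler_normB _ _)).
have := powS_half p rh; have := powS_half p.+1 rh.
have : 0 <= rho e ^+ p.+2 by exact: exprn_ge0.
move: c1 c2 c3 c4; clear; lra.
Unshelve. all: by end_near. Qed.

End Derivatives.

(** * Generalized partial derivatives *)

Section Partials.
Context {R : realType} {rho : gauge R}.
Local Notation Rt := (gnum rho).

Lemma partial_coord n k (X : set 'rV[Rt]_n) (f : 'rV[Rt]_n -> 'rV[Rt]_k) Om u x xe i j :
  gsf_net X f Om u -> X x -> vrep x xe ->
  \forall e \near (0:R)^'+, partial i (u e) (xe e) 0 j =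
    'D_(delta_mx 0 i) (fun y => u e y 0 j) (xe e).
Proof.
move=> [oO XO _] Xx rx; near=> e; have Ox : Om e (xe e) by near: e; exact: (XO x Xx xe rx).
have e01 : 0 < e <= 1 by near: e; exact: near_unit.
have [_ /(_ [::] (xe e) Ox)[_ d]] := oO e e01.
by rewrite (derive_coord j (d i)).2.
Unshelve. all: by end_near. Qed.

Lemma partial_vrep_ex n k (X : set 'rV[Rt]_n) (f : 'rV[Rt]_n -> 'rV[Rt]_k) Om u x xe i :
  gsf_net X f Om u -> X x -> vrep x xe ->
  exists y : 'rV[Rt]_k, vrep y (fun e => partial i (u e) (xe e)).
Proof.
move=> [_ _ h] Xx rx; have [_ /(_ [:: i]) m] := h x xe Xx rx.
by exists (\row_j cls (fun e => partial i (u e) (xe e) 0 j)); exact: vrep_cls.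
Qed.

Lemma partial_vrep_indep n k (X : set 'rV[Rt]_n) (f : 'rV[Rt]_n -> 'rV[Rt]_k) Om u
    x xe xe' i (y : 'rV[Rt]_k) :
  gsf_net X f Om u -> X x -> vrep x xe -> vrep x xe' ->
  vrep y (fun e => partial i (u e) (xe e)) ->
  vrep y (fun e => partial i (u e) (xe' e)).
Proof.
move=> gu Xx rx rx' ry; have [dO vu _] := (gsf_netP _ _ _ _).1 gu.
apply: (vrep_negl ry) => j.
apply: (negl_le (snet_indep dO (snet_partial i dO (vu j)) Xx rx rx')); near=> e.
have -> : partial i (u e) (xe e) 0 j = 'D_(delta_mx 0 i) (fun y => u e y 0 j) (xe e).
  by near: e; exact: partial_coord gu Xx rx.
suff -> : partial i (u e) (xe' e) 0 j =
  'D_(delta_mx 0 i) (fun y => u e y 0 j) (xe' e) by [].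
by near: e; exact: partial_coord gu Xx rx'.
Unshelve. all: by end_near. Qed.

(** The difference of two defining nets is negligible near an interior point, and so
    are its derivatives by [snet_partial_negl]. *)
Lemma interior_partial_vrep n k (X : set 'rV[Rt]_n) (f : 'rV[Rt]_n -> 'rV[Rt]_k) Om u
    x xe i y :
  gsf_net X f Om u -> sharp_interior X x -> vrep x xe ->
  interior_partial X i f x y -> vrep y (fun e => partial i (u e) (xe e)).
Proof.
move=> gu ix rx [Om' [u' [xe' [gu' rx' ry]]]]; have Xx := sharp_interior_sub ix.
have [z rz] := partial_vrep_ex i gu Xx rx'.
suff -> : y = z by exact: partial_vrep_indep gu Xx rx' rx rz.
apply/(vrep_eq ry rz) => j.
have [dO vu fu] := (gsf_netP _ _ _ _).1 gu.
have [dO' vu' fu'] := (gsf_netP _ _ _ _).1 gu'.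
have dI := net_domainI dO dO'.
have s1 : snet X (fun e => Om e `&` Om' e) (fun e x => u e x 0 j).
  by apply: snet_sub (vu j) _ _ => // e z' [].
have s2 : snet X (fun e => Om e `&` Om' e) (fun e x => u' e x 0 j).
  by apply: snet_sub (vu' j) _ _ => // e z' [].
have s3 := snetD s2 (snetN dI s1).
have := snet_partial_negl i dI s3 _ ix rx' => n3.
apply: negl_le (n3 _) _ => [p pe Xp rp|].
  exact: ((vrep_eq (fu' p pe Xp rp) (fu p pe Xp rp)).1 erefl j).
near=> e; have e01 : 0 < e <= 1 by near: e; exact: near_unit.
have Ox : Om e (xe' e) /\ Om' e (xe' e) by near: e; exact: (dI.2 x Xx xe' rx').
have -> : partial i (u e) (xe' e) 0 j = 'D_(delta_mx 0 i) (fun y => u e y 0 j) (xe' e).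
  by near: e; exact: partial_coord gu Xx rx'.
have -> : partial i (u' e) (xe' e) 0 j = 'D_(delta_mx 0 i) (fun y => u' e y 0 j) (xe' e).
  by near: e; exact: partial_coord gu' Xx rx'.
rewrite deriveD; [|exact: snet_derivable s2 e01 Ox|].
  by rewrite deriveN//; exact: snet_derivable s1 e01 Ox.
by apply: derivableN; exact: snet_derivable s1 e01 Ox.
Unshelve. all: by end_near. Qed.

Lemma gpartial_interior n k (X : set 'rV[Rt]_n) (f : 'rV[Rt]_n -> 'rV[Rt]_k) Om u x xe i :
  gsf_net X f Om u -> sharp_interior X x -> vrep x xe ->
  vrep (gpartial X i f x) (fun e => partial i (u e) (xe e)).
Proof.
move=> gu ix rx; have [y ry] := partial_vrep_ex i gu (sharp_interior_sub ix) rx.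
have Py : is_gpartial X i f x y by left; split=> //; exists Om, u, xe.
suff -> : gpartial X i f x = y by [].
apply: xget_unique => // z [[_ Pz]|[]//].
exact: vrep_uniq (interior_partial_vrep gu ix rx Pz) ry.
Qed.

(** Domains on which derivatives extend from the sharp interior: the points are
    given by a net of convex sets, and the interior is dense. *)
Definition regular n (X : set 'rV[Rt]_n) (A : R -> set 'rV[R]_n) := [/\
  forall xe, vmoderate (rho := rho) xe -> (\forall e \near (0:R)^'+, A e (xe e)) ->
    exists2 x, X x & vrep x xe,
  forall x, X x -> exists2 xe, vrep x xe & \forall e \near (0:R)^'+, A e (xe e),
  forall e, convex_set (A e) &
  forall x xe k, X x -> vrep x xe -> exists x' xe', [/\ sharp_interior X x',
    vrep x' xe' & \forall e \near (0:R)^'+, `|xe' e - xe e| <= rho e ^+ k]].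

Lemma common_exponent (I : finType) (P : I -> nat -> Prop) :
  (forall i n m, (n <= m)%N -> P i n -> P i m) ->
  (forall i, exists n, P i n) -> exists n, forall i, P i n.
Proof.
move=> mono /choice[N hN]; exists (\max_i N i)%N => i.
by apply: mono (hN i); exact: leq_bigmax.
Qed.

Lemma vmoderate_near n (xe ye : R -> 'rV[R]_n) : vmoderate (rho := rho) xe ->
  (\forall e \near (0:R)^'+, `|ye e - xe e| <= 1) -> vmoderate (rho := rho) ye.
Proof.
move=> mx h j; have -> : (fun e => ye e 0 j) = (fun e => xe e 0 j + (ye e - xe e) 0 j).
  by apply/funext => e; rewrite !mxE [RHS]addrC subrK.
apply: modD (mx j) (mod_small _ _); near=> e.
by apply: (le_trans (coord_norm _ _)); near: e.
Unshelve. all: by end_near. Qed.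

Lemma partial_lipschitz n k (X : set 'rV[Rt]_n) A (f : 'rV[Rt]_n -> 'rV[Rt]_k) Om u
    (x : 'rV[Rt]_n) xe i :
  regular X A -> gsf_net X f Om u -> vrep x xe ->
  (\forall e \near (0:R)^'+, A e (xe e)) ->
  exists N : nat, \forall e \near (0:R)^'+, forall y, A e y -> `|y - xe e| <= 1 ->
    `|partial i (u e) y - partial i (u e) (xe e)| <= rho e ^- N * `|y - xe e|.
Proof.
move=> [XA _ cA _] gu rx hA; have [dO vu _] := (gsf_netP _ _ _ _).1 gu.
pose K e := A e `&` [set y | `|y - xe e| <= 1].
have cK e : convex_set (K e).
  move=> y z s [Ay hy] [Az hz] s01; split; first exact: cA.
  move: s01 => /andP[s0 s1] /=.
  have -> : y + s *: (z - y) - xe e = (1 - s) *: (y - xe e) + s *: (z - xe e).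
    by apply/rowP => j; rewrite !mxE; ring.
  apply: (le_trans (ler_normD _ _)); rewrite !normrZ !ger0_norm ?subr_ge0//.
  apply: (@le_trans _ _ ((1 - s) * 1 + s * 1)); last lra.
  by apply: lerD; apply: ler_wpM2l; rewrite ?subr_ge0.
have iK : internal_in X K.
  split; first by near=> e; exists (xe e); split; [near: e|rewrite /= subrr normr0].
  move=> ye hy; apply: XA.
    apply: (vmoderate_near (vrep_mod rx)); near=> e.
    by have [] : K e (ye e) by near: e.
  near=> e; by have [] : K e (ye e) by near: e.
have KO := internal_in_domain dO iK.
pose P (j : 'I_k) (N : nat) := \forall e \near (0:R)^'+, forall y, K e y ->
  `|'D_(delta_mx 0 i) (fun z => u e z 0 j) y -
    'D_(delta_mx 0 i) (fun z => u e z 0 j) (xe e)| <= rho e ^- N * `|y - xe e|.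
have [N hN] : exists N, forall j, P j N.
  apply: common_exponent => [j a b ab Pa|j].
    rewrite /P; near=> e => y Ky.
    have /gauge_le1[r0 r0' r1 _] : 0 < rho e <= 2^-1 by near: e; exact: gauge_half.
    have h : forall y, K e y -> `|'D_(delta_mx 0 i) (fun z => u e z 0 j) y -
      'D_(delta_mx 0 i) (fun z => u e z 0 j) (xe e)| <= rho e ^- a * `|y - xe e|.
      by near: e.
    apply: le_trans (h y Ky) _; apply: ler_wpM2r => //.
    by rewrite lef_pV2 ?posrE ?exprn_gt0// ler_wiXn2l.
  have [N hN] := snet_lipschitz dO (snet_partial i dO (vu j)) iK cK.
  exists N; rewrite /P; near=> e => y Ky.
  have Kx : K e (xe e) by split; [near: e|rewrite /= subrr normr0].
  by move: (xe e) y Kx Ky; near: e.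
exists N; near=> e => y Ay hy.
have e01 : 0 < e <= 1 by near: e; exact: near_unit.
have Kx : K e (xe e) by split; [near: e|rewrite /= subrr normr0].
have Ky : K e y by [].
have r : 0 < rho e <= 2^-1 by near: e; exact: gauge_half.
have [r0 _ _ _] := gauge_le1 r.
have KOe z : K e z -> Om e z by move: z; near: e.
have h : forall j y, K e y -> `|'D_(delta_mx 0 i) (fun z => u e z 0 j) y -
    'D_(delta_mx 0 i) (fun z => u e z 0 j) (xe e)| <= rho e ^- N * `|y - xe e|.
  by near: e; apply: filter_forall.
apply: norm_coord => [|j]; first by rewrite mulr_ge0// invr_ge0 exprn_ge0// ltW.
have [oO _ _] := gu; have [_ sm] := oO e e01.
have dz z : K e z -> partial i (u e) z 0 j = 'D_(delta_mx 0 i) (fun z => u e z 0 j) z.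
  by move=> /KOe Oz; have [_ d] := sm [::] z Oz; rewrite (derive_coord j (d i)).2.
by rewrite !mxE (dz _ Ky) (dz _ Kx); exact: h.
Unshelve. all: by end_near. Qed.

(** Outside of the interior the derivative is a sharp limit. The derivatives of the
    net are Lipschitz near [x] with a moderate constant, hence their value at [x]
    is a limit; it is the only one as interior points are dense. *)
Lemma gpartial_vrep n k (X : set 'rV[Rt]_n) A (f : 'rV[Rt]_n -> 'rV[Rt]_k) Om u x xe i :
  regular X A -> gsf_net X f Om u -> X x -> vrep x xe ->
  vrep (gpartial X i f x) (fun e => partial i (u e) (xe e)).
Proof.
move=> rX gu Xx; have [XA AX cA dX] := rX.
have [ix|nix] := pselect (sharp_interior X x).
  by move=> rx; exact: gpartial_interior gu ix rx.
suff : exists2 xe, vrep x xe & vrep (gpartial X i f x) (fun e => partial i (u e) (xe e)).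
  by move=> [ye ry h] rx; exact: partial_vrep_indep gu Xx ry rx h.
have {xe}[xe rx hA] := AX _ Xx; exists xe => //.
have [y ry] := partial_vrep_ex i gu Xx rx.
have [N hN] := partial_lipschitz i rX gu rx hA.
(* The Lipschitz constant rho ^ - N turns a distance rho ^ (N + k') into rho ^ k';
   one more power of rho pays for moving to a representative inside A. *)
have near_val k' x' xe' (y' : 'rV[Rt]_k) :
    X x' -> vrep x' xe' -> vrep y' (fun e => partial i (u e) (xe' e)) ->
    (\forall e \near (0:R)^'+, `|xe' e - xe e| <= rho e ^+ (N + k').+1) ->
    exists2 ye', vrep y' ye' &
      \forall e \near (0:R)^'+, `|ye' e - partial i (u e) (xe e)| <= rho e ^+ k'.
  move=> Xx' rx' ry' hd; have [xe2 rx2 hA2] := AX _ Xx'.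
  exists (fun e => partial i (u e) (xe2 e)).
    exact: partial_vrep_indep gu Xx' rx' rx2 ry'.
  have hd2 : \forall e \near (0:R)^'+, `|xe2 e - xe e| <= rho e ^+ (N + k').
    have nn : negl rho (fun e => `|xe2 e - xe' e|).
      have := rep_eq (rep_gnorm (vrepB rx2 rx')) (rep_gnorm (vrepB rx' rx')).
      rewrite subrr => -[/(_ erefl) + _] => /negl_le; apply; near=> e.
      by rewrite subrr normr0 subr0.
    near=> e; have r : 0 < rho e <= 2^-1 by near: e; exact: gauge_half.
    have h1 : `|xe' e - xe e| <= rho e ^+ (N + k').+1 by near: e.
    have h2 : `|xe2 e - xe' e| <= rho e ^+ (N + k').+1.
      by rewrite -[leLHS]normr_id; near: e; exact: nn.
    rewrite -(subrKA (xe' e)); apply: (le_trans (ler_normD _ _)).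
    by have := powS_half (N + k') r; move: h1 h2; clear; lra.
  near=> e; have r : 0 < rho e <= 2^-1 by near: e; exact: gauge_half.
  have [r0 r0' r1 _] := gauge_le1 r.
  have h1 : `|xe2 e - xe e| <= rho e ^+ (N + k') by near: e.
  have h2 : A e (xe2 e) by near: e.
  have h3 : forall y, A e y -> `|y - xe e| <= 1 ->
    `|partial i (u e) y - partial i (u e) (xe e)| <= rho e ^- N * `|y - xe e| by near: e.
  apply: le_trans (h3 _ h2 _) _; first by apply: le_trans h1 _; exact: exprn_ile1.
  apply: le_trans (ler_wpM2l _ h1) _; first by rewrite invr_ge0 exprn_ge0.
  by rewrite exprD mulKf// expf_neq0// gt_eqF.
suff -> : gpartial X i f x = y by [].
apply: xget_unique.
  right; split=> // r r0; have [re rr] := rep_ex r; have [k' hk'] := glt0_rep rr r0.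
  exists (cls (fun e => rho e ^+ (N + k'.+1).+1)); first exact: glt0_rhoX.
  move=> x' ix' bx'; have Xx' := sharp_interior_sub ix'.
  have [xe' rx'] := vrep_ex x'; have [y' ry'] := partial_vrep_ex i gu Xx' rx'.
  exists y'; first (exists Om, u, xe'; split; [exact: gu|exact: rx'|exact: ry']).
  have hd := gball_rep rx rx' (rep_rhoX rho _) bx'.
  have [ye' ry2 hy2] := near_val _ _ _ _ Xx' rx' ry' hd.
  apply: (@near_gball _ _ _ _ _ _ _ _ _ k'.+1 ry ry2 rr); near=> e.
  have h1 : `|ye' e - partial i (u e) (xe e)| <= rho e ^+ k'.+1 by near: e.
  have h2 : rho e ^+ k' <= re e by near: e.
  have h : 0 < rho e <= 2^-1 by near: e; exact: gauge_half.
  by have := powS_half k' h; move: h1 h2; clear; lra.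
move=> z [[]//|[_ hz]]; have [ze rz] := vrep_ex z.
apply/(vrep_eq rz ry) => j k'.
have [s s0 hs] := hz _ (glt0_rhoX rho k'.+1).
have [se rs] := rep_ex s; have [M hM] := glt0_rep rs s0.
have [x' [xe' [ix' rx' hx']]] := dX x xe (maxn M.+1 (N + k'.+1).+1) Xx rx.
have Xx' := sharp_interior_sub ix'.
have rle (r : R) a b : 0 < r <= 2^-1 -> (a <= b)%N -> r ^+ b <= r ^+ a.
  by move=> /gauge_le1[? ? ? _] ab; apply: ler_wiXn2l.
have bx' : gball x s x'.
  apply: (@near_gball _ _ _ _ _ _ _ _ _ M.+1 rx rx' rs); near=> e.
  have h1 : `|xe' e - xe e| <= rho e ^+ (maxn M.+1 (N + k'.+1).+1) by near: e.
  have h2 : rho e ^+ M <= se e by near: e.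
  have h : 0 < rho e <= 2^-1 by near: e; exact: gauge_half.
  have := rle _ _ _ h (leq_maxl M.+1 (N + k'.+1).+1).
  by have := powS_half M h; move: h1 h2; clear; lra.
have [y' /(interior_partial_vrep gu ix' rx') ry' by'] := hs x' ix' bx'.
have [ye' ry2 hy2] : exists2 ye', vrep y' ye' &
    \forall e \near (0:R)^'+, `|ye' e - partial i (u e) (xe e)| <= rho e ^+ k'.+1.
  apply: (near_val _ x' xe' _ Xx' rx' ry'); near=> e.
  have h1 : `|xe' e - xe e| <= rho e ^+ (maxn M.+1 (N + k'.+1).+1) by near: e.
  apply: (le_trans h1); apply: rle (leq_maxr _ _).
  by near: e; exact: gauge_half.
have hz2 := gball_rep rz ry2 (rep_rhoX rho _) by'.
near=> e; have h : 0 < rho e <= 2^-1 by near: e; exact: gauge_half.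
have h1 : `|ye' e - ze e| <= rho e ^+ k'.+1 by near: e.
have h2 : `|ye' e - partial i (u e) (xe e)| <= rho e ^+ k'.+1 by near: e.
have c1 := le_trans (coord_norm _ j) h1; have c2 := le_trans (coord_norm _ j) h2.
move: c1 c2 (powS_half k' h); rewrite !mxE.
move: (ye' e 0 j) (ze e 0 j) (partial i (u e) (xe e) 0 j) => a b c.
by clear; rewrite !ler_norml => /andP[? ?] /andP[? ?] ?; apply/andP; split; lra.
Unshelve. all: by end_near. Qed.

Lemma gpartial_net n k (X : set 'rV[Rt]_n) A (f : 'rV[Rt]_n -> 'rV[Rt]_k) Om u i :
  regular X A -> gsf_net X f Om u ->
  gsf_net X (gpartial X i f) Om (fun e => partial i (u e)).
Proof.
move=> rX gu; have [oO XO h] := gu; split; [|exact: XO|].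
  move=> e e01; have [oe sm] := oO e e01; split; [exact: oe|] => s x Ox.
  have := sm (rcons s i) x Ox; rewrite /partials -cats1 foldr_cat.
  exact.
move=> x xe Xx rx; split; first exact: gpartial_vrep rX gu Xx rx.
move=> s; have [_ /(_ (rcons s i))] := h x xe Xx rx.
by rewrite /partials -cats1; under eq_fun do rewrite foldr_cat.
Qed.

(** Both sides are represented by derivatives of the defining nets, to which the
    classical chain rule applies. *)
Lemma gpartial_comp n p (Y : set 'rV[Rt]_n) B (X : set 'rV[Rt]_p) A
    (c : 'rV[Rt]_n -> 'rV[Rt]_p) (f : 'rV[Rt]_p -> Rt) i :
  regular Y B -> regular X A -> gsf Y c -> gsf X (fun x => sc (f x)) ->
  (forall y, Y y -> X (c y)) -> forall y, Y y ->
  gpartial Y i (fun y => sc (f (c y))) y 0 0 =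
  \sum_j gpartial Y i c y 0 j * gpartial X j (fun x => sc (f x)) (c y) 0 0.
Proof.
move=> rY rX [Om [u gu]] [La [v gv]] YX y Yy; have [ye ry] := vrep_ex y.
have gc : gsf_net Y (fun y => sc (f (c y))) (comp_domain Om u La) (fun e => v e \o u e).
  exact: gsf_net_comp gu YX gv.
have [dO vu hu] := (gsf_netP _ _ _ _).1 gu.
have [dL vv hv] := (gsf_netP _ _ _ _).1 gv.
have rc := hu _ _ Yy ry.
have r1 := gpartial_vrep i rY gc Yy ry 0.
have r2 : rep (\sum_j gpartial Y i c y 0 j * gpartial X j (fun x => sc (f x)) (c y) 0 0)
    (fun e => \sum_j partial i (u e) (ye e) 0 j * partial j (v e) (u e (ye e)) 0 0).
  apply: rep_sum => j; apply: repM; first exact: gpartial_vrep i rY gu Yy ry j.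
  exact: gpartial_vrep j rX gv (YX y Yy) rc 0.
apply: rep_uniq (rep_near r1 _) r2.
have pc : \forall e \near (0:R)^'+, forall j, partial j (v e) (u e (ye e)) 0 0 =
    'D_(delta_mx 0 j) (fun y => v e y 0 0) (u e (ye e)).
  by apply: filter_forall => j; exact: partial_coord gv (YX y Yy) rc.
near=> e.
have e01 : 0 < e <= 1 by near: e; exact: near_unit.
have Oe : Om e (ye e) by near: e; exact: (dO.2 _ Yy _ ry).
have Le : La e (u e (ye e)) by near: e; exact: (dL.2 _ (YX y Yy) _ rc).
have pce j : partial j (v e) (u e (ye e)) 0 0 =
    'D_(delta_mx 0 j) (fun y => v e y 0 0) (u e (ye e)) by move: j; near: e.
have -> : partial i (v e \o u e) (ye e) 0 0 =
    'D_(delta_mx 0 i) (fun y => v e (u e y) 0 0) (ye e).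
  by near: e; exact: (partial_coord i 0 gc Yy ry).
have du : derivable (u e) (ye e) (delta_mx 0 i).
  by apply: derivable_coords => j; exact: snet_derivable (vu j) e01 Oe.
have dv := snet_differentiable dL (vv 0) e01 Le.
have [_ ] := derive_comp_dir du dv; rewrite /comp => ->.
by rewrite derive_delta//; apply: eq_bigr => j _; rewrite pce.
Unshelve. all: by end_near. Qed.

End Partials.

(** * Differential algebra on an interval *)

Section Algebra.
Context {R : realType} {rho : gauge R}.
Local Notation Rt := (gnum rho).
Variables (t1 t2 : Rt).
Hypothesis t12 : glt t1 t2.
Local Notation I := (gcc t1 t2).

Definition slab n (j0 : 'I_n) : set 'rV[Rt]_n := [set x | I (x 0 j0)].

Definition real_slab n (j0 : 'I_n) (a b : R -> R) (e : R) : set 'rV[R]_n :=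
  [set y | a e <= y 0 j0 <= b e].

Lemma gcc_near (a b : R -> R) (t : Rt) te : rep t1 a -> rep t2 b -> rep t te ->
  (\forall e \near (0:R)^'+, a e <= te e <= b e) -> I t.
Proof.
move=> ra rb rt h; split; [apply: (near_gle ra rt)|apply: (near_gle rt rb)];
  near=> e; have /andP[] : a e <= te e <= b e by near: e.
  by [].
by [].
Unshelve. all: by end_near. Qed.

Definition clip (a b x : R) := Num.max a (Num.min b x).

Lemma clip_in (a b x : R) : a <= b -> a <= clip a b x <= b.
Proof. by move=> ab; rewrite /clip le_max lexx/= ge_max ab ge_min lexx. Qed.

Lemma clip_dist (a b x c : R) : a <= b -> 0 <= c -> a <= x + c -> x <= b + c ->
  `|x - clip a b x| <= c.
Proof.
move=> ab c0 ax xb; rewrite /clip minEle; case: ifPn => [bx|].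
  by rewrite max_r// ler_norml; apply/andP; split; lra.
rewrite -ltNge => xb'; rewrite maxEle; case: ifPn => [_|].
  by rewrite subrr normr0.
by rewrite -ltNge => xa; rewrite ler_norml; apply/andP; split; lra.
Qed.

Lemma near_ab (a b : R -> R) : rep t1 a -> rep t2 b ->
  \forall e \near (0:R)^'+, a e <= b e.
Proof.
move=> ra rb; have [K hK] := glt_rep ra rb t12; near=> e.
have /gauge_le1[r0 r0' _ _] : 0 < rho e <= 2^-1 by near: e; exact: gauge_half.
have h : a e + rho e ^+ K <= b e by near: e.
by apply: le_trans h; rewrite lerDl exprn_ge0.
Unshelve. all: by end_near. Qed.

(** The order of generalized numbers leaves a negligible slack, which clipping
    removes: points of [t1, t2] have representatives inside the real intervals. *)
Lemma rep_clip (a b : R -> R) (t : Rt) te : rep t1 a -> rep t2 b -> rep t te -> I t ->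
  rep t (fun e => clip (a e) (b e) (te e)).
Proof.
move=> ra rb rt [It1 It2]; apply: (rep_negl rt) => k; near=> e.
have /gauge_le1[r0 r0' _ _] : 0 < rho e <= 2^-1 by near: e; exact: gauge_half.
apply: clip_dist.
- by near: e; exact: near_ab.
- exact: exprn_ge0.
- by near: e; exact: gle_rep ra rt It1 k.
- by near: e; exact: gle_rep rt rb It2 k.
Unshelve. all: by end_near. Qed.

Definition set_coord n (j0 : 'I_n) (y : 'rV[R]_n) (c : R) : 'rV[R]_n :=
  \row_j (if j == j0 then c else y 0 j).

(** The interval is longer than a power of [rho]; moving the distinguished coordinate
    inside by a higher power [rho ^ M] gives nearby interior points. *)
Lemma regular_slab n (j0 : 'I_n) (a b : R -> R) : rep t1 a -> rep t2 b ->
  regular (slab j0) (real_slab j0 a b).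
Proof.
move=> ra rb; have [K hK] := glt_rep ra rb t12; split.
- move=> xe mx hx; exists (\row_j cls (fun e => xe e 0 j)); last exact: vrep_cls.
  exact: gcc_near ra rb (vrep_cls mx j0) hx.
- move=> x Ix; have [xe rx] := vrep_ex x.
  exists (fun e => set_coord j0 (xe e) (clip (a e) (b e) (xe e 0 j0))).
    move=> j; rewrite /set_coord; under eq_fun do rewrite mxE.
    have [->|jj] := eqVneq j j0; last exact: rx.
    exact: rep_clip.
  near=> e; rewrite /real_slab/= mxE eqxx; apply: clip_in.
  by near: e; exact: near_ab.
- move=> e y z s; rewrite /real_slab/= => /andP[y1 y2] /andP[z1 z2] /andP[s0 s1].
  by rewrite !mxE; apply/andP; split; nra.
- move=> x xe k Ix rx.
  pose M := (maxn k K.+2).+1.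
  pose xe' e := set_coord j0 (xe e)
    (clip (a e + rho e ^+ M) (b e - rho e ^+ M) (xe e 0 j0)).
  have hM : \forall e \near (0:R)^'+, a e + rho e ^+ M <= b e - rho e ^+ M.
    near=> e; have r : 0 < rho e <= 2^-1 by near: e; exact: gauge_half.
    have [r0 r0' r1 _] := gauge_le1 r.
    have h : a e + rho e ^+ K <= b e by near: e.
    have h1 : rho e ^+ M <= rho e ^+ K.+1.
      by apply: ler_wiXn2l => //; rewrite /M; lia.
    by move: (powS_half K r) h h1; clear; lra.
  have hd : \forall e \near (0:R)^'+, `|xe' e - xe e| <= rho e ^+ k.
    have Ix1 := gle_rep ra (rx j0) Ix.1 M; have Ix2 := gle_rep (rx j0) rb Ix.2 M.
    near=> e; have r : 0 < rho e <= 2^-1 by near: e; exact: gauge_half.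
    have [r0 r0' r1 _] := gauge_le1 r.
    apply: norm_coord => [|j]; first exact: exprn_ge0.
    rewrite !mxE; have [->|jj] := eqVneq j j0; last first.
      by rewrite subrr normr0 exprn_ge0.
    rewrite distrC; apply: clip_dist; first by near: e.
    - exact: exprn_ge0.
    - have h : a e <= xe e 0 j0 + rho e ^+ M by near: e.
      have : rho e ^+ M <= rho e ^+ k.+1 by apply: ler_wiXn2l => //; rewrite /M; lia.
      by move: (powS_half k r) h; clear; lra.
    - have h : xe e 0 j0 <= b e + rho e ^+ M by near: e.
      have : rho e ^+ M <= rho e ^+ k.+1 by apply: ler_wiXn2l => //; rewrite /M; lia.
      by move: (powS_half k r) h; clear; lra.
  have mx' : vmoderate (rho := rho) xe'.
    apply: (vmoderate_near (vrep_mod rx)); near=> e.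
    have r : 0 < rho e <= 2^-1 by near: e; exact: gauge_half.
    have [r0 r0' r1 _] := gauge_le1 r.
    by apply: (@le_trans _ _ (rho e ^+ k)); [near: e|exact: exprn_ile1].
  exists (\row_j cls (fun e => xe' e 0 j)), xe'; split=> //; last exact: vrep_cls.
  exists (cls (fun e => rho e ^+ M)); first exact: glt0_rhoX.
  move=> y by'; have [ye ry] := vrep_ex y.
  have hy := gball_rep (vrep_cls mx') ry (rep_rhoX rho M) by'.
  apply: (gcc_near ra rb (ry j0)); near=> e.
  have h1 : `|ye e - xe' e| <= rho e ^+ M by near: e.
  have := le_trans (coord_norm _ j0) h1; rewrite !mxE eqxx.
  have : a e + rho e ^+ M <= b e - rho e ^+ M by near: e.
  move=> /(clip_in (xe e 0 j0)); move: (clip _ _ _) => c.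
  clear; rewrite ler_norml => /andP[? ?] /andP[? ?].
  by apply/andP; split; lra.
Unshelve. all: by end_near. Qed.

Local Notation X1 := (line I).

Lemma regular_line : exists A, regular (line I) A.
Proof.
have [a ra] := rep_ex t1; have [b rb] := rep_ex t2.
by exists (real_slab 0 a b); exact: (@regular_slab 1 0 a b ra rb).
Qed.

Lemma sc00 (x : 'rV[Rt]_1) : sc (x 0 0) = x.
Proof. by apply/rowP => j; rewrite mxE (ord1 j). Qed.

(** ** Scalar functions on [t1, t2] *)

Definition gnet (f : Rt -> Rt) Om (F : R -> 'rV[R]_1 -> R) :=
  [/\ net_domain X1 Om, snet X1 Om F & forall x xe, X1 x -> vrep x xe ->
      rep (f (x 0 0)) (fun e => F e (xe e))].

Definition gsmooth (f : Rt -> Rt) := exists Om F, gnet f Om F.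

Local Notation D := (gder_sc I).

Lemma gsf_net_gnet (f : Rt -> Rt) Om u :
  gsf_net X1 (fun x => sc (f (x 0 0))) Om u -> gnet f Om (fun e x => u e x 0 0).
Proof.
move=> /gsf_netP[dO vu h]; split=> // x xe Xx rx.
by have := h x xe Xx rx 0; rewrite mxE.
Qed.

Lemma gnet_gsf_net (f : Rt -> Rt) Om F : gnet f Om F ->
  gsf_net X1 (fun x => sc (f (x 0 0))) Om (fun e x => const_mx (F e x)).
Proof.
move=> [dO sF h]; apply/gsf_netP; split=> [//|j|x xe Xx rx j].
  by apply: (snet_ext dO sF) => e x _ _; rewrite mxE.
by rewrite mxE; under eq_fun do rewrite mxE; exact: h.
Qed.

Lemma gsmoothP (f : Rt -> Rt) : gsmooth f <-> gsf1 I (fun t => sc (f t)).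
Proof.
split=> [[Om [F /gnet_gsf_net h]]|[Om [u /gsf_net_gnet h]]].
  by exists Om, (fun e x => const_mx (F e x)).
by exists Om, (fun e x => u e x 0 0).
Qed.

Lemma gsf_net_ext n k (X : set 'rV[Rt]_n) (f g : 'rV[Rt]_n -> 'rV[Rt]_k) Om u :
  (forall x, X x -> f x = g x) -> gsf_net X f Om u -> gsf_net X g Om u.
Proof.
move=> fg [h1 h2 h3]; split=> // x xe Xx rx; rewrite -fg//; exact: h3.
Qed.

(** Derivatives depend on the values on [X] only; this is what allows rewriting
    under the derivation of functions known on [t1, t2]. *)
Lemma gpartial_ext n k (X : set 'rV[Rt]_n) i (f g : 'rV[Rt]_n -> 'rV[Rt]_k) :
  (forall x, X x -> f x = g x) -> gpartial X i f = gpartial X i g.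
Proof.
move=> fg; apply/funext => x; rewrite /gpartial; congr xget; apply/seteqP.
have aux (f1 f2 : 'rV[Rt]_n -> 'rV[Rt]_k) : (forall x, X x -> f1 x = f2 x) ->
    forall x y, interior_partial X i f1 x y -> interior_partial X i f2 x y.
  move=> f12 x' y [Om [u [xe [gu rx ry]]]]; exists Om, u, xe.
  by split; [exact: gsf_net_ext f12 gu|exact: rx|exact: ry].
have aux2 (f1 f2 : 'rV[Rt]_n -> 'rV[Rt]_k) : (forall x, X x -> f1 x = f2 x) ->
    forall x y, is_gpartial X i f1 x y -> is_gpartial X i f2 x y.
  move=> f12 x' y [[ix h]|[nx h]]; [left|right].
    by split; [exact: ix|exact: aux f12 _ _ h].
  split; first exact: nx.
  move=> r /h[s s0 hs]; exists s; first exact: s0.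
  move=> z iz /(hs z iz)[y' hy' bz].
  by exists y'; [exact: aux f12 _ _ hy'|exact: bz].
by split=> y; apply: aux2 => z Xz; [exact: fg|exact/esym/fg].
Qed.

Lemma D_ext (f g : Rt -> Rt) : (forall t, I t -> f t = g t) -> D f = D g.
Proof.
move=> fg; apply/funext => t; rewrite /gder_sc/gder.
have E : gpartial X1 0 (fun x => sc (f (x 0 0))) = gpartial X1 0 (fun x => sc (g (x 0 0))).
  by apply: gpartial_ext => x Xx; rewrite fg.
by rewrite E.
Qed.

Lemma gnet_ext (f g : Rt -> Rt) Om F : (forall t, I t -> f t = g t) ->
  gnet f Om F -> gnet g Om F.
Proof. by move=> fg [h1 h2 h3]; split=> // x xe Xx rx; rewrite -fg//; exact: h3. Qed.

Lemma gsmooth_ext (f g : Rt -> Rt) : (forall t, I t -> f t = g t) ->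
  gsmooth f -> gsmooth g.
Proof. by move=> fg [Om [F /(gnet_ext fg) h]]; exists Om, F. Qed.

Local Notation d0 := (delta_mx 0 0 : 'rV[R]_1).

Lemma gnet_D (f : Rt -> Rt) Om F : gnet f Om F ->
  gnet (D f) Om (fun e x => 'D_d0 (F e) x).
Proof.
move=> gF; have [dO sF h] := gF; split=> //; first exact: snet_partial.
have [A rA] := regular_line; have gu := gnet_gsf_net gF.
move=> x xe Xx rx; rewrite /gder_sc/gder sc00.
have := gpartial_vrep 0 rA gu Xx rx 0 => /rep_near; apply; near=> e.
have -> : partial 0 (fun x0 : 'rV[R]_1 => const_mx (F e x0) : 'rV[R]_1) (xe e) 0 0 =
    'D_d0 (fun y => (const_mx (F e y) : 'rV[R]_1) 0 0) (xe e).
  by near: e; exact: (partial_coord 0 0 gu Xx rx).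
by congr ('D_d0 _ _); apply/funext => y; rewrite mxE.
Unshelve. all: by end_near. Qed.

Lemma gsmooth_D (f : Rt -> Rt) : gsmooth f -> gsmooth (D f).
Proof. by move=> [Om [F /gnet_D h]]; exists Om, (fun e x => 'D_d0 (F e) x). Qed.

Lemma gnet_sub (f : Rt -> Rt) Om Om' F : gnet f Om F -> net_domain X1 Om' ->
  (forall e, Om' e `<=` Om e) -> gnet f Om' F.
Proof. by move=> [dO sF h] dO' OO; split=> //; exact: snet_sub sF _ _. Qed.

Lemma gsmooth2 (f g : Rt -> Rt) : gsmooth f -> gsmooth g ->
  exists Om F G, gnet f Om F /\ gnet g Om G.
Proof.
move=> [Of [F gF]] [Og [G gG]]; exists (fun e => Of e `&` Og e), F, G.
have dI := net_domainI (let: And3 h _ _ := gF in h) (let: And3 h _ _ := gG in h).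
by split; [apply: gnet_sub gF dI _|apply: gnet_sub gG dI _] => e x [].
Qed.

Lemma gnet_eq (f g : Rt -> Rt) Om F Om' G : gnet f Om F -> gnet g Om' G ->
  (forall x xe, X1 x -> vrep x xe -> \forall e \near (0:R)^'+, F e (xe e) = G e (xe e)) ->
  forall t, I t -> f t = g t.
Proof.
move=> [_ _ hF] [_ _ hG] FG t It.
have Xt : X1 (sc t) by rewrite /line/= mxE.
have [xe rx] := vrep_ex (sc t).
have := hF _ _ Xt rx; have := hG _ _ Xt rx; rewrite mxE => rg rf.
exact: rep_uniq (rep_near rf (FG _ _ Xt rx)) rg.
Qed.

Lemma gnetD (f g : Rt -> Rt) Om F G : gnet f Om F -> gnet g Om G ->
  gnet (fun t => f t + g t) Om (fun e x => F e x + G e x).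
Proof.
move=> [dO sF hF] [_ sG hG]; split=> //; first exact: snetD.
by move=> x xe Xx rx; apply: repD; [exact: hF|exact: hG].
Qed.

Lemma gnetM (f g : Rt -> Rt) Om F G : gnet f Om F -> gnet g Om G ->
  gnet (fun t => f t * g t) Om (fun e x => F e x * G e x).
Proof.
move=> [dO sF hF] [_ sG hG]; split=> //; first exact: snetM.
by move=> x xe Xx rx; apply: repM; [exact: hF|exact: hG].
Qed.

Lemma net_domainT n (X : set 'rV[Rt]_n) : net_domain X (fun=> setT).
Proof. by split=> [e _|x _ xe _]; [exact: openT|near=> e].
Unshelve. all: by end_near. Qed.

Lemma gnet_cst (c : Rt) ce : rep c ce -> gnet (fun=> c) (fun=> setT) (fun e _ => ce e).
Proof.
move=> rc; split=> //; first exact: net_domainT.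
exact: snet_cst (rep_mod rc).
Qed.

Lemma gnet_id : gnet id (fun=> setT) (fun e x => x 0 0).
Proof.
split; [exact: net_domainT|exact: snet_coord|].
by move=> x xe _ rx; exact: rx.
Qed.

Lemma gsmoothD (f g : Rt -> Rt) : gsmooth f -> gsmooth g -> gsmooth (fun t => f t + g t).
Proof.
move=> sf sg; have [Om [F [G [gF gG]]]] := gsmooth2 sf sg.
by exists Om, (fun e x => F e x + G e x); exact: gnetD.
Qed.

Lemma gsmoothM (f g : Rt -> Rt) : gsmooth f -> gsmooth g -> gsmooth (fun t => f t * g t).
Proof.
move=> sf sg; have [Om [F [G [gF gG]]]] := gsmooth2 sf sg.
by exists Om, (fun e x => F e x * G e x); exact: gnetM.
Qed.

Lemma gsmooth_cst (c : Rt) : gsmooth (fun=> c).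
Proof.
by have [ce rc] := rep_ex c; exists (fun=> setT), (fun e _ => ce e); exact: gnet_cst.
Qed.

Lemma gsmooth_id : gsmooth id.
Proof. by exists (fun=> setT), (fun e x => x 0 0); exact: gnet_id. Qed.

Lemma near_domain Om x xe : net_domain X1 Om -> X1 x -> vrep x xe ->
  \forall e \near (0:R)^'+, 0 < e <= 1 /\ Om e (xe e).
Proof.
move=> dO Xx rx; near=> e; split; near: e; first exact: near_unit.
exact: (dO.2 x Xx xe rx).
Unshelve. all: by end_near. Qed.

Lemma D_add (f g : Rt -> Rt) : gsmooth f -> gsmooth g ->
  forall t, I t -> D (fun t => f t + g t) t = D f t + D g t.
Proof.
move=> sf sg; have [Om [F [G [gF gG]]]] := gsmooth2 sf sg.
apply: (gnet_eq (gnet_D (gnetD gF gG)) (gnetD (gnet_D gF) (gnet_D gG))).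
move=> x xe Xx rx; have [[dO sF _] [_ sG _]] := (gF, gG).
near=> e; have [e01 Oe] : 0 < e <= 1 /\ Om e (xe e) by near: e; exact: near_domain Xx rx.
by rewrite deriveD//; [exact: snet_derivable sF e01 Oe|exact: snet_derivable sG e01 Oe].
Unshelve. all: by end_near. Qed.

Lemma D_mul (f g : Rt -> Rt) : gsmooth f -> gsmooth g ->
  forall t, I t -> D (fun t => f t * g t) t = D f t * g t + f t * D g t.
Proof.
move=> sf sg; have [Om [F [G [gF gG]]]] := gsmooth2 sf sg.
apply: (gnet_eq (gnet_D (gnetM gF gG)) (gnetD (gnetM (gnet_D gF) gG) (gnetM gF (gnet_D gG)))).
move=> x xe Xx rx; have [[dO sF _] [_ sG _]] := (gF, gG).
near=> e; have [e01 Oe] : 0 < e <= 1 /\ Om e (xe e) by near: e; exact: near_domain Xx rx.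
rewrite deriveM; [|exact: snet_derivable sF e01 Oe|exact: snet_derivable sG e01 Oe].
by rewrite addrC [X in X + _ = _]mulrC.
Unshelve. all: by end_near. Qed.

Lemma D_cst (c : Rt) t : I t -> D (fun=> c) t = 0.
Proof.
move: t; have [ce rc] := rep_ex c.
apply: (gnet_eq (gnet_D (gnet_cst rc)) (gnet_cst (rep0 rho))).
by move=> x xe _ _; near=> e; exact: derive_cst.
Unshelve. all: by end_near. Qed.

Lemma D_id t : I t -> D id t = 1.
Proof.
move: t; apply: (gnet_eq (gnet_D gnet_id) (gnet_cst (rep1 rho))).
move=> x xe _ _; near=> e; rewrite (derivable_coord _ _ _).2 mxE eqxx//.
Unshelve. all: by end_near. Qed.

Lemma gsmooth_sum (J : Type) (s : seq J) (f : J -> Rt -> Rt) :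
  (forall j, gsmooth (f j)) -> gsmooth (fun t => \sum_(j <- s) f j t).
Proof.
move=> sf; elim: s => [|j s IH].
  by apply: gsmooth_ext (gsmooth_cst 0) => t _; rewrite big_nil.
by apply: gsmooth_ext (gsmoothD (sf j) IH) => t _; rewrite big_cons.
Qed.

Lemma D_sum (J : Type) (s : seq J) (f : J -> Rt -> Rt) : (forall j, gsmooth (f j)) ->
  forall t, I t -> D (fun t => \sum_(j <- s) f j t) t = \sum_(j <- s) D (f j) t.
Proof.
move=> sf; elim: s => [|j s IH] t It.
  rewrite (@D_ext _ (fun=> 0)) ?(D_cst 0 It) ?big_nil// => u _; exact: big_nil.
rewrite big_cons -IH// -D_add//; last exact: gsmooth_sum.
by congr (_ t); apply: D_ext => u _; rewrite big_cons.
Qed.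

Lemma D_scale (c : Rt) (f : Rt -> Rt) : gsmooth f ->
  forall t, I t -> D (fun t => c * f t) t = c * D f t.
Proof.
by move=> sf t It; rewrite D_mul ?D_cst ?mul0r ?add0r//; exact: gsmooth_cst.
Qed.

Lemma gsmoothX (f : Rt -> Rt) n : gsmooth f -> gsmooth (fun t => f t ^+ n).
Proof.
move=> sf; elim: n => [|n IH].
  by apply: gsmooth_ext (gsmooth_cst 1) => t _; rewrite expr0.
by apply: gsmooth_ext (gsmoothM sf IH) => t _; rewrite exprS.
Qed.

Definition Dn i (f : Rt -> Rt) := iter i D f.

Lemma gsmooth_Dn i f : gsmooth f -> gsmooth (Dn i f).
Proof. by move=> sf; elim: i => //= i IH; exact: gsmooth_D. Qed.

Lemma Dn_ext i (f g : Rt -> Rt) : (forall t, I t -> f t = g t) ->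
  forall t, I t -> Dn i f t = Dn i g t.
Proof. by move=> fg; elim: i => [//|i IH] t It /=; rewrite (D_ext IH). Qed.

(** ** Vector valued functions on [t1, t2] *)

(** Finitely many scalar nets are restricted to the intersection of their domains. *)
Lemma gsf1P k (f : Rt -> 'rV[Rt]_k) :
  gsf1 I f <-> forall j, gsmooth (fun t => f t 0 j).
Proof.
split=> [[Om [u gu]] j|h].
  have [dO vu hu] := (gsf_netP _ _ _ _).1 gu.
  exists Om, (fun e x => u e x 0 j); split=> // x xe Xx rx.
  exact: hu Xx rx j.
have /choice[Om /choice[F hF]] := h.
exists (fun e => [set x | forall j, Om j e x]), (fun e x => \row_j F j e x).
have dO : net_domain X1 (fun e => [set x | forall j, Om j e x]).
  split=> [e e01|x Xx xe rx].
    rewrite openE => x Ox; rewrite /interior.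
    apply: (@filter_forall _ 'I_k (fun j => Om j e) (nbhs x)) => j.
    have [[oO _] _ _] := hF j; exact: near_open (oO e e01) (Ox j).
  apply: filter_forall => j; have [[_ XO] _ _] := hF j.
  exact: (XO x Xx xe rx).
apply/gsf_netP; split=> // [j|x xe Xx rx j].
  have [_ sF _] := hF j.
  have sF' : snet X1 (fun e => [set x | forall j, Om j e x]) (F j).
    by apply: snet_sub sF _ _ => // e x; exact.
  by apply: (snet_ext dO sF') => e x _ _; rewrite mxE.
have [_ _ r] := hF j; under eq_fun do rewrite mxE.
exact: r Xx rx.
Qed.

Lemma gder_coord k (f : Rt -> 'rV[Rt]_k) j t : gsf1 I f -> I t ->
  gder I f t 0 j = D (fun s => f s 0 j) t.
Proof.
move=> [Om [u gu]] It; have [dO vu hu] := (gsf_netP _ _ _ _).1 gu.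
have gj : gnet (fun t => f t 0 j) Om (fun e x => u e x 0 j).
  by split=> // x xe Xx rx; exact: hu Xx rx j.
have Xt : X1 (sc t) by rewrite /line/= mxE.
have [A rA] := regular_line; have [xe rx] := vrep_ex (sc t).
have r1 := gpartial_vrep 0 rA gu Xt rx j.
have [_ _ /(_ _ _ Xt rx)] := gnet_D gj; rewrite mxE => r2.
apply: rep_uniq (rep_near r1 _) r2; exact: (partial_coord 0 j gu Xt rx).
Qed.

Lemma gdern_coord k (f : Rt -> 'rV[Rt]_k) i : gsf1 I f ->
  gsf1 I (gdern I i f) /\
  forall j t, I t -> gdern I i f t 0 j = Dn i (fun s => f s 0 j) t.
Proof.
move=> sf; elim: i => [|i [IH1 IH2]]; first by split.
have E j t : I t -> gdern I i.+1 f t 0 j = Dn i.+1 (fun s => f s 0 j) t.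
  move=> It; rewrite /gdern iterS gder_coord//.
  by rewrite (D_ext (IH2 j)).
split=> //; apply/gsf1P => j.
apply: (@gsmooth_ext (Dn i.+1 (fun s => f s 0 j))) => [t It|]; first by rewrite E.
by apply: gsmooth_Dn; move: sf => /gsf1P.
Qed.

(** ** Chain rule *)

Lemma gsf_net_curve k (c : Rt -> 'rV[Rt]_k) : (forall j, gsmooth (fun t => c t 0 j)) ->
  exists Om u, gsf_net X1 (fun x => c (x 0 0)) Om u.
Proof. by move=> /gsf1P. Qed.

Lemma gsmooth_comp k (X : set 'rV[Rt]_k) (f : 'rV[Rt]_k -> Rt) (c : Rt -> 'rV[Rt]_k) :
  gsf X (fun x => sc (f x)) -> (forall j, gsmooth (fun t => c t 0 j)) ->
  (forall t, I t -> X (c t)) -> gsmooth (fun t => f (c t)).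
Proof.
move=> [La [v gv]] /gsf_net_curve[Om [u gu]] cX.
apply/gsmoothP; eexists; eexists.
exact: (gsf_net_comp gu (fun x => cX (x 0 0)) gv).
Qed.

Lemma D_comp k (X : set 'rV[Rt]_k) A (f : 'rV[Rt]_k -> Rt) (c : Rt -> 'rV[Rt]_k) :
  regular X A ->
  gsf X (fun x => sc (f x)) -> (forall j, gsmooth (fun t => c t 0 j)) ->
  (forall t, I t -> X (c t)) -> forall t, I t ->
  D (fun t => f (c t)) t =
  \sum_j D (fun s => c s 0 j) t * gpartial X j (fun x => sc (f x)) (c t) 0 0.
Proof.
move=> rX sf sc1 cX t It; have [A1 rA1] := regular_line.
have Xt : X1 (sc t) by rewrite /line/= mxE.
have sc2 := (gsf1P c).2 sc1.
have XX (x : 'rV[Rt]_1) : X1 x -> X (c (x 0 0)) by exact: cX.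
rewrite -[LHS]/(gpartial X1 0 (fun x => sc (f (c (x 0 0)))) (sc t) 0 0).
rewrite (gpartial_comp 0 rA1 rX sc2 sf XX Xt) mxE.
by apply: eq_bigr => j _; congr (_ * _); exact: gder_coord.
Qed.

End Algebra.

(** * Integrals of continuous real functions *)

Section RealIntegral.
Context {R : realType}.
Implicit Types (a b c d : R) (f g : R -> R).

Definition rint a b f := \int[lebesgue_measure]_(x in `[a, b]) f x.

Definition cont_on a b f := forall x, a <= x <= b -> {for x, continuous f}.

Lemma cont_on_sub a b c d f : a <= c -> d <= b -> cont_on a b f -> cont_on c d f.
Proof.
move=> ac db h x /andP[cx xd]; apply: h.
by rewrite (le_trans ac cx) (le_trans xd db).
Qed.

Lemma cont_on_within a b f : cont_on a b f -> {within `[a, b], continuous f}.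
Proof.
move=> h; apply: continuous_in_subspaceT => x; rewrite inE/= in_itv/=; exact: h.
Qed.

Lemma cont_on_integrable a b f : cont_on a b f ->
  lebesgue_measure.-integrable `[a, b] (EFin \o f).
Proof.
move=> h; apply: continuous_compact_integrable; first exact: segment_compact.
exact: cont_on_within.
Qed.

Lemma rint_bound a b f (C : R) : a <= b -> cont_on a b f ->
  (forall x, a <= x <= b -> `|f x| <= C) -> `|rint a b f| <= C * (b - a).
Proof.
move=> ab cf hC; rewrite /rint.
apply: le_trans (le_normr_Rintegral _ _) _; [exact: measurable_itv|exact: cont_on_integrable|].
apply: (@le_trans _ _ (\int[lebesgue_measure]_(x in `[a, b]) cst C x)).
  apply: le_Rintegral.
  - exact: measurable_itv.
  - apply: (@cont_on_integrable _ _ (fun x => `|f x|)) => x /cf cx.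
    by apply: continuous_comp => //; exact: norm_continuous.
  - by apply: (@cont_on_integrable _ _ (cst C)) => x _; exact: cst_continuous.
  - by move=> x; rewrite /= in_itv/=; exact: hC.
rewrite Rintegral_cst//= lebesgue_measure_itv/= lte_fin.
by case: ltP => ba /=; rewrite ?lexx// mulr0 mulr_ge0// ?subr_ge0//;
  apply: le_trans (hC a _); rewrite ?lexx ?ab.
Qed.

Lemma rintB a b f g : cont_on a b f -> cont_on a b g ->
  rint a b (fun x => f x - g x) = rint a b f - rint a b g.
Proof.
move=> cf cg; apply: RintegralB; [exact: measurable_itv| |];
  exact: cont_on_integrable.
Qed.

Lemma rint_split a b c f : a <= c -> c <= b -> cont_on a b f ->
  rint a b f = rint a c f + rint c b f.
Proof.
move=> ac cb cf.
have := @Rintegral_itvB R f (BLeft a) (BRight b) c (cont_on_integrable cf).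
rewrite !bnd_simp => /(_ ac cb); rewrite Rintegral_itv_obnd_cbnd; last first.
  apply: (@integrableS _ _ _ lebesgue_measure `[a, b]).
  - exact: measurable_itv.
  - exact: measurable_itv.
  - by apply: subset_itv => //; rewrite bnd_simp.
  - exact: cont_on_integrable.
by rewrite /rint => <-; rewrite addrC subrK.
Qed.

Lemma eq_rint a b f g : (forall x, a <= x <= b -> f x = g x) -> rint a b f = rint a b g.
Proof.
by move=> fg; apply: eq_Rintegral => x; rewrite inE/= in_itv/=; exact: fg.
Qed.

Lemma rint_lower a b c d f (C : R) : a <= c -> c <= d -> d <= b -> cont_on a b f ->
  (forall x, a <= x <= b -> 0 <= f x) -> (forall x, c <= x <= d -> C <= f x) ->
  C * (d - c) <= rint a b f.
Proof.
move=> ac cd db cf f0 fC.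
have cb := le_trans cd db.
rewrite (rint_split ac cb cf) (rint_split cd db); last exact: cont_on_sub cf.
have p1 : 0 <= rint a c f.
  apply: Rintegral_ge0 => x; rewrite /= in_itv/= => /andP[ax xc]; apply: f0.
  by rewrite ax (le_trans xc cb).
have p2 : 0 <= rint d b f.
  apply: Rintegral_ge0 => x; rewrite /= in_itv/= => /andP[dx xb]; apply: f0.
  by rewrite xb (le_trans ac (le_trans cd dx)).
suff : C * (d - c) <= rint c d f by move: p1 p2; lra.
apply: (@le_trans _ _ (\int[lebesgue_measure]_(x in `[c, d]) cst C x)).
  rewrite Rintegral_cst//=.
  rewrite lebesgue_measure_itv/= lte_fin; case: ltP => //= dc.
  have -> : d = c by apply/eqP; rewrite eq_le cd dc.
  by rewrite subrr.
apply: le_Rintegral.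
- exact: measurable_itv.
- by apply: (@cont_on_integrable _ _ (cst C)) => x _; exact: cst_continuous.
- by apply: cont_on_integrable; exact: cont_on_sub cf.
- by move=> x; rewrite /= in_itv/=; exact: fC.
Qed.

Lemma rint_FTC a b f F : a < b -> cont_on a b f ->
  (forall x, a <= x <= b -> is_derive x 1 F (f x)) -> rint a b f = F b - F a.
Proof.
move=> ab cf dF.
have cF x : a <= x <= b -> {for x, continuous F}.
  move=> /dF[d _]; apply: differentiable_continuous; exact/derivable1_diffP.
rewrite /rint /Rintegral.
rewrite (@continuous_FTC2 R f F a b ab (cont_on_within cf))//.
  split.
  - by move=> x /subset_itv_oo_cc; rewrite in_itv/= => /dF[].
  - by apply: cvg_at_right_filter; apply: cF; rewrite lexx ltW.
  - by apply: cvg_at_left_filter; apply: cF; rewrite lexx ltW.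
by move=> x /subset_itv_oo_cc; rewrite in_itv/= => /dF[_ <-]; rewrite derive1E.
Qed.

(** ** Integrals depending on a parameter *)

Definition row2 (s t : R) : 'rV[R]_2 := \row_j (if j == 0 then s else t).

Lemma row2_0 s t : row2 s t 0 0 = s. Proof. by rewrite mxE eqxx. Qed.

Lemma row2_1 s t : row2 s t 0 1 = t. Proof. by rewrite mxE. Qed.

Lemma row2_near (s t : R) (A : set 'rV[R]_2) : nbhs (row2 s t) A ->
  \forall t' \near t & s' \near s, A (row2 s' t').
Proof.
move=> /nbhs_ballP[r /= r0 hA].
have r20 : 0 < r / 2 by rewrite divr_gt0.
exists (ball t (r / 2), ball s (r / 2)); first by split; exact: nbhsx_ballx.
move=> [t' s'] [/= ht hs]; apply: hA; rewrite -ball_normE/=.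
apply: (@le_lt_trans _ _ (r / 2)); last by rewrite ltr_pdivrMr// ltr_pMr// ltr1n.
apply: norm_coord => [|j]; first exact: ltW.
rewrite !mxE; case: (j == 0); move: ht hs; rewrite -!ball_normE/=; [move=> _|move=> + _];
  exact: ltW.
Qed.

Lemma row2_continuous (s t : R) (G : 'rV[R]_2 -> R) :
  {for row2 s t, continuous G} ->
  {for t, continuous (fun t' => G (row2 s t'))}.
Proof.
move=> cG A /cG /row2_near /= [[U V] /= [nU nV] UV].
apply: filterS nU => t' Ut'; apply: (UV (t', s)).
by split=> //=; exact: nbhs_singleton.
Qed.

(** The tube lemma for a segment. *)
Lemma compact_near_param a b (s : R) (P : R -> R -> Prop) :
  (forall t, a <= t <= b -> \forall t' \near t & s' \near s, P s' t') ->
  \forall s' \near s, forall t, a <= t <= b -> P s' t.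
Proof.
move=> h; have /compact_near_coveringP := @segment_compact R a b.
move=> /(_ R (nbhs s) P _) cov.
have : \forall s' \near s, `[a, b] `<=` P s'.
  by apply: cov => t; rewrite /= in_itv/=; exact: h.
by apply: filterS => s' hs t tI; apply: hs; rewrite /= in_itv/=.
Qed.

(** The derivative is dominated by a constant: a bound on the compact segment, which
    persists up to 1 for nearby parameters by the tube lemma. *)
Lemma rint_param_derive a b (W : set 'rV[R]_2) (G G' : 'rV[R]_2 -> R) (s : R) :
  a <= b -> open W -> (forall t, a <= t <= b -> W (row2 s t)) ->
  (forall x, W x -> [/\ {for x, continuous G}, {for x, continuous G'},
    derivable G x (delta_mx 0 0) & 'D_(delta_mx 0 0) G x = G' x]) ->
  is_derive s 1 (fun s' => rint a b (fun t => G (row2 s' t)))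
    (rint a b (fun t => G' (row2 s t))).
Proof.
move=> ab oW Ws hG.
have nW : \forall s' \near s, forall t, a <= t <= b -> W (row2 s' t).
  apply: compact_near_param => t /Ws Wt.
  by apply: row2_near; exact: near_open.
have cs : cont_on a b (fun t => G' (row2 s t)).
  by move=> t /Ws/hG[_ c _ _]; exact: row2_continuous.
have [C hC] : exists C : R, forall t, a <= t <= b -> `|G' (row2 s t)| <= C.
  have cn : {within `[a, b], continuous (fun t => `|G' (row2 s t)|)}.
    apply: cont_on_within => t /cs ct; apply: continuous_comp => //.
    exact: norm_continuous.
  have [c _ hc] := EVT_max ab cn.
  by exists `|G' (row2 s c)| => t tI; apply: hc; rewrite in_itv.
have nC : \forall s' \near s, forall t, a <= t <= b -> `|G' (row2 s' t)| <= C + 1.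
  apply: compact_near_param => t tI.
  apply: (@row2_near s t [set x | `|G' x| <= C + 1]).
  have [_ /(@cvgrPdist_le _ _ _ (nbhs (row2 s t)))/(_ 1 ltr01) c _ _] := hG _ (Ws t tI).
  apply: filterS c => x /= hx.
  have := hC t tI; have := ler_distD (G' x) 0 (G' (row2 s t)).
  have := ler_normB (G' (row2 s t)) (G' (row2 s t) - G' x).
  by rewrite subKr; move: hx; lra.
have [r /= r0 hr] := (nbhs_ballP _ _).1 (filterI nW nC).
have Ib s' : s' \in `]s - r, s + r[%R ->
    (forall t, a <= t <= b -> W (row2 s' t)) /\
    forall t, a <= t <= b -> `|G' (row2 s' t)| <= C + 1.
  move=> sI; apply: hr; rewrite -ball_normE/= ltr_distlC.
  by move: sI; rewrite in_itv.
have der s' t : (forall t, a <= t <= b -> W (row2 s' t)) -> a <= t <= b ->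
    is_derive s' 1 (fun z => G (row2 z t)) (G' (row2 s' t)).
  move=> Ws' tI; have [_ _ d <-] := hG _ (Ws' t tI).
  have E z : row2 z t = row2 0 t + z *: delta_mx 0 0.
    apply/rowP => j; rewrite !mxE eqxx/=; case: (j == 0).
      by rewrite add0r mulr1.
    by rewrite mulr0 addr0.
  have -> : (fun z => G (row2 z t)) = (fun z => G (row2 0 t + z *: delta_mx 0 0)).
    by apply/funext => z; rewrite E.
  by have := @is_derive_line R 2 G (row2 0 t) (delta_mx 0 0) s'; rewrite -E; exact.
have sI : s \in `]s - r, s + r[%R by rewrite in_itv/= ltrBlDr ltrDl r0.
have C0 : 0 <= C + 1.
  have aI : a <= a <= b by rewrite lexx ab.
  by have := hC a aI; have := normr_ge0 (G' (row2 s a)); lra.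
have intG z : [set` `]s - r, s + r[%R] z ->
    lebesgue_measure.-integrable `[a, b] (EFin \o (fun t => G (row2 z t))).
  move=> /Ib[Wz _]; apply: cont_on_integrable => t /Wz/hG[c _ _ _].
  exact: row2_continuous.
have derG z t : [set` `]s - r, s + r[%R] z -> `[a, b]%classic t ->
    derivable (fun z => G (row2 z t)) z 1.
  by move=> /Ib[Wz _]; rewrite /= in_itv/= => tI; have [] := der z t Wz tI.
have intC : lebesgue_measure.-integrable `[a, b] (EFin \o (cst (C + 1) : R -> R)).
  by apply: cont_on_integrable => x _; exact: cst_continuous.
have bndG z t : [set` `]s - r, s + r[%R] z -> `[a, b]%classic t ->
    `|partial1of2 (fun z t => G (row2 z t)) z t| <= (cst (C + 1) : R -> R) t.
  move=> /Ib[Wz Cz]; rewrite /= in_itv/= => tI; rewrite partial1of2E.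
  by have [_ ->] := der z t Wz tI; exact: Cz.
have mI : measurable `[a, b]%classic by exact: measurable_itv.
split.
  have := @derivable_under_integral R _ _ lebesgue_measure
    (fun z t => G (row2 z t)) `[a, b]%classic mI s (s - r) (s + r) sI intG derG
    (cst (C + 1)) (fun=> C0) intC bndG.
  exact.
have := @differentiation_under_integral R _ _ lebesgue_measure
    (fun z t => G (row2 z t)) `[a, b]%classic mI s (s - r) (s + r) sI intG derG
    (cst (C + 1)) (fun=> C0) intC bndG.
rewrite derive1E => ->.
apply: eq_rint => t tI; rewrite partial1of2E.
by have [_ ->] := der s t (Ib s sI).1 tI.
Qed.

End RealIntegral.

(** * The generalized integral *)

Section Integral.
Context {R : realType} {rho : gauge R}.
Local Notation Rt := (gnum rho).
Variables (t1 t2 : Rt).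
Hypothesis t12 : glt t1 t2.
Local Notation I := (gcc t1 t2).
Local Notation X1 := (line I).
Local Notation D := (gder_sc I).
Local Notation d0 := (delta_mx 0 0 : 'rV[R]_1).

Definition pt (t : R) : 'rV[R]_1 := const_mx t.

Lemma pt_continuous (t : R) (F : 'rV[R]_1 -> R) : {for pt t, continuous F} ->
  {for t, continuous (fun s => F (pt s))}.
Proof.
move=> cF; apply: (@continuous_comp _ _ _ pt F) => //.
apply/(@cvgrPdist_le _ _ _ (nbhs t)) => e e0.
apply/nbhs_ballP; exists e => //= s; rewrite -ball_normE/= => h.
by apply: norm_coord => [|j]; [exact: ltW|rewrite !mxE ltW].
Qed.

Lemma ptE t : pt t = 0 + t *: d0.
Proof. by apply/rowP => j; rewrite !mxE add0r (ord1 j) eqxx mulr1. Qed.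

Lemma pt00 (y : 'rV[R]_1) : y = pt (y 0 0).
Proof. by apply/rowP => j; rewrite mxE (ord1 j). Qed.

Lemma strict_near (a b : R -> R) : rep t1 a -> rep t2 b ->
  \forall e \near (0:R)^'+, a e < b e.
Proof.
move=> ra rb; have [K hK] := glt_rep ra rb t12; near=> e.
have /gauge_le1[r0 r0' _ _] : 0 < rho e <= 2^-1 by near: e; exact: gauge_half.
have h : a e + rho e ^+ K <= b e by near: e.
by apply: lt_le_trans h; rewrite ltrDl exprn_gt0.
Unshelve. all: by end_near. Qed.

Lemma length_near (a b : R -> R) : rep t1 a -> rep t2 b ->
  exists N : nat, \forall e \near (0:R)^'+, 0 <= b e - a e <= rho e ^- N.
Proof.
move=> ra rb; have [N hN] := mod_bound (rep_mod (repB rb ra)); exists N.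
near=> e; have ab : a e < b e by near: e; exact: strict_near.
by rewrite subr_ge0 (ltW ab)/=; apply: le_trans (ler_norm _) _; near: e.
Unshelve. all: by end_near. Qed.

(** Different representatives of [t1] and [t2] bound different real intervals; the
    hull contains both, and is still internal in [t1, t2]. *)
Definition hull (a b c d : R -> R) (e : R) : set 'rV[R]_1 :=
  [set y | Num.min (a e) (c e) <= y 0 0 <= Num.max (b e) (d e)].

Lemma rep_in_I (a b c d : R -> R) te : rep t1 a -> rep t2 b -> rep t1 c -> rep t2 d ->
  (\forall e \near (0:R)^'+, Num.min (a e) (c e) <= te e <= Num.max (b e) (d e)) ->
  exists2 t, I t & rep t te.
Proof.
move=> ra rb rc rd h.
have mt : te \in moderate rho.
  have := modD (modD (mod_norm (rep_mod ra)) (mod_norm (rep_mod rb)))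
               (modD (mod_norm (rep_mod rc)) (mod_norm (rep_mod rd))).
  move=> /mod_le; apply; near=> e.
  have : Num.min (a e) (c e) <= te e <= Num.max (b e) (d e) by near: e.
  apply: contraTT; rewrite -ltNge ger0_norm ?addr_ge0// => h1.
  have := ler_norm (a e); have := ler_norm (b e); have := ler_norm (c e).
  have := ler_norm (d e); have := ler_norm (- a e); have := ler_norm (- b e).
  have := ler_norm (- c e); have := ler_norm (- d e).
  move: (normr_ge0 (a e)) (normr_ge0 (b e)) (normr_ge0 (c e)) (normr_ge0 (d e)).
  rewrite !normrN negb_and -!ltNge lt_min gt_max.
  move: h1; case: (ger0P (te e)) => h0 h1; move=> *.
    by apply/orP; right; apply/andP; split; lra.
  by apply/orP; left; apply/andP; split; lra.
exists (cls te); last exact: rep_cls.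
have rt := rep_cls mt; split.
  apply: (rep_gle ra rt) => k.
  have := (rep_eq ra rc).1 erefl k => n1; near=> e.
  have : Num.min (a e) (c e) <= te e <= Num.max (b e) (d e) by near: e.
  have : `|a e - c e| <= rho e ^+ k by near: e.
  have : 0 < rho e <= 2^-1 by near: e; exact: gauge_half.
  move=> /gauge_le1[_ /(exprn_ge0 k) + _ _].
  rewrite ler_norml ge_min => p0 /andP[? ?] /andP[/orP[] ? _]; lra.
apply: (rep_gle rt rb) => k.
have := (rep_eq rb rd).1 erefl k => n1; near=> e.
have : Num.min (a e) (c e) <= te e <= Num.max (b e) (d e) by near: e.
have : `|b e - d e| <= rho e ^+ k by near: e.
have : 0 < rho e <= 2^-1 by near: e; exact: gauge_half.
move=> /gauge_le1[_ /(exprn_ge0 k) + _ _].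
rewrite ler_norml le_max => p0 /andP[? ?] /andP[_ /orP[] ?]; lra.
Unshelve. all: by end_near. Qed.

Lemma hull_internal (a b c d : R -> R) : rep t1 a -> rep t2 b -> rep t1 c -> rep t2 d ->
  internal_in X1 (hull a b c d).
Proof.
move=> ra rb rc rd; split.
  near=> e; exists (pt (a e)); rewrite /hull/= mxE.
  have ab : a e < b e by near: e; exact: strict_near.
  by rewrite ge_min lexx/= le_max (ltW ab).
move=> ye hy; have [t It rt] := rep_in_I ra rb rc rd hy.
exists (sc t); first by rewrite /line/= mxE.
by move=> j; rewrite mxE (ord1 j).
Unshelve. all: by end_near. Qed.

Lemma snet_cont_on Om F (e a b : R) : snet X1 Om F -> 0 < e <= 1 ->
  (forall t, a <= t <= b -> Om e (pt t)) -> cont_on a b (fun t => F e (pt t)).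
Proof. by move=> sF e01 h t /h Ot; apply: pt_continuous; exact: snet_continuous sF _ _. Qed.

Lemma rint_net_mod f Om F (a b : R -> R) : gnet t1 t2 f Om F ->
  rep t1 a -> rep t2 b ->
  (fun e => rint (a e) (b e) (fun t => F e (pt t))) \in moderate rho.
Proof.
move=> [dO sF _] ra rb; have iK := hull_internal ra rb ra rb.
have KO := internal_in_domain dO iK; have [N hN] := snet_uniform sF iK.
apply: (mod_le (modM (mod_rhoV rho N) (rep_mod (repB rb ra)))); near=> e.
have e01 : 0 < e <= 1 by near: e; exact: near_unit.
have ab : a e < b e by near: e; exact: strict_near.
have tK t : a e <= t <= b e -> hull a b a b e (pt t).
  by rewrite /hull/= mxE minxx maxxx.
apply: le_trans (ler_norm _); apply: rint_bound; first exact: ltW.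
  apply: (snet_cont_on sF e01) => t /tK; move: (pt t); near: e; exact: KO.
move=> t /tK; move: (pt t); near: e; exact: hN.
Unshelve. all: by end_near. Qed.

(** The integrands differ negligibly, uniformly on the hull, and the end points move
    by negligible amounts while the integrand is moderate. *)
Lemma rint_net_indep f Om F Om' F' (a b c d : R -> R) : gnet t1 t2 f Om F ->
  gnet t1 t2 f Om' F' -> rep t1 a -> rep t2 b -> rep t1 c -> rep t2 d ->
  negl rho (fun e => rint (c e) (d e) (fun t => F' e (pt t)) -
                     rint (a e) (b e) (fun t => F e (pt t))).
Proof.
move=> [dO sF hF] [dO' sF' hF'] ra rb rc rd.
have iK := hull_internal ra rb rc rd.
have KO := internal_in_domain dO iK; have KO' := internal_in_domain dO' iK.
have [N hN] := snet_uniform sF' iK; have [L hL] := length_near ra rb.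
move=> n.
have hd : \forall e \near (0:R)^'+, forall y, hull a b c d e y ->
    `|F' e y - F e y| <= rho e ^+ (L + n.+2).
  apply: uniform_near iK.1 _ => ye /iK.2[y Xy ry].
  exact: (rep_eq (hF' _ _ Xy ry) (hF _ _ Xy ry)).1 erefl (L + n.+2)%N.
have nac := (rep_eq ra rc).1 erefl (N + n.+2)%N.
have nbd := (rep_eq rb rd).1 erefl (N + n.+2)%N.
near=> e.
have e01 : 0 < e <= 1 by near: e; exact: near_unit.
have r : 0 < rho e <= 2^-1 by near: e; exact: gauge_half.
have [r0 r0' r1 _] := gauge_le1 r.
have ab : a e < b e by near: e; exact: strict_near.
have cd : c e < d e by near: e; exact: strict_near.
pose p := Num.min (a e) (c e); pose q := Num.max (b e) (d e).
have pa : p <= a e by rewrite /p ge_min lexx.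
have pc : p <= c e by rewrite /p ge_min lexx orbT.
have bq : b e <= q by rewrite /q le_max lexx.
have dq : d e <= q by rewrite /q le_max lexx orbT.
have tK t : p <= t <= q -> hull a b c d e (pt t) by rewrite /hull/= mxE.
have cF : cont_on p q (fun t => F e (pt t)).
  by apply: (snet_cont_on sF e01) => t /tK; move: (pt t); near: e; exact: KO.
have cF' : cont_on p q (fun t => F' e (pt t)).
  by apply: (snet_cont_on sF' e01) => t /tK; move: (pt t); near: e; exact: KO'.
have bF' t : p <= t <= q -> `|F' e (pt t)| <= rho e ^- N.
  by move=> /tK; move: (pt t); near: e.
have bd t : p <= t <= q -> `|F' e (pt t) - F e (pt t)| <= rho e ^+ (L + n.+2).
  by move=> /tK; move: (pt t); near: e.
pose P x := rint p x (fun t => F' e (pt t)).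
have lip x y : p <= x -> x <= y -> y <= q -> `|P y - P x| <= rho e ^- N * (y - x).
  move=> px xy yq; rewrite /P (@rint_split _ p y x)//; last exact: cont_on_sub cF'.
  rewrite addrC addKr; apply: rint_bound => //; first exact: cont_on_sub cF'.
  move=> t /andP[xt ty]; apply: bF'.
  by rewrite (le_trans px xt) (le_trans ty yq).
have lip2 x y : p <= x -> p <= y -> x <= q -> y <= q ->
    `|x - y| <= rho e ^+ (N + n.+2) -> `|P y - P x| <= rho e ^+ n.+2.
  move=> px py xq yq xy.
  have E : rho e ^- N * rho e ^+ (N + n.+2) = rho e ^+ n.+2.
    by rewrite exprD mulKf// expf_neq0// gt_eqF.
  rewrite -E; have [le|/ltW le] := lerP x y.
    apply: le_trans (lip x y px le yq) _; apply: ler_wpM2l.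
      by rewrite invr_ge0 exprn_ge0.
    by apply: le_trans xy; rewrite distrC ler_norm.
  rewrite distrC; apply: le_trans (lip y x py le xq) _; apply: ler_wpM2l.
    by rewrite invr_ge0 exprn_ge0.
  by apply: le_trans xy; rewrite ler_norm.
have E1 : rint (c e) (d e) (fun t => F' e (pt t)) = P (d e) - P (c e).
  rewrite /P (@rint_split _ p (d e) (c e))// ?(ltW cd)//; last exact: cont_on_sub cF'.
  by rewrite addrC addKr.
have E2 : rint (a e) (b e) (fun t => F' e (pt t)) = P (b e) - P (a e).
  rewrite /P (@rint_split _ p (b e) (a e))// ?(ltW ab)//; last exact: cont_on_sub cF'.
  by rewrite addrC addKr.
have aq : a e <= q by exact: le_trans (ltW ab) bq.
have cq : c e <= q by exact: le_trans (ltW cd) dq.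
have pb : p <= b e by exact: le_trans pa (ltW ab).
have pd : p <= d e by exact: le_trans pc (ltW cd).
have l1 : `|P (c e) - P (a e)| <= rho e ^+ n.+2 by apply: lip2 => //; near: e.
have l2 : `|P (d e) - P (b e)| <= rho e ^+ n.+2 by apply: lip2 => //; near: e.
have l3 : `|rint (a e) (b e) (fun t => F' e (pt t)) - rint (a e) (b e) (fun t => F e (pt t))|
    <= rho e ^+ n.+2.
  rewrite -rintB; [|exact: cont_on_sub cF'|exact: cont_on_sub cF].
  have /andP[ba0 baL] : 0 <= b e - a e <= rho e ^- L by near: e.
  apply: le_trans (@rint_bound _ _ _ _ (rho e ^+ (L + n.+2)) (ltW ab) _ _) _.
  - by move=> t tI; apply: continuousB; [exact: cont_on_sub cF' t tI|exact: cont_on_sub cF t tI].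
  - by move=> t /andP[at_ tb]; apply: bd; rewrite (le_trans pa at_) (le_trans tb bq).
  apply: le_trans (ler_wpM2l _ baL) _; first exact: exprn_ge0.
  by rewrite exprD mulrAC divff ?mul1r// expf_neq0// gt_eqF.
have h1 := powS_half n r; have h2 := powS_half n.+1 r.
move: l1 l2 l3; rewrite E1 E2; move: (P _) (P _) (P _) (P _) (rint _ _ _).
have h3 : 0 <= rho e ^+ n.+2 by exact: exprn_ge0.
move: h1 h2 h3; clear; move=> h1 h2 h3 x y z w v.
rewrite !ler_norml => /andP[? ?] /andP[? ?] /andP[? ?]; apply/andP; split; lra.
Unshelve. all: by end_near. Qed.

Lemma oriented_rint (a b : R) (f : R -> R) : a < b -> oriented_integral a b f = rint a b f.
Proof.
move=> ab; rewrite /oriented_integral [X in _ - X](_ : _ = 0) ?subr0//.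
by rewrite set_itv_ge ?Rintegral_set0// bnd_simp -ltNge.
Qed.

Lemma gintegral_rep f Om F (a b : R -> R) : gnet t1 t2 f Om F -> rep t1 a -> rep t2 b ->
  rep (gintegral t1 t2 f t1 t2) (fun e => rint (a e) (b e) (fun t => F e (pt t))).
Proof.
move=> gF ra rb; have rI := rep_cls (rint_net_mod gF ra rb).
suff -> : gintegral t1 t2 f t1 t2 =
  cls (fun e => rint (a e) (b e) (fun t => F e (pt t))) by [].
apply: xget_unique.
  exists Om, (fun e x => const_mx (F e x)), a, b.
  split; [exact: gnet_gsf_net|exact: ra|exact: rb|].
  apply: (rep_near rI); near=> e; rewrite oriented_rint; last first.
    by near: e; exact: strict_near.
  by apply: eq_rint => t _; rewrite mxE.
move=> y [Om' [u [c [d [gu rc rd ry]]]]].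
have gF' := gsf_net_gnet gu.
have rz : rep y (fun e => rint (c e) (d e) (fun t => u e (pt t) 0 0)).
  apply: (rep_near ry); near=> e; rewrite oriented_rint//.
  by near: e; exact: strict_near.
apply/(rep_eq rz rI); exact: rint_net_indep gF gF' ra rb rc rd.
Unshelve. all: by end_near. Qed.

Local Notation J f := (gintegral t1 t2 f t1 t2).

Lemma gintegral_ext f g : gsmooth t1 t2 f -> (forall t, I t -> f t = g t) -> J f = J g.
Proof.
move=> [Om [F gF]] fg; have [a ra] := rep_ex t1; have [b rb] := rep_ex t2.
exact: rep_uniq (gintegral_rep gF ra rb) (gintegral_rep (gnet_ext fg gF) ra rb).
Qed.

Lemma real_in_domain Om (a b : R -> R) : net_domain X1 Om -> rep t1 a -> rep t2 b ->
  \forall e \near (0:R)^'+, [/\ 0 < e <= 1, a e < b e &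
    forall t, a e <= t <= b e -> Om e (pt t)].
Proof.
move=> dO ra rb; have KO := internal_in_domain dO (hull_internal ra rb ra rb).
near=> e; split; [by near: e; exact: near_unit|by near: e; exact: strict_near|].
move=> t tI; have : hull a b a b e (pt t) by rewrite /hull/= mxE minxx maxxx.
by move: (pt t); near: e.
Unshelve. all: by end_near. Qed.

Lemma t1_in : I t1.
Proof.
have [a ra] := rep_ex t1; have [b rb] := rep_ex t2; apply: (gcc_near ra rb ra).
by near=> e; rewrite lexx ltW//; near: e; exact: strict_near.
Unshelve. all: by end_near. Qed.

Lemma t2_in : I t2.
Proof.
have [a ra] := rep_ex t1; have [b rb] := rep_ex t2; apply: (gcc_near ra rb rb).
by near=> e; rewrite lexx andbT ltW//; near: e; exact: strict_near.
Unshelve. all: by end_near. Qed.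

Lemma gnet_at f Om F t te : gnet t1 t2 f Om F -> I t -> rep t te ->
  rep (f t) (fun e => F e (pt (te e))).
Proof.
move=> [_ _ h] It rt.
have Xt : X1 (sc t) by rewrite /line/= mxE.
have rx : vrep (sc t) (fun e => pt (te e)).
  by move=> j; rewrite mxE; under eq_fun do rewrite mxE.
by have := h _ _ Xt rx; rewrite mxE.
Qed.

Lemma gintegral_D f : gsmooth t1 t2 f -> J (D f) = f t2 - f t1.
Proof.
move=> [Om [F gF]]; have [a ra] := rep_ex t1; have [b rb] := rep_ex t2.
have gD := gnet_D t12 gF; have [dO sF _] := gF; have [_ sD _] := gD.
apply: rep_uniq (rep_near (gintegral_rep gD ra rb) _)
  (repB (gnet_at gF t2_in rb) (gnet_at gF t1_in ra)).
near=> e; have [e01 ab tO] : [/\ 0 < e <= 1, a e < b e &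
    forall t, a e <= t <= b e -> Om e (pt t)] by near: e; exact: real_in_domain.
have dF t : a e <= t <= b e -> is_derive t 1 (fun t => F e (pt t)) ('D_d0 (F e) (pt t)).
  move=> /tO Ot; have d := snet_derivable (i := 0) sF e01 Ot.
  have -> : (fun t => F e (pt t)) = (fun t => F e (0 + t *: d0)).
    by apply/funext => z; rewrite ptE.
  by have := @is_derive_line R 1 (F e) 0 d0 t; rewrite -ptE; apply; exact: d.
exact: rint_FTC ab (snet_cont_on sD e01 tO) dF.
Unshelve. all: by end_near. Qed.

Lemma gintegralB f g : gsmooth t1 t2 f -> gsmooth t1 t2 g ->
  J (fun t => f t - g t) = J f - J g.
Proof.
move=> sf sg; have [Om [F [G [gF gG]]]] := gsmooth2 sf sg.
have [a ra] := rep_ex t1; have [b rb] := rep_ex t2.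
have gB : gnet t1 t2 (fun t => f t - g t) Om (fun e x => F e x - G e x).
  have [dO sF hF] := gF; have [_ sG hG] := gG; split; first exact: dO.
    exact: snetD sF (snetN dO sG).
  by move=> x xe Xx rx; apply: repB; [exact: hF|exact: hG].
have [[dO sF _] [_ sG _]] := (gF, gG).
apply: rep_uniq (rep_near (gintegral_rep gB ra rb) _)
  (repB (gintegral_rep gF ra rb) (gintegral_rep gG ra rb)).
near=> e; have [e01 ab tO] : [/\ 0 < e <= 1, a e < b e &
    forall t, a e <= t <= b e -> Om e (pt t)] by near: e; exact: real_in_domain.
by apply: rintB; [exact: snet_cont_on sF e01 tO|exact: snet_cont_on sG e01 tO].
Unshelve. all: by end_near. Qed.

End Integral.

(** * A positivity principle for the integral *)

Section Positivity.
Context {R : realType} {rho : gauge R}.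
Local Notation Rt := (gnum rho).
Variables (t1 t2 : Rt).
Hypothesis t12 : glt t1 t2.
Local Notation I := (gcc t1 t2).
Local Notation X1 := (line I).
Local Notation J f := (gintegral t1 t2 f t1 t2).

Lemma rep_exp (x : Rt) xe m : rep x xe -> rep (x ^+ m) (fun e => xe e ^+ m).
Proof.
move=> rx; elim: m => [|m IH].
  by apply: (rep_near (rep1 rho)); near=> e; rewrite expr0.
by rewrite exprS; apply: (rep_near (repM rx IH)); near=> e; rewrite exprS.
Unshelve. all: by end_near. Qed.

Definition weight m (t : Rt) : Rt := ((t - t1) * (t2 - t)) ^+ m.

Lemma gnet_weight m Om a b : net_domain X1 Om -> rep t1 a -> rep t2 b ->
  gnet t1 t2 (weight m) Om (fun e y => ((y 0 0 - a e) * (b e - y 0 0)) ^+ m).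
Proof.
move=> dO ra rb; have sx := snet_coord X1 Om (0 : 'I_1).
have s1 : snet X1 Om (fun e y => y 0 0 - a e).
  exact: snetD sx (snetN dO (snet_cst _ _ (rep_mod ra))).
have s2 : snet X1 Om (fun e y => b e - y 0 0).
  exact: snetD (snet_cst _ _ (rep_mod rb)) (snetN dO sx).
split=> //; first exact: snetX dO (snetM s1 s2).
move=> x xe Xx rx; apply: rep_exp; apply: repM; apply: repB => //; exact: rx.
Qed.

Lemma convex_hull a b c d (e : R) : convex_set (@hull R a b c d e).
Proof.
move=> y z s; rewrite /hull/= => /andP[y1 y2] /andP[z1 z2] /andP[s0 s1].
rewrite !mxE; move: (Num.min _ _) (Num.max _ _) y1 y2 z1 z2 => p q y1 y2 z1 z2.
by apply/andP; split; nra.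
Qed.

(** If [f] had size [rho ^ n] at some point, it would keep it on an interval of
    length [rho ^ M], and the integral would exceed a power of [rho]. *)
Lemma gintegral_weight_eq0 f m : gsmooth t1 t2 f ->
  J (fun t => f t * f t * weight m t) = 0 -> forall t, I t -> f t = 0.
Proof.
move=> [Om [F gF]] J0 t It.
have [a ra] := rep_ex t1; have [b rb] := rep_ex t2.
have [te0 rt0] := rep_ex t; have rt := rep_clip t12 ra rb rt0 It.
have [dO sF hF] := gF.
have gG := gnetM (gnetM gF gF) (gnet_weight m dO ra rb).
have nJ := (rep_eq0 (gintegral_rep t12 gG ra rb)).1 J0.
apply/(rep_eq0 (gnet_at gF It rt)) => n.
have iK := hull_internal t12 ra rb ra rb.
have [N hN] := snet_lipschitz dO sF iK (fun e => @convex_hull a b a b e).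
have [K hK] := glt_rep ra rb t12.
pose M := (N + n + K + 2)%N.
have hM1 : (K.+1 <= M)%N by rewrite /M; clear; lia.
have hM2 : M = (N + (n + K + 2))%N by rewrite /M; clear; lia.
have hM3 : (n.+1 <= n + K + 2)%N by clear; lia.
pose Q := (n.+1 + n.+1 + (M.+2 + M.+2) * m + M.+2)%N.
have [_ sG _] := gG.
near=> e.
have [e01 ab tO] : [/\ 0 < e <= 1, a e < b e &
    forall t, a e <= t <= b e -> Om e (pt t)] by near: e; exact: (real_in_domain t12 dO ra rb).
have r : 0 < rho e <= 2^-1 by near: e; exact: gauge_half.
have [r0 r0' r1 r2] := gauge_le1 r.
have abK : a e + rho e ^+ K <= b e by near: e.
have lipF y z : hull a b a b e y -> hull a b a b e z ->
    `|F e z - F e y| <= rho e ^- N * `|z - y| by move: y z; near: e.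
have nJe : `|rint (a e) (b e) (fun t => F e (pt t) * F e (pt t) *
    ((pt t 0 0 - a e) * (b e - pt t 0 0)) ^+ m)| <= rho e ^+ Q.+1.
  by near: e; exact: nJ.
have := clip_in (te0 e) (ltW ab); set u := clip _ _ _ => /andP[au ub].
rewrite leNgt; apply/negP => Fu.
pose dl := rho e ^+ M.
have dl0 : 0 < dl by exact: exprn_gt0.
have dlK : dl * 2 <= rho e ^+ K.
  apply: le_trans (powS_half K r); rewrite ler_wpM2r//.
  exact: ler_wiXn2l.
have dlN : rho e ^- N * dl <= rho e ^+ n.+1.
  have -> : dl = rho e ^+ N * rho e ^+ (n + K + 2).
    by rewrite /dl hM2 exprD.
  rewrite mulKf ?expf_neq0 ?gt_eqF//.
  exact: ler_wiXn2l.
have dl4 : rho e ^+ M.+2 <= dl / 4.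
  have := powS_half M r; have := powS_half M.+1 r; rewrite -/dl; clear; lra.
(* From the half of [a, b] that contains u, moving towards the other half leaves room
   for a segment of length dl / 4 at distance at least dl / 4 from both ends. *)
have [c [d [ac cd db dc inner]]] : exists c d, [/\ a e <= c, c <= d, d <= b e,
    d - c = dl / 4 & forall x, c <= x <= d -> [/\ `|x - u| <= dl, dl / 4 <= x - a e &
      dl / 4 <= b e - x]].
  have [h|/ltW h] := lerP u ((a e + b e) / 2).
    exists (u + dl / 4), (u + dl / 2); split; try (move: au ub ab dl0 dlK abK h; clear; lra).
    by move=> x /andP[x1 x2]; split; [rewrite ger0_norm|..];
      move: x1 x2 au ub ab dl0 dlK abK h; clear; lra.
  exists (u - dl / 2), (u - dl / 4); split; try (move: au ub ab dl0 dlK abK h; clear; lra).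
  by move=> x /andP[x1 x2]; split; [rewrite ler0_norm|..];
    move: x1 x2 au ub ab dl0 dlK abK h; clear; lra.
have tK x : a e <= x <= b e -> hull a b a b e (pt x).
  by rewrite /hull/= mxE minxx maxxx.
pose C := rho e ^+ n.+1 * rho e ^+ n.+1 * (rho e ^+ M.+2 * rho e ^+ M.+2) ^+ m.
have low : C * (d - c) <= rint (a e) (b e) (fun t => F e (pt t) * F e (pt t) *
    ((pt t 0 0 - a e) * (b e - pt t 0 0)) ^+ m).
  apply: rint_lower => //.
  - exact: snet_cont_on sG e01 tO.
  - move=> x /andP[ax xb]; apply: mulr_ge0.
      by rewrite -expr2 sqr_ge0.
    by rewrite mxE exprn_ge0 ?mulr_ge0 ?subr_ge0.
  move=> x xI; have [h1 h2 h3] := inner x xI.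
  have xab : a e <= x <= b e.
    by move: xI => /andP[? ?]; rewrite (le_trans ac)// (le_trans _ db).
  have uab : a e <= u <= b e by rewrite au ub.
  have l1 : `|F e (pt x) - F e (pt u)| <= rho e ^+ n.+1.
    apply: le_trans (lipF _ _ (tK u uab) (tK x xab)) _; apply: le_trans dlN.
    apply: ler_wpM2l; first by rewrite invr_ge0 exprn_ge0.
    by apply: norm_coord => [|j]; [exact: ltW|rewrite !mxE].
  have l2 : rho e ^+ n.+1 <= `|F e (pt x)|.
    have := powS_half n r; have := ler_normB (F e (pt x)) (F e (pt x) - F e (pt u)).
    by rewrite subKr; move: Fu l1; clear; lra.
  have p0 k : 0 <= rho e ^+ k by exact: exprn_ge0.
  rewrite /C mxE; apply: ler_pM.
  - by rewrite mulr_ge0.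
  - by apply: exprn_ge0; apply: mulr_ge0.
  - have -> : F e (pt x) * F e (pt x) = `|F e (pt x)| * `|F e (pt x)|.
      by rewrite -normrM ger0_norm// -expr2 sqr_ge0.
    exact: ler_pM.
  - have h2' := le_trans dl4 h2; have h3' := le_trans dl4 h3.
    have q : rho e ^+ M.+2 * rho e ^+ M.+2 <= (x - a e) * (b e - x) by exact: ler_pM.
    have q0 : 0 <= rho e ^+ M.+2 * rho e ^+ M.+2 by exact: mulr_ge0.
    by apply: lerXn2r => //; rewrite nnegrE//; exact: le_trans q.
have CQ : rho e ^+ Q <= C * (d - c).
  have p0 k : 0 <= rho e ^+ k by exact: exprn_ge0.
  have C0 : 0 <= C.
    by rewrite /C; apply: mulr_ge0; [exact: mulr_ge0|apply/exprn_ge0/mulr_ge0].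
  rewrite dc; apply: le_trans (ler_wpM2l C0 dl4).
  by rewrite /C /Q -exprD -exprD -exprM -!exprD.
have := le_trans CQ (le_trans low (le_trans (ler_norm _) nJe)).
have := powS_half Q r; have : 0 < rho e ^+ Q by exact: exprn_gt0.
by clear; lra.
Unshelve. all: by end_near. Qed.

End Positivity.

(** * Differentiation under the generalized integral *)

Section Variation.
Context {R : realType} {rho : gauge R}.
Local Notation Rt := (gnum rho).
Variables (t1 t2 : Rt).
Hypothesis t12 : glt t1 t2.
Local Notation I := (gcc t1 t2).
Local Notation X1 := (line I).
Local Notation J f := (gintegral t1 t2 f t1 t2).
Local Notation d0 := (delta_mx 0 0 : 'rV[R]_1).
Local Notation Y := (slab t1 t2 (1 : 'I_2)).
Local Notation e0 := (delta_mx 0 0 : 'rV[R]_2).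

Lemma is_derive_coord (f : R -> R) (y : 'rV[R]_1) (l : R) : is_derive (y 0 0) 1 f l ->
  is_derive y d0 (fun z : 'rV[R]_1 => f (z 0 0)) l.
Proof.
have E : (fun h : R => h^-1 *: (((fun z : 'rV[R]_1 => f (z 0 0)) \o shift y) (h *: d0) -
      f (y 0 0))) = (fun h => h^-1 *: ((f \o shift (y 0 0)) (h *: 1) - f (y 0 0))).
  by apply/funext => h /=; rewrite !mxE eqxx mulr1 [_ *: 1]mulr1.
by case=> d dE; split; [rewrite /derivable E|rewrite /derive E].
Qed.

Lemma derive_affine n k (f : 'rV[R]_n -> 'rV[R]_k) x w l :
  (forall h : R, f (h *: w + x) = f x + h *: l) -> 'D_w f x = l.
Proof.
move=> hf; apply: cvg_lim; first exact: norm_hausdorff.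
have c : (fun _ : R => l) @ (0:R)^' --> l by exact: cvg_cst.
apply: cvg_trans c; apply: near_eq_cvg.
have hn : \forall h \near (0:R)^', h != 0 by exact: nbhs_dnbhs_neq.
apply: filterS hn => h h0 /=.
by rewrite hf [_ + h *: l]addrC addrK scalerA mulVf ?scale1r.
Qed.

Lemma coord_near (y : 'rV[R]_1) (P : R -> Prop) : (\forall s \near y 0 0, P s) ->
  \forall z \near y, P ((z : 'rV[R]_1) 0 0).
Proof. exact: (@coord_continuous R 1 1 0 0 y). Qed.

(** ** Nets of integrals depending on a parameter *)

Definition param_domain (W : R -> set 'rV[R]_2) (a b : R -> R) (e : R) : set 'rV[R]_1 :=
  [set y | a e < b e /\ forall t, a e <= t <= b e -> W e (row2 (y 0 0) t)].

Definition param_int (a b : R -> R) (G : R -> 'rV[R]_2 -> R) : R -> 'rV[R]_1 -> R :=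
  fun e y => rint (a e) (b e) (fun t => G e (row2 (y 0 0) t)).

(** Over one generalized parameter the segment is internal in the strip; this gives
    the bounds, uniform in [t], on which moderateness of the integrals rests. *)
Definition slice (se : R -> R) (a b : R -> R) (e : R) : set 'rV[R]_2 :=
  [set z | z 0 0 = se e /\ a e <= z 0 1 <= b e].

Lemma slice_internal (se a b : R -> R) : se \in moderate rho -> rep t1 a -> rep t2 b ->
  internal_in Y (slice se a b).
Proof.
move=> ms ra rb; split.
  near=> e; exists (row2 (se e) (a e)); rewrite /slice/= row2_0 row2_1 lexx; split=> //.
  have ab : a e < b e by near: e; exact: (strict_near t12 ra rb).
  exact: ltW.
move=> ze hz.
have hz1 : \forall e \near (0:R)^'+, Num.min (a e) (a e) <= ze e 0 1 <= Num.max (b e) (b e).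
  near=> e; have [_ h] : slice se a b e (ze e) by near: e.
  by rewrite minxx maxxx.
have [t It rt] := rep_in_I ra rb ra rb hz1.
have rs : rep (cls se : Rt) (fun e => ze e 0 0).
  apply: (rep_near (rep_cls ms)); near=> e.
  by have [-> _] : slice se a b e (ze e) by near: e.
exists (\row_j (if j == 0 then cls se else t)); first by rewrite /slab/= mxE.
move=> j; rewrite mxE; case: eqP => [->//|/eqP].
by case: j => -[|[|]]//= i _; rewrite (_ : Ordinal i = 1)//; exact: val_inj.
Unshelve. all: by end_near. Qed.

Lemma param_net_domain W (a b : R -> R) : net_domain Y W -> rep t1 a -> rep t2 b ->
  net_domain (line (setT : set Rt)) (param_domain W a b).
Proof.
move=> dW ra rb; split=> [e e01|x _ xe rx].
  rewrite openE => y [ab Wy]; rewrite /interior.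
  have h : \forall s \near y 0 0, forall t, a e <= t <= b e -> W e (row2 s t).
    apply: compact_near_param => t /Wy Wt; apply: row2_near.
    exact: near_open (dW.1 e e01) Wt.
  by apply: filterS (coord_near h) => z hz; split.
have iK := slice_internal (rep_mod (rx 0)) ra rb.
have KO := internal_in_domain dW iK.
near=> e; split; first by near: e; exact: (strict_near t12 ra rb).
move=> t tI; have : slice (fun e => xe e 0 0) a b e (row2 (xe e 0 0) t).
  by rewrite /slice/= row2_0 row2_1.
by move: (row2 _ t); near: e.
Unshelve. all: by end_near. Qed.

Lemma param_int_derive W G (a b : R -> R) e y : net_domain Y W -> snet Y W G ->
  0 < e <= 1 -> param_domain W a b e y ->
  is_derive (y 0 0) 1 (fun s => rint (a e) (b e) (fun t => G e (row2 s t)))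
    (rint (a e) (b e) (fun t => 'D_e0 (G e) (row2 (y 0 0) t))).
Proof.
move=> dW sG e01 [ab Wy].
have h x : W e x -> [/\ {for x, continuous (G e)}, {for x, continuous ('D_e0 (G e))},
    derivable (G e) x e0 & 'D_e0 (G e) x = 'D_e0 (G e) x].
  move=> Wx; split; last by [].
  - exact: snet_continuous sG e01 Wx.
  - exact: snet_continuous (snet_partial 0 dW sG) e01 Wx.
  - exact: snet_derivable sG e01 Wx.
exact: rint_param_derive (ltW ab) (dW.1 e e01) Wy h.
Qed.

(** Differentiating under the integral sign replaces [G] by a partial derivative of
    [G], hence the class of these integrals is closed under derivation. *)
Lemma snet_param_int W G (a b : R -> R) : net_domain Y W -> rep t1 a -> rep t2 b ->
  snet Y W G -> snet (line (setT : set Rt)) (param_domain W a b) (param_int a b G).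
Proof.
move=> dW ra rb sG.
exists [set H | exists2 G, snet Y W G & H = param_int a b G]; last by exists G.
move=> _ [{sG}G sG ->]; split=> [e y e01 Py|i|x xe _ rx].
- have d := param_int_derive dW sG e01 Py; split=> [|i].
    have [/derivable1_diffP/differentiable_continuous c _] := d.
    apply: (@continuous_comp _ _ _ (fun z : 'rV[R]_1 => z 0 0)
      (fun s => rint (a e) (b e) (fun t => G e (row2 s t)))) c.
    exact: coord_continuous.
  by rewrite (ord1 i); have [] := is_derive_coord d.
- rewrite (ord1 i); exists (param_int a b (fun e x => 'D_e0 (G e) x)).
    by exists (fun e x => 'D_e0 (G e) x) => //; exact: snet_partial.
  move=> e y e01 Py.
  by have [_ ->] := is_derive_coord (param_int_derive dW sG e01 Py).
- have iK := slice_internal (rep_mod (rx 0)) ra rb.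
  have [N hN] := snet_uniform sG iK.
  have dP := param_net_domain dW ra rb.
  apply: (mod_le (modM (mod_rhoV rho N) (rep_mod (repB rb ra)))); near=> e.
  have e01 : 0 < e <= 1 by near: e; exact: near_unit.
  have [ab Wx] : param_domain W a b e (xe e).
    by near: e; exact: (dP.2 x _ xe rx).
  apply: le_trans (ler_norm _); apply: rint_bound; first exact: ltW.
    by move=> t /Wx Wt; apply: row2_continuous; exact: snet_continuous sG e01 Wt.
  move=> t tI; have : slice (fun e => xe e 0 0) a b e (row2 (xe e 0 0) t).
    by rewrite /slice/= row2_0 row2_1.
  by move: (row2 _ t); near: e.
Unshelve. all: by end_near. Qed.

Definition grow2 (s t : Rt) : 'rV[Rt]_2 := \row_j (if j == 0 then s else t).

Lemma gsf_net_slice (s : Rt) se : rep s se ->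
  gsf_net X1 (fun x => grow2 s (x 0 0)) (fun=> setT) (fun e y => row2 (se e) (y 0 0)).
Proof.
move=> rs; apply/gsf_netP; split; first exact: net_domainT.
  move=> j; have dT := @net_domainT R rho 1 X1.
  case: (eqVneq j 0) => [->|j0].
    by apply: (snet_ext dT (snet_cst _ _ (rep_mod rs))) => e x _ _; rewrite mxE.
  apply: (snet_ext dT (snet_coord X1 _ 0)) => e x _ _.
  by rewrite mxE (negbTE j0).
move=> x xe Xx rx j; rewrite mxE; under eq_fun do rewrite mxE.
by case: (j == 0); [exact: rs|exact: rx].
Qed.

Lemma grow2_Y s t : I t -> Y (grow2 s t).
Proof. by move=> It; rewrite /slab/= mxE. Qed.

Lemma param_gintegral_rep (H : 'rV[Rt]_2 -> Rt) W hv (a b : R -> R) (s : Rt) se :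
  gsf_net Y (fun x => sc (H x)) W hv -> rep t1 a -> rep t2 b -> rep s se ->
  rep (J (fun t => H (grow2 s t)))
      (fun e => param_int a b (fun e x => hv e x 0 0) e (pt (se e))).
Proof.
move=> gH ra rb rs.
have gc := gsf_net_comp (gsf_net_slice rs) (fun x => @grow2_Y s (x 0 0)) gH.
have gc' := @gsf_net_gnet _ _ t1 t2 (fun t => H (grow2 s t)) _ _ gc.
apply: (rep_near (gintegral_rep t12 gc' ra rb)); near=> e.
by rewrite /param_int; apply: eq_rint => t _ /=; rewrite !mxE.
Unshelve. all: by end_near. Qed.

(** Both sides are represented by the integral of the partial derivative of the net
    of [H]; on the left the point 0 is interior to the whole line, on the right
    the strip is regular. *)
Lemma gder_param (H : 'rV[Rt]_2 -> Rt) : gsf Y (fun x => sc (H x)) ->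
  gder_sc setT (fun s => J (fun t => H (grow2 s t))) 0 =
  J (fun t => gpartial Y 0 (fun x => sc (H x)) (grow2 0 t) 0 0).
Proof.
move=> [W [hv gH]]; have [a ra] := rep_ex t1; have [b rb] := rep_ex t2.
have [dW vh _] := (gsf_netP _ _ _ _).1 gH.
pose HN e (x : 'rV[R]_2) := hv e x 0 0; have sH : snet Y W HN by exact: (vh 0).
pose Phi s := J (fun t => H (grow2 s t)).
have dP := param_net_domain dW ra rb.
have gPhi : gsf_net (line setT) (fun x => sc (Phi (x 0 0))) (param_domain W a b)
    (fun e y => const_mx (param_int a b HN e y)).
  apply/gsf_netP; split; first exact: dP.
    move=> j; apply: (snet_ext dP (snet_param_int dW ra rb sH)) => e x _ _.
    by rewrite mxE.
  move=> x xe _ rx j; rewrite mxE; under eq_fun do rewrite mxE (pt00 (xe _)).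
  exact: param_gintegral_rep gH ra rb (rx 0).
have i0 : sharp_interior (line (setT : set Rt)) (sc 0).
  by exists (cls (fun e => rho e ^+ 0)); [exact: glt0_rhoX|].
have r0 : vrep (sc (0 : Rt)) (fun=> pt 0).
  by move=> j; rewrite mxE; under eq_fun do rewrite mxE; exact: rep0.
have rL := gpartial_interior 0 gPhi i0 r0 0.
have [B rB] : exists B, regular Y B by exists (real_slab 1 a b); exact: regular_slab.
have gP := gpartial_net 0 rB gH.
have gP' : gsf_net Y (fun x => sc (gpartial Y 0 (fun x => sc (H x)) x 0 0)) W
    (fun e => partial 0 (hv e)).
  by apply: gsf_net_ext gP => x _; rewrite sc00.
have rR := param_gintegral_rep gP' ra rb (rep0 rho).
rewrite -[LHS]/(gpartial (line setT) 0 (fun x => sc (Phi (x 0 0))) (sc 0) 0 0).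
apply: rep_uniq (rep_near rL _) rR.
near=> e.
have e01 : 0 < e <= 1 by near: e; exact: near_unit.
have Pe : param_domain W a b e (pt 0) by near: e; exact: (dP.2 (sc 0) _ _ r0).
have -> : partial 0 (fun y => const_mx (param_int a b HN e y) : 'rV[R]_1) (pt 0) 0 0 =
    'D_d0 (fun y => (const_mx (param_int a b HN e y) : 'rV[R]_1) 0 0) (pt 0).
  by near: e; exact: (partial_coord 0 0 gPhi _ r0).
have -> : (fun y => (const_mx (param_int a b HN e y) : 'rV[R]_1) 0 0) = param_int a b HN e.
  by apply/funext => y; rewrite mxE.
have [_ ->] := is_derive_coord (param_int_derive dW sH e01 Pe).
rewrite /param_int; apply: eq_rint => t tI.
have Wt : W e (row2 (pt 0 0 0) t) by exact: Pe.2.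
have [oW _ _] := gH; have [_ sm] := oW e e01; have [_ d] := sm [::] _ Wt.
by rewrite -(derive_coord 0 (d 0)).2.
Unshelve. all: by end_near. Qed.

(** ** The two dimensional family [c t + s v t] *)

Section Family.
Variables (p : nat) (c v : Rt -> 'rV[Rt]_p).
Hypotheses (sc_ : gsf1 I c) (sv_ : gsf1 I v).

Definition family (x : 'rV[Rt]_2) : 'rV[Rt]_p := c (x 0 1) + x 0 0 *: v (x 0 1).

Lemma family_net : exists Om (u V : R -> 'rV[R]_2 -> 'rV[R]_p),
  [/\ gsf_net Y family Om (fun e x => u e x + x 0 0 *: V e x),
      gsf_net Y (fun x => v (x 0 1)) Om V &
      forall e x h, u e (h *: e0 + x) = u e x /\ V e (h *: e0 + x) = V e x].
Proof.
have pY : gsf_net Y (fun x => sc (x 0 1)) (fun=> setT) (fun e x => pt (x 0 1)).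
  apply/gsf_netP; split; first exact: net_domainT.
    move=> j; apply: (snet_ext (@net_domainT R rho _ Y) (snet_coord Y _ 1)) => e x _ _.
    by rewrite mxE.
  by move=> x xe Yx rx j; rewrite mxE; under eq_fun do rewrite mxE; exact: rx.
have YX x : Y x -> X1 (sc (x 0 1)) by rewrite /line/= mxE.
have [Oc [uc gc]] := sc_; have [Ov [uv gv]] := sv_.
have gc1 := gsf_net_comp pY YX gc; have gv1 := gsf_net_comp pY YX gv.
have [dc nc hc] := (gsf_netP _ _ _ _).1 gc1.
have [dv nv hv] := (gsf_netP _ _ _ _).1 gv1.
have dI := net_domainI dc dv.
move: dI; set Om := (X in net_domain Y X) => dI.
pose uc' e (x : 'rV[R]_2) := uc e (pt (x 0 1)).
pose uv' e (x : 'rV[R]_2) := uv e (pt (x 0 1)).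
exists Om, uc', uv'.
have nc' j : snet Y Om (fun e x => uc' e x 0 j).
  by apply: snet_sub (nc j) _ _ => // e x [].
have nv' j : snet Y Om (fun e x => uv' e x 0 j).
  by apply: snet_sub (nv j) _ _ => // e x [].
split.
- apply/gsf_netP; split; first exact: dI.
    move=> j; apply: (snet_ext dI (snetD (nc' j) (snetM (snet_coord Y _ 0) (nv' j)))).
    by move=> e x _ _; rewrite !mxE.
  move=> x xe Yx rx j; rewrite /family !mxE; under eq_fun do rewrite !mxE.
  have h1 := hc x xe Yx rx j; have h2 := hv x xe Yx rx j.
  move: h1 h2; rewrite /= !mxE => h1 h2.
  by apply: repD h1 _; apply: repM h2; exact: rx.
- apply/gsf_netP; split; first exact: dI.
    exact: nv'.
  move=> x xe Yx rx j; have := hv x xe Yx rx j; rewrite /= mxE.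
  exact.
- move=> e x h; have E : (h *: e0 + x) 0 1 = x 0 1 by rewrite !mxE mulr0 add0r.
  by rewrite /uc' /uv' E.
Qed.

Lemma gpartial_family x j : Y x -> gpartial Y 0 family x 0 j = v (x 0 1) 0 j.
Proof.
move=> Yx; have [Om [u [V [gF gV E]]]] := family_net.
have [a ra] := rep_ex t1; have [b rb] := rep_ex t2.
have [xe rx] := vrep_ex x.
have rB := regular_slab t12 (1 : 'I_2) ra rb.
have r1 := gpartial_vrep 0 rB gF Yx rx j.
have [_ _ hV] := (gsf_netP _ _ _ _).1 gV.
apply: rep_uniq (rep_near r1 _) (hV x xe Yx rx j).
near=> e; congr ((_ : 'rV[R]_p) 0 j); rewrite /partial; apply: derive_affine => h.
have [-> ->] := E e (xe e) h.
have -> : (h *: e0 + xe e) 0 0 = h + xe e 0 0 by rewrite !mxE eqxx mulr1.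
by rewrite scalerDl [h *: _ + _]addrC addrA.
Unshelve. all: by end_near. Qed.

Variables (X : set 'rV[Rt]_p) (A : R -> set 'rV[R]_p) (f : 'rV[Rt]_p -> Rt).
Hypotheses (rX : regular X A) (sf : gsf X (fun x => sc (f x))).
Hypothesis cvX : forall s t, I t -> X (c t + s *: v t).

(** The first variation in abstract form: differentiation under the integral,
    followed by the chain rule in [X]. *)
Lemma gder_family :
  gder_sc setT (fun s => J (fun t => f (c t + s *: v t))) 0 =
  J (fun t => \sum_j v t 0 j * gpartial X j (fun x => sc (f x)) (c t) 0 0).
Proof.
have [Om [u [V [gF _ _]]]] := family_net.
have [a ra] := rep_ex t1; have [b rb] := rep_ex t2.
have rB := regular_slab t12 (1 : 'I_2) ra rb.
have FX x : Y x -> X (family x) by exact: cvX.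
have sF : gsf Y family by exists Om, (fun e x => u e x + x 0 0 *: V e x).
have sfF : gsf Y (fun x => sc (f (family x))).
  by have [La [w gw]] := sf; eexists; eexists; exact: gsf_net_comp gF FX gw.
have E s : (fun t => f (c t + s *: v t)) = (fun t => f (family (grow2 s t))).
  by apply/funext => t; rewrite /family !mxE.
have -> : (fun s => J (fun t => f (c t + s *: v t))) =
    (fun s => J (fun t => f (family (grow2 s t)))) by apply/funext => s; rewrite E.
have -> := @gder_param (fun x => f (family x)) sfF.
apply: gintegral_ext; first exact: t12.
  have [W [hv gH]] := sfF.
  have gP := gpartial_net 0 rB gH.
  apply/gsmoothP; exists (comp_domain (fun=> setT) (fun e (y : 'rV[R]_1) => row2 0 (y 0 0)) W).
  exists (fun e => partial 0 (hv e) \o (fun y : 'rV[R]_1 => row2 0 (y 0 0))).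
  have := gsf_net_comp (gsf_net_slice (rep0 rho)) (fun x => @grow2_Y 0 (x 0 0)) gP.
  by apply: gsf_net_ext => x _ /=; rewrite sc00.
move=> t It; rewrite (gpartial_comp 0 rB rX sF sf FX (grow2_Y 0 It)).
apply: eq_bigr => j _; rewrite gpartial_family; last exact: grow2_Y.
by rewrite /family !mxE /= scale0r addr0.
Qed.

End Family.
End Variation.

(** * The Euler-Lagrange equations and the energy balance *)

Section DifferentialAlgebra.
Context {R : realType} {rho : gauge R}.
Local Notation Rt := (gnum rho).
Variables (t1 t2 : Rt).
Hypothesis t12 : glt t1 t2.
Local Notation I := (gcc t1 t2).
Local Notation D := (gder_sc I).
Local Notation Dn := (Dn t1 t2).
Local Notation gs := (gsmooth t1 t2).
Local Notation J f := (gintegral t1 t2 f t1 t2).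

Lemma gsmoothB (f g : Rt -> Rt) : gs f -> gs g -> gs (fun t => f t - g t).
Proof.
move=> sf sg; apply: gsmooth_ext (gsmoothD sf (gsmoothM (gsmooth_cst _ _ (-1)) sg)).
by move=> t _; rewrite mulN1r.
Qed.

Lemma D_sub (f g : Rt -> Rt) : gs f -> gs g -> forall t, I t ->
  D (fun t => f t - g t) t = D f t - D g t.
Proof.
move=> sf sg t It; rewrite -mulN1r -D_scale// -D_add//; last first.
  by apply: gsmoothM => //; exact: gsmooth_cst.
by congr (_ t); apply: D_ext => u _; rewrite mulN1r.
Qed.

Lemma Dn_lin i (f g : Rt -> Rt) s : gs f -> gs g -> forall t, I t ->
  Dn i (fun t => f t + s * g t) t = Dn i f t + s * Dn i g t.
Proof.
move=> sf sg; elim: i => [//|i IH] t It /=.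
rewrite (D_ext IH) D_add ?D_scale//; try exact: gsmooth_Dn.
by apply: gsmoothM; [exact: gsmooth_cst|exact: gsmooth_Dn].
Qed.

Lemma DnS i f : Dn i.+1 f = Dn i (D f).
Proof. exact: iterSr. Qed.

(** ** Functions vanishing to a given order *)

(** Vanishing to order [n] is expressed by divisibility, which passes to products
    and loses one order under derivation. *)
Definition vanishing (t0 : Rt) n (f : Rt -> Rt) :=
  exists2 g, gs g & forall t, I t -> f t = (t - t0) ^+ n * g t.

Lemma gsmooth_shift t0 : gs (fun t => t - t0).
Proof. by apply: gsmoothB; [exact: gsmooth_id|exact: gsmooth_cst]. Qed.

Lemma gsmooth_vanishing t0 n f : vanishing t0 n f -> gs f.
Proof.
move=> [g sg fg]; apply: gsmooth_ext (fun t It => esym (fg t It)) _.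
by apply: gsmoothM => //; exact/gsmoothX/gsmooth_shift.
Qed.

Lemma vanishingD t0 n f g : vanishing t0 n f -> vanishing t0 n g ->
  vanishing t0 n (fun t => f t + g t).
Proof.
move=> [f1 sf hf] [g1 sg hg]; exists (fun t => f1 t + g1 t); first exact: gsmoothD.
by move=> t It; rewrite hf// hg// mulrDr.
Qed.

Lemma vanishing_shift t0 n f : vanishing t0 n f ->
  vanishing t0 n.+1 (fun t => (t - t0) * f t).
Proof. by move=> [g sg hg]; exists g => // t It; rewrite hg// exprS mulrA. Qed.

(** With [f = (t - t0) u] one has [D f = u + (t - t0) D u], and [D u] is covered by
    the induction hypothesis. *)
Lemma vanishing_D t0 n f : vanishing t0 n.+1 f -> vanishing t0 n (D f).
Proof.
elim: n f => [|n IH] f vf.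
  exists (D f); first exact/gsmooth_D/gsmooth_vanishing/vf.
  by move=> t _; rewrite mul1r.
have [g sg hg] := vf; pose u t := (t - t0) ^+ n.+1 * g t.
have vu : vanishing t0 n.+1 u by exists g.
have su := gsmooth_vanishing vu; have sh := gsmooth_shift t0.
have E t : I t -> u t + (t - t0) * D u t = D f t.
  move=> It; rewrite -[u t]mul1r.
  have <- : D (fun t => t - t0) t = 1.
    by rewrite D_sub ?D_id ?D_cst ?subr0//; [exact: gsmooth_id|exact: gsmooth_cst].
  rewrite -D_mul//; congr (_ t); apply: D_ext => z Iz.
  by rewrite hg// /u [in RHS]exprS mulrA.
have [k sk hk] := vanishingD vu (vanishing_shift (IH u vu)).
by exists k => // t It; rewrite -E// hk.
Qed.

Lemma vanishing_Dn t0 n f i : I t0 -> vanishing t0 n f -> (i < n)%N -> Dn i f t0 = 0.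
Proof.
move=> It0; elim: n i f => [|n IH] i f vf; first by rewrite ltn0.
case: i => [_|i]; last by rewrite ltnS DnS; apply: IH; exact: vanishing_D.
by have [g _ /(_ _ It0) /= ->] := vf; rewrite subrr exprS mul0r mul0r.
Qed.

Lemma weight_vanishing1 m f : gs f -> vanishing t1 m (fun t => weight t1 t2 m t * f t).
Proof.
move=> sf; exists (fun t => (t2 - t) ^+ m * f t).
  apply: gsmoothM => //; apply: gsmoothX; apply: gsmoothB; first exact: gsmooth_cst.
  exact: gsmooth_id.
by move=> t _; rewrite /weight exprMn mulrA.
Qed.

Lemma weight_vanishing2 m f : gs f -> vanishing t2 m (fun t => weight t1 t2 m t * f t).
Proof.
move=> sf; exists (fun t => (-1) ^+ m * (t - t1) ^+ m * f t).
  apply: gsmoothM => //; apply: gsmoothM; first exact: gsmooth_cst.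
  exact/gsmoothX/gsmooth_shift.
move=> t _; rewrite /weight -[t2 - t]opprB mulrN [X in X * f t]exprNn exprMn; ring.
Qed.

(** ** The momenta identity *)

(** The recursion makes the terms [P j * Dn j w] telescope. With [w] a component of
    the variation this is the integration by parts of the first variation; with
    [w] a component of the velocity it is the energy balance. *)
Lemma momenta_identity m (G P : nat -> Rt -> Rt) w :
  (forall j, gs (P j)) -> gs w ->
  (forall j, (j < m)%N -> forall t, I t -> P j t = G j t - D (P j.+1) t) ->
  (forall t, I t -> P m t = G m t) ->
  forall t, I t -> D (fun t => \sum_(0 <= j < m) P j.+1 t * Dn j w t) t =
    \sum_(0 <= j < m.+1) G j t * Dn j w t - P 0%N t * w t.
Proof.
move=> sP sw rec last t It.
rewrite D_sum//; last by move=> j; apply: gsmoothM => //; exact: gsmooth_Dn.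
rewrite big_nat_recr//= -last// -addrA.
have -> : P m t * Dn m w t - P 0%N t * w t =
    \sum_(0 <= j < m) (P j.+1 t * Dn j.+1 w t - P j t * Dn j w t).
  by rewrite (telescope_sumr (fun j => P j t * Dn j w t)).
rewrite -big_split/=; apply: eq_big_nat => j /andP[_ jm].
rewrite D_mul//; last exact: gsmooth_Dn.
have -> : G j t = P j t + D (P j.+1) t by rewrite rec// subrK.
by rewrite /=; ring.
Qed.

End DifferentialAlgebra.

Section EulerLagrange.
Context {R : realType} {rho : gauge R}.
Local Notation Rt := (gnum rho).
Variables (t1 t2 : Rt) (d m : nat).
Hypothesis t12 : glt t1 t2.
Variable L : 'rV[Rt]_(1 + m.+1 * d) -> Rt.
Local Notation I := (gcc t1 t2).
Local Notation D := (gder_sc I).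
Local Notation Dn := (Dn t1 t2).
Local Notation gs := (gsmooth t1 t2).
Local Notation J f := (gintegral t1 t2 f t1 t2).
Local Notation X := (jet_domain t1 t2 (d := d) (m := m)).
Local Notation jetq q := (jet t1 t2 m q).
Hypothesis sL : gsf X (fun x => sc (L x)).

Implicit Types q h : Rt -> 'rV[Rt]_d.
Local Notation time := (lshift (m.+1 * d) (0 : 'I_1)).
Local Notation coord i k := (rshift 1 (mxvec_index (i : 'I_m.+1) (k : 'I_d))).

Lemma jet_domainE : X = slab t1 t2 time.
Proof. by apply/predeqP => x; rewrite /jet_domain/slab/= mxE. Qed.

Lemma regular_jet : exists A, regular X A.
Proof.
have [a ra] := rep_ex t1; have [b rb] := rep_ex t2.
by exists (real_slab time a b); rewrite jet_domainE; exact: regular_slab.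
Qed.

Lemma jet_time q t : jetq q t 0 time = t.
Proof. by rewrite row_mxEl mxE. Qed.

Lemma jet_coord q t i k : jetq q t 0 (coord i k) = gdern I i q t 0 k.
Proof. by rewrite row_mxEr mxvecE mxE. Qed.

Lemma jet_in q t : I t -> X (jetq q t).
Proof. by move=> It; rewrite jet_domainE /slab/= jet_time. Qed.

Lemma jet_index (j : 'I_(1 + m.+1 * d)) (P : 'I_(1 + m.+1 * d) -> Prop) :
  P time -> (forall i k, P (coord i k)) -> P j.
Proof.
move=> Pt Pc; case: (split_ordP j) => k ->.
  by rewrite (ord1 k).
by case/mxvec_indexP: k => i k; exact: Pc.
Qed.

Lemma jet_sum (F : 'I_(1 + m.+1 * d) -> Rt) :
  \sum_j F j = F time + \sum_(i < m.+1) \sum_(k < d) F (coord i k).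
Proof.
rewrite big_split_ord/= big_ord1; congr (_ + _).
rewrite (reindex _ (curry_mxvec_bij _ _)) /=.
by rewrite pair_bigA; apply: eq_bigr => -[].
Qed.

Lemma jet_gsmooth q : gsf1 I q -> forall j, gs (fun t => jetq q t 0 j).
Proof.
move=> sq j; apply: (@jet_index j (fun j => gs (fun t => jetq q t 0 j))) => [|i k].
  by apply: gsmooth_ext (gsmooth_id _ _) => t _; rewrite jet_time.
have [sqi _] := gdern_coord t12 i sq.
apply: gsmooth_ext ((gsf1P _ _ _).1 sqi k) => t _; rewrite jet_coord//.
Qed.

Definition jetv (h : Rt -> 'rV[Rt]_d) (t : Rt) : 'rV[Rt]_(1 + m.+1 * d) :=
  row_mx 0 (mxvec (\matrix_(i < m.+1) gdern I i h t)).

Lemma jetv_time h t : jetv h t 0 time = 0.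
Proof. by rewrite row_mxEl mxE. Qed.

Lemma jetv_coord h t i k : jetv h t 0 (coord i k) = gdern I i h t 0 k.
Proof. by rewrite row_mxEr mxvecE mxE. Qed.

Lemma jetv_gsmooth h : gsf1 I h -> forall j, gs (fun t => jetv h t 0 j).
Proof.
move=> sh j; apply: (@jet_index j (fun j => gs (fun t => jetv h t 0 j))) => [|i k].
  by apply: gsmooth_ext (gsmooth_cst _ _ 0) => t _; rewrite jetv_time.
have [shi _] := gdern_coord t12 i sh.
apply: gsmooth_ext ((gsf1P _ _ _).1 shi k) => t _; rewrite jetv_coord//.
Qed.

Lemma gsf1_shift q h s : gsf1 I q -> gsf1 I h -> gsf1 I (fun t => q t + s *: h t).
Proof.
move=> /gsf1P sq /gsf1P sh; apply/gsf1P => k.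
apply: gsmooth_ext (gsmoothD (sq k) (gsmoothM (gsmooth_cst _ _ s) (sh k))) => t _.
by rewrite !mxE.
Qed.

Lemma jet_shift q h s t : gsf1 I q -> gsf1 I h -> I t ->
  jetq (fun t => q t + s *: h t) t = jetq q t + s *: jetv h t.
Proof.
move=> sq sh It; apply/rowP => j; rewrite [in RHS]mxE [X in _ + X]mxE.
apply: (@jet_index j (fun j => jetq (fun t => q t + s *: h t) t 0 j =
  jetq q t 0 j + s * jetv h t 0 j)) => [|i k].
  by rewrite !jet_time jetv_time mulr0 addr0.
rewrite !jet_coord jetv_coord.
have [_ ->//] := gdern_coord t12 i (gsf1_shift s sq sh).
have [_ ->//] := gdern_coord t12 i sq; have [_ ->//] := gdern_coord t12 i sh.
move: sq sh => /gsf1P sq /gsf1P sh; rewrite -Dn_lin//.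
by apply: Dn_ext => // u _; rewrite !mxE.
Qed.

Definition Lgrad q (i : 'I_m.+1) (k : 'I_d) (t : Rt) : Rt :=
  gpartial X (coord i k) (fun x => sc (L x)) (jetq q t) 0 0.

Lemma Lagr_gradE q i k t : Lagr_grad t1 t2 L i (jetq q t) 0 k = Lgrad q i k t.
Proof. by rewrite mxE. Qed.

Lemma Lgrad_gsmooth q i k : gsf1 I q -> gs (Lgrad q i k).
Proof.
move=> sq; have [A rA] := regular_jet; have [La [v gv]] := sL.
apply: (@gsmooth_comp _ _ t1 t2 _ X
  (fun x => gpartial X (coord i k) (fun x => sc (L x)) x 0 0) (jetq q)).
- exists La, (fun e => partial (coord i k) (v e)).
  by apply: gsf_net_ext (gpartial_net (coord i k) rA gv) => x _; rewrite sc00.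
- exact: jet_gsmooth.
- exact: jet_in.
Qed.

(** On [t1, t2] the jet of [q + s h] runs along the line of direction [jetv h], which
    is the situation of [gder_family]. *)
Lemma first_variationE q h : gsf1 I q -> gsf1 I h ->
  first_variation t1 t2 L q h =
  J (fun t => \sum_(i < m.+1) \sum_(k < d) Lgrad q i k t * Dn i (fun s => h s 0 k) t).
Proof.
move=> sq sh; have [A rA] := regular_jet.
have sj := (gsf1P t1 t2 (jetq q)).2 (jet_gsmooth sq).
have sv := (gsf1P t1 t2 (jetv h)).2 (jetv_gsmooth sh).
have inX s t : I t -> X (jetq q t + s *: jetv h t).
  by move=> It; rewrite -jet_shift//; exact: jet_in.
have E : (fun s => action t1 t2 L (fun t => q t + s *: h t)) =
    (fun s => J (fun t => L (jetq q t + s *: jetv h t))).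
  apply/funext => s; apply: gintegral_ext; first exact: t12.
    apply: (@gsmooth_comp _ _ t1 t2 _ X L); first exact: sL.
      exact: jet_gsmooth (gsf1_shift s sq sh).
    by move=> t; exact: jet_in.
  by move=> t It; rewrite jet_shift.
rewrite /first_variation E (gder_family t12 sj sv rA sL inX).
have S t : I t -> \sum_(i < m.+1) \sum_(k < d) Lgrad q i k t * Dn i (fun s => h s 0 k) t =
    \sum_j jetv h t 0 j * gpartial X j (fun x => sc (L x)) (jetq q t) 0 0.
  move=> It; rewrite jet_sum jetv_time mul0r add0r.
  apply: eq_bigr => i _; apply: eq_bigr => k _; rewrite jetv_coord mulrC.
  by have [_ ->] := gdern_coord t12 i sh.
apply/esym/gintegral_ext; [exact: t12| |exact: S].
apply: gsmooth_sum => i; apply: gsmooth_sum => k; apply: gsmoothM.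
  exact: Lgrad_gsmooth.
by apply: gsmooth_Dn => //; exact: (gsf1P _ _ _).1 sh k.
Qed.

Lemma D_Lagrangian q : gsf1 I q -> forall t, I t ->
  D (fun t => L (jetq q t)) t = Lagr_time t1 t2 L (jetq q t) +
    \sum_(i < m.+1) \sum_(k < d) Lgrad q i k t * Dn i.+1 (fun s => q s 0 k) t.
Proof.
move=> sq t It; have [A rA] := regular_jet.
rewrite (D_comp t12 rA sL (jet_gsmooth sq) (fun t => @jet_in q t) It) jet_sum.
congr (_ + _).
  rewrite (D_ext (g := id)); last by move=> u _; rewrite jet_time.
  by rewrite D_id// mul1r.
apply: eq_bigr => i _; apply: eq_bigr => k _; rewrite mulrC; congr (_ * _).
have [_ h] := gdern_coord t12 i sq.
by rewrite (D_ext (g := Dn i (fun s => q s 0 k)))// => u Iu; rewrite jet_coord h.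
Qed.

(** The components of [momentum], written as iterated scalar derivatives on which the
    algebra of the derivation operates. *)
Definition mom q (k : 'I_d) (j : nat) (t : Rt) : Rt :=
  \sum_(0 <= i < (m - j).+1) (-1) ^+ i * Dn i (Lgrad q (inord (i + j)) k) t.

Lemma mom_gsmooth q k j : gsf1 I q -> gs (mom q k j).
Proof.
move=> sq; apply: gsmooth_sum => i; apply: gsmoothM; first exact: gsmooth_cst.
by apply: gsmooth_Dn => //; exact: Lgrad_gsmooth.
Qed.

Lemma momentumE q j k t : gsf1 I q -> I t ->
  momentum t1 t2 L j q t 0 k = mom q k j t.
Proof.
move=> sq It; rewrite /momentum /mom summxE; apply: eq_bigr => i _; rewrite mxE.
congr (_ * _).
have sg : gsf1 I (fun s => Lagr_grad t1 t2 L (inord (i + j)) (jetq q s)).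
  apply/gsf1P => k'; apply: gsmooth_ext (Lgrad_gsmooth (inord (i + j)) k' sq) => u _.
  by rewrite Lagr_gradE.
have [_ ->//] := gdern_coord t12 i sg.
by apply: Dn_ext => // u _; rewrite Lagr_gradE.
Qed.

Lemma mom_rec q k j : gsf1 I q -> (j < m)%N -> forall t, I t ->
  mom q k j t = Lgrad q (inord j) k t - D (mom q k j.+1) t.
Proof.
move=> sq jm t It; rewrite /mom -subSS subSn// big_nat_recl//= mul1r add0n; congr (_ + _).
have sG i : gs (fun t => (-1) ^+ i * Dn i (Lgrad q (inord (i + j.+1)) k) t).
  apply: gsmoothM; first exact: gsmooth_cst.
  by apply: gsmooth_Dn => //; exact: Lgrad_gsmooth.
rewrite D_sum// -sumrN; apply: eq_bigr => i _.
rewrite D_scale//; last by apply: gsmooth_Dn => //; exact: Lgrad_gsmooth.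
by rewrite addnS addSn exprS mulN1r mulNr.
Qed.

Lemma mom_last q k t : mom q k m t = Lgrad q (inord m) k t.
Proof. by rewrite /mom subnn big_nat1 mul1r add0n. Qed.

Lemma sum_inord (F : 'I_m.+1 -> Rt) :
  \sum_(0 <= j < m.+1) F (inord j) = \sum_(i < m.+1) F i.
Proof. by rewrite big_mkord; apply: eq_bigr => i _; rewrite inord_val. Qed.

Lemma mom_identity q k w : gsf1 I q -> gs w -> forall t, I t ->
  D (fun t => \sum_(0 <= j < m) mom q k j.+1 t * Dn j w t) t =
  \sum_(i < m.+1) Lgrad q i k t * Dn i w t - mom q k 0 t * w t.
Proof.
move=> sq sw t It.
rewrite (momenta_identity t12 (fun j => mom_gsmooth k j sq) sw
  (G := fun j => Lgrad q (inord j) k)) //;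
  [|by move=> j jm u Iu; exact: mom_rec|by move=> u _; rewrite mom_last].
congr (_ - _); rewrite -(sum_inord (fun i => Lgrad q i k t * Dn i w t)).
by apply: eq_big_nat => j /andP[_ jm]; rewrite inordK.
Qed.

(** The Euler-Lagrange equations: test with [weight * mom q k 0] in the [k]-th
    direction, which is admissible and makes the integrand a weighted square. *)
Lemma euler_lagrange q k : gsf1 I q -> weak_extremal t1 t2 L q ->
  forall t, I t -> mom q k 0 t = 0.
Proof.
move=> sq ext.
have sP := mom_gsmooth k 0 sq.
pose w t := weight t1 t2 m t * mom q k 0 t.
have v1 : vanishing t1 t2 t1 m w by exact: weight_vanishing1.
have v2 : vanishing t1 t2 t2 m w by exact: weight_vanishing2.
have sw : gs w by exact: gsmooth_vanishing v1.
have I1 := t1_in t12; have I2 := t2_in t12.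
pose h t : 'rV[Rt]_d := w t *: delta_mx 0 k.
have hE k' t : h t 0 k' = (k' == k)%:R * w t by rewrite !mxE eqxx/= mulrC.
have hDn i k' t : I t -> Dn i (fun s => h s 0 k') t = (k' == k)%:R * Dn i w t.
  move=> It; rewrite -[RHS]add0r.
  have -> : 0 = Dn i (fun=> 0) t.
    elim: (i : nat) t It => [//|j IH] t It /=.
    by rewrite (D_ext (g := fun=> 0)) ?D_cst// => u /IH.
  rewrite -Dn_lin//; last exact: gsmooth_cst.
  by apply: Dn_ext => // u _; rewrite hE add0r.
have sh : gsf1 I h.
  apply/gsf1P => k'.
  apply: gsmooth_ext (gsmoothM (gsmooth_cst _ _ (k' == k)%:R) sw) => t _.
  by rewrite hE.
have adm : admissible_variation t1 t2 m h.
  split=> // i im; have [_ hi] := gdern_coord t12 i sh.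
  split; apply/rowP => k'; rewrite hi// hDn// [RHS]mxE.
    by rewrite (vanishing_Dn t12 I1 v1 im) mulr0.
  by rewrite (vanishing_Dn t12 I2 v2 im) mulr0.
have dJ := ext h adm; rewrite first_variationE// in dJ.
pose A t := \sum_(i < m.+1) Lgrad q i k t * Dn i w t.
have sA : gs A.
  by apply: gsmooth_sum => i; apply: gsmoothM;
    [exact: Lgrad_gsmooth|exact: gsmooth_Dn].
have JA : J A = 0.
  rewrite -dJ; apply: gintegral_ext => // t It; apply: eq_bigr => i _.
  rewrite (bigD1 k)//= hDn// eqxx mul1r big1 ?addr0// => k' /negbTE kk.
  by rewrite hDn// kk mul0r mulr0.
pose S t := \sum_(0 <= j < m) mom q k j.+1 t * Dn j w t.
have sS : gs S.
  by apply: gsmooth_sum => j; apply: gsmoothM;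
    [exact: mom_gsmooth|exact: gsmooth_Dn].
have S1 : S t1 = 0.
  rewrite /S big_nat big1// => j /andP[_ jm].
  by rewrite (vanishing_Dn t12 I1 v1 jm) mulr0.
have S2 : S t2 = 0.
  rewrite /S big_nat big1// => j /andP[_ jm].
  by rewrite (vanishing_Dn t12 I2 v2 jm) mulr0.
have sPw : gs (fun t => mom q k 0 t * w t) by exact: gsmoothM.
have JP : J (fun t => mom q k 0 t * w t) = 0.
  have := gintegral_D t12 sS; rewrite S1 S2 subrr.
  rewrite (gintegral_ext t12 (gsmooth_D t12 sS) (mom_identity k sq sw)).
  by rewrite (gintegralB t12 sA sPw) JA sub0r => /eqP; rewrite oppr_eq0 => /eqP.
apply: (gintegral_weight_eq0 t12 (m := m) sP).
rewrite -JP; apply/esym/gintegral_ext => // t It; rewrite /w; ring.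
Qed.

End EulerLagrange.

Theorem theorem47 (R : realType) (rho : gauge R) (t1 t2 : gnum rho)
  (d m : nat) (L : 'rV[gnum rho]_(1 + m.+1 * d) -> gnum rho)
  (q : gnum rho -> 'rV[gnum rho]_d) :
  glt t1 t2 -> (0 < d)%N -> (0 < m)%N ->
  gsf (jet_domain t1 t2 (d := d) (m := m)) (fun x => sc (L x)) ->
  gsf1 (gcc t1 t2) q ->
  weak_extremal t1 t2 L q ->
  forall t, gcc t1 t2 t ->
    gder_sc (gcc t1 t2)
      (fun s => L (jet t1 t2 m q s) -
        \sum_(1 <= j < m.+1) dot (momentum t1 t2 L j q s)
                                 (gdern (gcc t1 t2) j q s)) t
    = Lagr_time t1 t2 L (jet t1 t2 m q t).
Proof.
move=> t12 _ _ sL sq ext t It.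
pose qk k s := q s 0 k; pose v k := gder_sc (gcc t1 t2) (qk k).
have sqk k : gsmooth t1 t2 (qk k) by exact: (gsf1P _ _ _).1 sq k.
have sv k : gsmooth t1 t2 (v k) by exact: gsmooth_D.
pose S k s := \sum_(0 <= j < m) mom t1 t2 L q k j.+1 s * Dn t1 t2 j (v k) s.
have sS k : gsmooth t1 t2 (S k).
  by apply: gsmooth_sum => j; apply: gsmoothM; [exact: mom_gsmooth|exact: gsmooth_Dn].
have sLj : gsmooth t1 t2 (fun s => L (jet t1 t2 m q s)).
  by apply: (gsmooth_comp sL); [exact: jet_gsmooth|exact: jet_in].
(* The derivative of order j of q is the one of order j - 1 of the velocity v: the sum
   is the one of [mom_identity] with w a component of v. *)
rewrite (D_ext (g := fun s => L (jet t1 t2 m q s) - \sum_k S k s)); last first.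
  move=> s Is; congr (_ - _); rewrite big_add1 /S [RHS]exchange_big/=.
  apply: eq_bigr => j _; apply: eq_bigr => k _; rewrite momentumE//.
  by have [_ ->//] := gdern_coord t12 j.+1 sq; rewrite DnS.
rewrite D_sub//; last exact: gsmooth_sum.
rewrite D_sum// D_Lagrangian// -[RHS]addr0 -addrA; congr (_ + _).
rewrite exchange_big/= -sumrB big1// => k _.
rewrite /S mom_identity// (euler_lagrange t12 sL k sq ext It)// mul0r subr0.
rewrite -sumrB big1// => i _.
by rewrite -[gder_sc _ _ t]/(Dn t1 t2 i.+1 (qk k) t) DnS subrr.
Qed.
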